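(* Let $\mathcal{G}$ be a finite connected simple graph with more than one vertex. Then there exists an elliptic minimal Sullivan algebra $\mathcal{M}_{\mathcal{G}}$ such that the automorphism group of $\mathcal{G}$ is isomorphic to the group of self-homotopy equivalences of $\mathcal{M}_{\mathcal{G}}$, that is, $\operatorname{Aut}(\mathcal{G})\cong\mathcal{E}(\mathcal{M}_{\mathcal{G}})$.
   Context: Graphs are simple (undirected, without loops). $\operatorname{Aut}(\mathcal{G})$ is the group of permutations $\sigma$ of the vertex set such that $(v,w)$ is an edge if and only if $(\sigma(v),\sigma(w))$ is an edge. All algebras are over $\mathbb{Q}$. For a graded vector space $W$, $\Lambda W$ is the free graded commutative algebra on $W$. A Sullivan algebra is a commutative differential graded algebra $(\Lambda W,d)$ with $W$ concentrated in degrees $\ge 2$ and finite-dimensional in each degree; it is minimal if $d(W)\subset\Lambda^{\ge2}W$, and elliptic if both $W$ and $H^*(\Lambda W,d)$ are finite-dimensional. Two morphisms $\phi_0,\phi_1:(\Lambda W,d)\to(A,d)$ into a commutative differential graded algebra are homotopic if there is a morphism $H:(\Lambda W,d)\to (A,d)\otimes(\Lambda(t,dt),d)$, with $\deg t=0$, $\deg dt=1$ and $d(t)=dt$, such that $(\mathrm{id}\cdot\epsilon_i)H=\phi_i$ for $i=0,1$, where $\epsilon_i:\Lambda(t,dt)\to\mathbb{Q}$ is the augmentation with $\epsilon_i(t)=i$. $\mathcal{E}(\mathcal{M})$ is the group of homotopy classes of self-homotopy equivalences of $\mathcal{M}$, i.e. the group of invertible elements of the monoid $[\mathcal{M},\mathcal{M}]$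 of homotopy classes of differential graded algebra endomorphisms. *)

(* Defs.v *)
From HB Require Import structures.
From mathcomp Require Import all_boot all_order all_fingroup all_algebra.
From mathcomp Require Import boolp classical_sets.

Set Implicit Arguments.
Unset Strict Implicit.
Unset Printing Implicit Defensive.

Import GRing.Theory.
Local Open Scope ring_scope.

(* A direct sum decomposition A = (+)_n A^n is given by its projections       *)
(* [comp n : A -> A^n]; hence [x] lies in A^n iff [comp n x = x].             *)
Record gcAlgebra := GCAlgebra {
  gca_sort :> algType rat;
  comp : nat -> {linear gca_sort -> gca_sort};
  comp_comp : forall m n x, comp m (comp n x) = if m == n then comp n x else 0;
  comp_sum : forall x, exists N, x = \sum_(n < N) comp n x;
  comp_one : comp 0%N 1 = 1;
  comp_mul : forall m n x y, comp m x = x -> comp n y = y ->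
    comp (m + n)%N (x * y) = x * y;
  gc_comm : forall m n x y, comp m x = x -> comp n y = y ->
    x * y = (-1) ^+ (m * n) *: (y * x) }.

Arguments comp {g} n.

Definition homog (A : gcAlgebra) (n : nat) (x : A) : Prop := comp n x = x.

Record cdga := CDGA {
  cdga_gca :> gcAlgebra;
  diff : {linear cdga_gca -> cdga_gca};
  diff_homog : forall n x, homog n x -> homog n.+1 (diff x);
  diff_mul : forall n x y, homog n x ->
    diff (x * y) = diff x * y + (-1) ^+ n *: (x * diff y);
  diff_diff : forall x, diff (diff x) = 0 }.

Arguments diff {c}.

Record gcMorphism (A B : gcAlgebra) := GCMorphism {
  gcm_fun :> {lrmorphism A -> B};
  gcm_homog : forall n x, homog n x -> homog n (gcm_fun x) }.

Record dgMorphism (A B : cdga) := DGMorphism {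
  dgm_gcm :> gcMorphism A B;
  dgm_diff : forall x, dgm_gcm (diff x) = diff (dgm_gcm x) }.

Section IdComp.
Variables A B C : cdga.

Lemma gcm_id_homog n (x : A) :
  homog n x -> homog n ((idfun : {lrmorphism A -> A}) x).
Proof. by []. Qed.

Definition gcm_id : gcMorphism A A := GCMorphism gcm_id_homog.

Lemma dgm_id_diff x : gcm_id (diff x) = diff (gcm_id x).
Proof. by []. Qed.

Definition dgm_id : dgMorphism A A := DGMorphism dgm_id_diff.

Variables (g : dgMorphism B C) (f : dgMorphism A B).

Lemma gcm_comp_homog n (x : A) :
  homog n x -> homog n ((g \o f : {lrmorphism A -> C}) x).
Proof. by move=> hx /=; apply/gcm_homog/gcm_homog. Qed.

Definition gcm_comp : gcMorphism A C := GCMorphism gcm_comp_homog.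

Lemma dgm_comp_diff x : gcm_comp (diff x) = diff (gcm_comp x).
Proof. by rewrite /= !dgm_diff. Qed.

Definition dgm_comp : dgMorphism A C := DGMorphism dgm_comp_diff.
End IdComp.

Section Sign.
Variable A : gcAlgebra.
Implicit Types x y : A.

Lemma comp_sumW x : exists N0, forall N, (N0 <= N)%N -> x = \sum_(n < N) comp n x.
Proof.
have [N0 e] := comp_sum x; exists N0 => N le; rewrite {1}e.
rewrite (big_ord_widen_cond N predT (fun n => comp n x)) // big_mkcond /=.
apply: eq_bigr => i _; case: ltnP => // h.
rewrite e raddf_sum big1 //= => j _; rewrite comp_comp.
by case: eqP => // ij; move: (ltn_ord j); rewrite -ij ltnNge h.
Qed.

Lemma comp_bound x : exists N, forall n, (N <= n)%N -> comp n x = 0.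
Proof.
have [N e] := comp_sum x; exists N => n h.
rewrite e raddf_sum big1 //= => j _; rewrite comp_comp.
by case: eqP => // ij; move: (ltn_ord j); rewrite -ij ltnNge h.
Qed.

Lemma homog_comp n x : homog n (comp n x).
Proof. by rewrite /homog comp_comp eqxx. Qed.

Lemma homog_neq m n x : homog n x -> m != n -> comp m x = 0.
Proof. by move=> <- /negPf e; rewrite comp_comp e. Qed.

Lemma comp_ext x y : (forall n, comp n x = comp n y) -> x = y.
Proof.
move=> e; have [N hx] := comp_sumW x; have [M hy] := comp_sumW y.
rewrite (hx _ (leq_maxl N M)) (hy _ (leq_maxr N M)).
by apply: eq_bigr => i _.
Qed.

(* The degree involution, x |-> (-1)^|x| x on homogeneous elements. *)
Definition sgn x : A :=
  \sum_(n < sval (cid (comp_bound x))) (-1) ^+ n *: comp n x.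

Lemma comp_sgn n x : comp n (sgn x) = (-1) ^+ n *: comp n x.
Proof.
rewrite /sgn; case: cid => N /= hN; rewrite raddf_sum /=.
under eq_bigr => i _ do rewrite linearZ /= comp_comp.
case: (ltnP n N) => h; last first.
  rewrite hN // scaler0 big1 // => i _.
  by case: eqP => [e|_]; rewrite ?scaler0 //; move: (ltn_ord i); rewrite -e ltnNge h.
rewrite (bigD1 (Ordinal h)) //= eqxx big1 ?addr0 // => i ne.
by case: eqP => [e|_]; rewrite ?scaler0 //; case/eqP: ne; apply: val_inj.
Qed.

Lemma sgn_homog n x : homog n x -> sgn x = (-1) ^+ n *: x.
Proof.
move=> h; apply: comp_ext => m; rewrite comp_sgn linearZ /=.
by have [->//|ne] := eqVneq m n; rewrite (homog_neq h ne) !scaler0.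
Qed.

Lemma sgn_linear : linear sgn.
Proof.
move=> a x y; apply: comp_ext => n.
by rewrite comp_sgn linearP /= [RHS]linearP /= !comp_sgn scalerDr !scalerA mulrC.
Qed.

HB.instance Definition _ := GRing.isLinear.Build rat A A *:%R sgn sgn_linear.

Lemma homog_ind (P : A -> Prop) : P 0 -> (forall x y, P x -> P y -> P (x + y)) ->
  (forall n x, homog n x -> P x) -> forall x, P x.
Proof.
move=> P0 PD Ph x; have [N ->] := comp_sum x.
by elim/big_ind: _ => // i _; apply: (Ph i); apply: homog_comp.
Qed.

Lemma sgn_mul x y : sgn (x * y) = sgn x * sgn y.
Proof.
elim/homog_ind: x => [|x x' hx hx'|m x hx].
- by rewrite mul0r linear0 mul0r.
- by rewrite mulrDl !linearD /= hx hx' -mulrDl.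
elim/homog_ind: y => [|y y' hy hy'|n y hy].
- by rewrite mulr0 linear0 mulr0.
- by rewrite mulrDr !linearD /= hy hy' -mulrDr.
rewrite (sgn_homog hx) (sgn_homog hy) (sgn_homog (comp_mul hx hy)).
by rewrite -scalerAl -scalerAr scalerA exprD.
Qed.

Lemma sgn_one : sgn 1 = 1.
Proof. by rewrite (sgn_homog (comp_one A)) scale1r. Qed.

HB.instance Definition _ := GRing.isMonoidMorphism.Build A A sgn (conj sgn_one sgn_mul).

Lemma sgnK x : sgn (sgn x) = x.
Proof.
apply: comp_ext => n.
by rewrite !comp_sgn scalerA -exprD addnn -mul2n exprM sqrrN !expr1n scale1r.
Qed.

End Sign.

Section PolyAux.
Variable A : gcAlgebra.
Implicit Types (p q : {poly A}) (c : rat).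

Definition qscale c p : {poly A} := c%:A *: p.

Definition phomog n p := forall i, homog n p`_i.

Lemma coef_qscale c p i : (qscale c p)`_i = c *: p`_i.
Proof. by rewrite coefZ mulr_algl. Qed.

Lemma qscaleA a b p : qscale a (qscale b p) = qscale (a * b) p.
Proof. by apply/polyP => i; rewrite !coef_qscale scalerA. Qed.

Lemma qscale1 p : qscale 1 p = p.
Proof. by apply/polyP => i; rewrite coef_qscale scale1r. Qed.

Lemma qscaleDr a p q : qscale a (p + q) = qscale a p + qscale a q.
Proof. exact: scalerDr. Qed.

Lemma qscaleDl p a b : qscale (a + b) p = qscale a p + qscale b p.
Proof. by rewrite /qscale scalerDl scalerDl. Qed.

Lemma qscaleAl a p q : qscale a (p * q) = qscale a p * q.
Proof. exact: scalerAl. Qed.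

Lemma qscaleAr a p q : qscale a (p * q) = p * qscale a q.
Proof.
apply/polyP => i; rewrite coef_qscale !coefM scaler_sumr.
by apply: eq_bigr => j _; rewrite coef_qscale scalerAr.
Qed.

Lemma map_qscale (B : gcAlgebra) (f : {linear A -> B}) a p :
  map_poly f (a%:A *: p) = a%:A *: map_poly f p.
Proof.
by apply/polyP => i; rewrite !(coef_map, coefZ) /= !mulr_algl linearZ.
Qed.

Lemma deriv_map (f : {linear A -> A}) p : (map_poly f p)^`() = map_poly f p^`().
Proof. by apply/polyP => i; rewrite !(coef_map, coef_deriv) /= raddfMn. Qed.

Lemma homog0 n : homog n (0 : A).
Proof. exact: linear0. Qed.

Lemma homogD n (x y : A) : homog n x -> homog n y -> homog n (x + y).
Proof. by rewrite /homog linearD => -> ->. Qed.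

Lemma homogZ n a (x : A) : homog n x -> homog n (a *: x).
Proof. by rewrite /homog linearZ => /= ->. Qed.

Lemma homogM m n (x y : A) : homog m x -> homog n y -> homog (m + n) (x * y).
Proof. exact: comp_mul. Qed.

Lemma homog_sum n (I : Type) (r : seq I) (P : pred I) (F : I -> A) :
  (forall i, P i -> homog n (F i)) -> homog n (\sum_(i <- r | P i) F i).
Proof. by move=> h; elim/big_ind: _ => //; [apply: homog0|apply: homogD]. Qed.

Lemma phomogP n p : phomog n p <-> map_poly (comp n) p = p.
Proof.
split=> [h|<- i]; last by rewrite coef_map; apply: homog_comp.
by apply/polyP => i; rewrite coef_map; apply: h.
Qed.

Lemma phomog0 n : phomog n 0.
Proof. by move=> i; rewrite coef0; apply: homog0. Qed.

Lemma phomogD n p q : phomog n p -> phomog n q -> phomog n (p + q).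
Proof. by move=> hp hq i; rewrite coefD; apply: homogD. Qed.

Lemma phomogM m n p q : phomog m p -> phomog n q -> phomog (m + n) (p * q).
Proof.
by move=> hp hq i; rewrite coefM; apply: homog_sum => j _; apply: homogM.
Qed.

Lemma phomog_deriv n p : phomog n p -> phomog n p^`().
Proof.
by move=> h i; rewrite coef_deriv -scaler_nat; apply/homogZ/h.
Qed.

Lemma map_sgn_phomog n p : phomog n p -> map_poly (@sgn A) p = qscale ((-1) ^+ n) p.
Proof.
by move=> h; apply/polyP => i; rewrite coef_map coef_qscale; apply: sgn_homog.
Qed.

Lemma phomog_sgn n p : phomog n p -> phomog n (map_poly (@sgn A) p).
Proof.
by move=> h i; rewrite (map_sgn_phomog h) coef_qscale; apply/homogZ/h.
Qed.

Lemma phomog_comm m n p q : phomog m p -> phomog n q ->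
  p * q = qscale ((-1) ^+ (m * n)) (q * p).
Proof.
move=> hp hq; apply/polyP => i; rewrite coef_qscale coefM coefMr scaler_sumr.
by apply: eq_bigr => j _; apply: gc_comm; [apply: hp|apply: hq].
Qed.

Lemma poly_comp_sum p : exists N0, forall N, (N0 <= N)%N ->
  p = \sum_(n < N) map_poly (comp n) p.
Proof.
pose F i := sval (cid (comp_sumW p`_i)).
exists (\max_(i < size p) F i)%N => N h; apply/polyP => i; rewrite coef_sum.
under eq_bigr => n _ do rewrite coef_map /=.
case: (ltnP i (size p)) => hi; last first.
  by rewrite nth_default // big1 // => n _; rewrite linear0.
apply: (svalP (cid (comp_sumW p`_i))).
exact: leq_trans (leq_bigmax (Ordinal hi)) h.
Qed.

End PolyAux.

(* A (x) Lambda(t, dt), with deg t = 0: the pair (p, q) of polynomials in t   *)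
(* with coefficients in A stands for p + q dt.                                *)
Definition pathAlg (A : gcAlgebra) : Type := ({poly A} * {poly A})%type.

Section PathAlg.
Variable A : gcAlgebra.
Local Notation P := (pathAlg A).
Local Notation s := (map_poly (@sgn A)).
Implicit Types u v w : P.

HB.instance Definition _ := GRing.Zmodule.copy P ({poly A} * {poly A})%type.

(* dt . a = (-1)^|a| a dt and dt . dt = 0. *)
Definition pmul u v : P := (u.1 * v.1, u.1 * v.2 + u.2 * s v.1).

Lemma pmulA : associative pmul.
Proof.
move=> [p q] [p1 q1] [p2 q2]; rewrite /pmul /=; congr pair; first exact: mulrA.
by rewrite rmorphM !mulrDr mulrDl !mulrA addrA.
Qed.

Lemma pmul1 : left_id (1, 0) pmul.
Proof. by case=> p q; rewrite /pmul /= !mul1r mul0r addr0. Qed.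

Lemma pmulr1 : right_id (1, 0) pmul.
Proof. by case=> p q; rewrite /pmul /= rmorph1 !mulr1 mulr0 add0r. Qed.

Lemma pmulDl : left_distributive pmul +%R.
Proof.
case=> p q [p1 q1] [p2 q2]; rewrite /pmul /=; congr pair; rewrite /= ?mulrDl //.
by rewrite addrACA.
Qed.

Lemma pmulDr : right_distributive pmul +%R.
Proof.
case=> p q [p1 q1] [p2 q2]; rewrite /pmul /=; congr pair; rewrite /= ?mulrDr //.
by rewrite rmorphD mulrDr addrACA.
Qed.

Lemma p1_neq0 : (1, 0) != 0 :> P.
Proof. by apply/eqP; case=> /eqP; rewrite oner_eq0. Qed.

HB.instance Definition _ := GRing.Zmodule_isNzRing.Build P
  pmulA pmul1 pmulr1 pmulDl pmulDr p1_neq0.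

Definition pscale (c : rat) u : P := (qscale c u.1, qscale c u.2).

Lemma pscaleA a b u : pscale a (pscale b u) = pscale (a * b) u.
Proof. by rewrite /pscale /= !qscaleA. Qed.

Lemma pscale1 : left_id 1 pscale.
Proof. by case=> p q; rewrite /pscale /= !qscale1. Qed.

Lemma pscaleDr : right_distributive pscale +%R.
Proof. by move=> a [p q] [p1 q1]; rewrite /pscale /= !qscaleDr. Qed.

Lemma pscaleDl u a b : pscale (a + b) u = pscale a u + pscale b u.
Proof. by rewrite /pscale !qscaleDl. Qed.

HB.instance Definition _ := GRing.Zmodule_isLmodule.Build rat P
  pscaleA pscale1 pscaleDr pscaleDl.

Lemma pscaleAl (a : rat) u v : a *: (u * v) = a *: u * v.
Proof.
case: u v => [p q] [p1 q1]; rewrite /GRing.scale /= /pscale /GRing.mul /= /pmul /=.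
by rewrite qscaleDr !qscaleAl.
Qed.

HB.instance Definition _ := GRing.Lmodule_isLalgebra.Build rat P pscaleAl.

Lemma pscaleAr (a : rat) u v : a *: (u * v) = u * (a *: v).
Proof.
case: u v => [p q] [p1 q1]; rewrite /GRing.scale /= /pscale /GRing.mul /= /pmul /=.
by rewrite qscaleDr !qscaleAr /qscale map_qscale.
Qed.

HB.instance Definition _ := GRing.Lalgebra_isAlgebra.Build rat P pscaleAr.

Definition pcomp (n : nat) u : P :=
  (map_poly (comp n) u.1, if n is m.+1 then map_poly (comp m) u.2 else 0).

Lemma pcomp_linear n : linear (pcomp n).
Proof.
move=> a [p q] [p1 q1]; rewrite /pcomp; congr pair => /=.
  by rewrite raddfD /= map_qscale.
case: n => [|n] /=; first by rewrite /qscale scaler0 addr0.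
by rewrite raddfD /= map_qscale.
Qed.

HB.instance Definition _ n := GRing.isLinear.Build rat P P *:%R (pcomp n) (pcomp_linear n).

Lemma map_comp_comp m n (p : {poly A}) :
  map_poly (comp m) (map_poly (comp n) p) = if m == n then map_poly (comp n) p else 0.
Proof.
apply/polyP => i; rewrite !coef_map /= comp_comp.
by case: ifP; rewrite ?coef_map ?coef0.
Qed.

Lemma pcomp_comp m n u : pcomp m (pcomp n u) = if m == n then pcomp n u else 0.
Proof.
rewrite /pcomp /= map_comp_comp; case: m n => [|m] [|n] //=.
- by rewrite raddf0.
- by rewrite map_comp_comp eqSS; case: ifP.
Qed.

Lemma pcomp_sum u : exists N, u = \sum_(n < N) pcomp n u.
Proof.
case: u => p q; have [N hp] := poly_comp_sum p; have [M hq] := poly_comp_sum q.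
exists (maxn N M).+1.
have fstS K (F : 'I_K -> P) : (\sum_i F i).1 = \sum_i (F i).1.
  by apply: (big_morph (fun u : P => u.1)).
have sndS K (F : 'I_K -> P) : (\sum_i F i).2 = \sum_i (F i).2.
  by apply: (big_morph (fun u : P => u.2)).
rewrite [RHS]surjective_pairing fstS sndS /=; congr pair.
  by apply: hp; rewrite leqW // leq_maxl.
rewrite big_ord_recl /= add0r; under eq_bigr => i _ do rewrite /=.
by apply: hq; rewrite leq_maxr.
Qed.

Lemma pcomp_one : pcomp 0 1 = 1.
Proof.
rewrite /pcomp /=; congr pair; apply/polyP => i; rewrite coef_map /= coef1.
by case: i => [|i] /=; rewrite ?comp_one ?linear0.
Qed.

Lemma pcompP n u : pcomp n u = u <->
  phomog n u.1 /\ (if n is m.+1 then phomog m u.2 else u.2 = 0).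
Proof.
case: u => p q; rewrite /pcomp /=; split.
  by case=> /phomogP hp hq; split=> //; case: n {hp} hq => [|n] // /phomogP.
by case=> /phomogP -> hq; congr pair; case: n hq => [->|n /phomogP].
Qed.

Lemma pcomp_mul m n u v : pcomp m u = u -> pcomp n v = v ->
  pcomp (m + n) (u * v) = u * v.
Proof.
case: u v => [p q] [p1 q1] /pcompP /= [hp hq] /pcompP /= [hp1 hq1].
apply/pcompP; rewrite /GRing.mul /= /pmul /=; split; first exact: phomogM.
case: m hp hq => [|m] hp hq; case: n hp1 hq1 => [|n] hp1 hq1; subst.
- by rewrite addn0 mulr0 mul0r addr0.
- by rewrite add0n mul0r addr0; apply: (phomogM hp hq1).
- by rewrite addn0 mulr0 add0r -[m]addn0; apply: phomogM => //; apply: phomog_sgn.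
rewrite addSn; apply: phomogD; first by rewrite addnS -addSn; apply: phomogM.
by apply: phomogM => //; apply: phomog_sgn.
Qed.

Lemma pgc_comm m n u v : pcomp m u = u -> pcomp n v = v ->
  u * v = (-1) ^+ (m * n) *: (v * u).
Proof.
case: u v => [p q] [p1 q1] /pcompP /= [hp hq] /pcompP /= [hp1 hq1].
rewrite /GRing.scale /= /pscale /GRing.mul /= /pmul /=; congr pair.
  exact: phomog_comm.
rewrite (map_sgn_phomog hp) (map_sgn_phomog hp1) -!qscaleAr qscaleDr addrC.
have sq k : (-1) ^+ (k * 2) = 1 :> rat by rewrite mulnC exprM sqrrN !expr1n.
congr (_ + _).
  case: m hp hq => [|m] hp hq; first by rewrite hq mul0r mulr0 /qscale !scaler0.
  rewrite (phomog_comm hq hp1) !qscaleA -exprD; congr qscale.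
rewrite qscaleA; case: n hp1 hq1 => [|n] hp1 hq1.
  by rewrite hq1 mul0r mulr0 /qscale !scaler0.
rewrite (phomog_comm hp hq1) -exprD mulnS -addnA [(_ + m)%N]addnC addnA addnn.
by rewrite -muln2 exprD sq mul1r.
Qed.

Definition pathGca : gcAlgebra :=
  @GCAlgebra P pcomp pcomp_comp pcomp_sum pcomp_one pcomp_mul pgc_comm.

End PathAlg.

Section PathCdga.
Variable A : cdga.
Local Notation P := (pathGca A).
Local Notation s := (map_poly (@sgn A)).
Local Notation D := (map_poly (@diff A)).
Implicit Types u v w : P.

(* d(p + q dt) = dp + ((-1)^|p| p' + dq) dt, as p' dt is obtained by moving   *)
(* dt to the right of the coefficients of p.                                  *)
Definition pdiff u : P := (D u.1, s u.1^`() + D u.2).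

Lemma pdiff_linear : linear pdiff.
Proof.
move=> a [p q] [p1 q1]; rewrite /pdiff; congr pair => /=.
  by rewrite raddfD /= map_qscale.
rewrite !raddfD /= derivZ !map_qscale qscaleDr.
by rewrite addrACA.
Qed.

HB.instance Definition _ := GRing.isLinear.Build rat P P *:%R pdiff pdiff_linear.

Lemma phomog_diff n (p : {poly A}) : phomog n p -> phomog n.+1 (D p).
Proof. by move=> h i; rewrite coef_map; apply/diff_homog/h. Qed.

Lemma map_diff_mul n (p q : {poly A}) : phomog n p ->
  D (p * q) = D p * q + qscale ((-1) ^+ n) (p * D q).
Proof.
move=> h; apply/polyP => i; rewrite coefD coef_qscale coef_map !coefM raddf_sum.
rewrite scaler_sumr -big_split; apply: eq_bigr => j _ /=.
by rewrite !coef_map /= (diff_mul _ (h _)).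
Qed.

Lemma sgn_diff (x : A) : sgn (diff x) = - diff (sgn x).
Proof.
elim/homog_ind: x => [|x y hx hy|n x hx].
- by rewrite !linear0.
- have DD (u v : A) : diff (u + v) = diff u + diff v by exact: linearD.
  have SD (u v : A) : sgn (u + v) = sgn u + sgn v by exact: linearD.
  by rewrite !(DD, SD) hx hy opprD.
rewrite (sgn_homog hx) (sgn_homog (diff_homog hx)) linearZ /= exprS mulN1r.
by rewrite scaleNr.
Qed.

Lemma map_sgn_diff (p : {poly A}) : s (D p) = - D (s p).
Proof. by apply/polyP => i; rewrite coefN !coef_map; apply: sgn_diff. Qed.

Lemma pdiff_homog n u : homog n u -> homog n.+1 (pdiff u).
Proof.
case: u => p q /pcompP /= [hp hq]; apply/pcompP; split=> /=.
  exact: phomog_diff.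
apply: phomogD; first by apply/phomog_sgn/phomog_deriv.
case: n hp hq => [|n] _ hq; last exact: phomog_diff.
by rewrite hq raddf0; apply: phomog0.
Qed.

Lemma pdiff_mul n u v : homog n u ->
  pdiff (u * v) = pdiff u * v + (-1) ^+ n *: (u * pdiff v).
Proof.
case: u v => [p q] [p1 q1] /pcompP /= [hp hq].
rewrite /GRing.scale /= /pscale /GRing.mul /= /pmul /pdiff /=; congr pair => /=.
  exact: map_diff_mul.
rewrite derivM !raddfD /= !rmorphM /= (map_diff_mul q1 hp) (map_sgn_phomog hp).
rewrite -qscaleAl mulrDr !qscaleDr mulrDl.
have -> : D (q * s p1) = D q * s p1 + qscale ((-1) ^+ n) (q * s (D p1)).
  case: n hp hq => [|n] _ hq.
    by rewrite hq raddf0 !mul0r raddf0 /qscale scaler0 addr0.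
  rewrite (map_diff_mul _ hq) map_sgn_diff mulrN exprS mulN1r; congr (_ + _).
  by apply/polyP => i; rewrite !coef_qscale coefN scalerN scaleNr opprK.
by rewrite [LHS](AC (2*(2*2)) ((3*(1*5))*((2*4)*6))).
Qed.

Lemma map_diff_diff (p : {poly A}) : D (D p) = 0.
Proof. by apply/polyP => i; rewrite !coef_map coef0; apply: diff_diff. Qed.

Lemma pdiff_diff u : pdiff (pdiff u) = 0.
Proof.
case: u => p q; rewrite /pdiff /=; congr pair; first exact: map_diff_diff.
by rewrite raddfD /= map_diff_diff addr0 deriv_map map_sgn_diff addNr.
Qed.

Definition pathCdga : cdga :=
  @CDGA P pdiff pdiff_homog pdiff_mul pdiff_diff.

(* id . epsilon_i : A (x) Lambda(t, dt) -> A, sending t to i and dt to 0. *)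
Definition aug (i : rat) (u : pathCdga) : A := (u.1).[i%:A].

End PathCdga.

Definition homotopic (M A : cdga) (f0 f1 : dgMorphism M A) : Prop :=
  exists H : dgMorphism M (pathCdga A),
    forall x, aug 0 (H x) = f0 x /\ aug 1 (H x) = f1 x.

(* A is the free graded commutative algebra Lambda W on the graded vector     *)
(* space W, included by [iota].                                               *)
Definition free_gca (A : gcAlgebra) (W : nat -> vectType rat)
    (iota : forall n, {linear W n -> A}) : Prop :=
  forall (B : gcAlgebra) (f : forall n, {linear W n -> B}),
    (forall n w, homog n (f n w)) ->
    (exists g : gcMorphism A B, forall n w, g (iota n w) = f n w) /\
    (forall g1 g2 : gcMorphism A B,
      (forall n w, g1 (iota n w) = f n w) ->
      (forall n w, g2 (iota n w) = f n w) -> g1 =1 g2).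

(* Each [gen n] is finite-dimensional, being a [vectType].                    *)
Record sullivan := Sullivan {
  sul_cdga :> cdga;
  gen : nat -> vectType rat;
  incl : forall n, {linear gen n -> sul_cdga};
  incl_homog : forall n w, homog n (incl n w);
  incl_free : free_gca incl;
  gen_ge2 : forall n, (n < 2)%N -> \dim {:gen n} = 0%N }.

Section SullivanNotions.
Variable M : sullivan.

Definition generator (x : M) : Prop := exists n (w : gen M n), x = incl M n w.

(* Lambda^{>= k} W, spanned by the products of at least k elements of W.      *)
Definition Lambda_ge (k : nat) (x : M) : Prop :=
  exists ms : seq (rat * seq M),
    (forall m, m \in ms ->
       (k <= size m.2)%N /\ (forall y, y \in m.2 -> generator y)) /\
    x = \sum_(m <- ms) m.1 *: \prod_(y <- m.2) y.

Definition minimal : Prop := forall n (w : gen M n), Lambda_ge 2 (diff (incl M n w)).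

Definition finite_dim_generators : Prop :=
  exists N, forall n, (N <= n)%N -> \dim {:gen M n} = 0%N.

(* ker d / im d is spanned by the classes of finitely many cocycles.          *)
Definition finite_dim_cohomology : Prop :=
  exists zs : seq M,
    (forall z, z \in zs -> diff z = 0) /\
    (forall z : M, diff z = 0 ->
       exists (c : nat -> rat) (b : M),
         z = \sum_(i < size zs) c i *: zs`_i + diff b).

Definition elliptic : Prop := finite_dim_generators /\ finite_dim_cohomology.

End SullivanNotions.

Section SelfEquivalences.
Variable M : cdga.
Local Open Scope classical_set_scope.

Definition hclass (f : dgMorphism M M) : set (dgMorphism M M) :=
  [set g | homotopic f g].

(* Composition of homotopy classes: the class of f \o g for f in C, g in D.   *)
Definition hmul (C D : set (dgMorphism M M)) : set (dgMorphism M M) :=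
  [set h | exists f g, [/\ C f, D g & homotopic (dgm_comp f g) h]].

Definition hone : set (dgMorphism M M) := hclass (dgm_id M).

Definition self_equivalences : set (set (dgMorphism M M)) :=
  [set C | range hclass C /\
           exists D, [/\ range hclass D, hmul C D = hone & hmul D C = hone]].

End SelfEquivalences.

Section GraphAut.
Variables (V : finType) (e : rel V).

Definition graph_aut : {set {perm V}} :=
  finset (fun s : {perm V} => [forall v, forall w, e v w == e (s v) (s w)]).

Lemma graph_autP (s : {perm V}) :
  reflect (forall v w, e v w = e (s v) (s w)) (s \in graph_aut).
Proof.
rewrite inE; apply: (iffP forallP) => h v.
  by move=> w; apply/eqP; move/forallP: (h v); apply.
by apply/forallP => w; apply/eqP.
Qed.

Lemma graph_aut_group_set : group_set graph_aut.
Proof.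
apply/group_setP; split; first by apply/graph_autP => v w; rewrite !perm1.
move=> s t /graph_autP hs /graph_autP ht; apply/graph_autP => v w.
by rewrite !permM -ht -hs.
Qed.

Canonical graph_aut_group := Group graph_aut_group_set.

End GraphAut.

(* In [{perm V}] the product [s * t] is the composite t \o s, whence the      *)
(* order of the factors on the right-hand side.                               *)
Definition aut_iso_self_equivalences (V : finType) (e : rel V) (M : cdga) : Prop :=
  exists Phi : {perm V} -> set (dgMorphism M M),
    [/\ {in graph_aut e &, injective Phi},
        (forall C, self_equivalences C <-> exists2 s, s \in graph_aut e & C = Phi s) &
        {in graph_aut e &, forall s t, Phi (s * t)%g = hmul (Phi t) (Phi s)}].

(* Main.v *)
(* The model is that of Costoya and Viruel: generators x1, x2, x_v (v in V) of *)
(* degrees 8, 10, 40 and y1, y2, y3, z, z_v of degrees 33, 35, 37, 119, 119,   *)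
(* where the x's are cocycles and                                             *)
(*   d y1 = x1^3 x2,  d y2 = x1^2 x2^2,  d y3 = x1 x2^3,                       *)
(*   d z = y1 y2 x1^4 x2^2 - y1 y3 x1^5 x2 + y2 y3 x1^6 + x1^15 + x2^12,       *)
(*   d z_v = x_v^3 + sum_(w ~ v) x_v x_w x2^4.                                 *)
(* Finiteness of the cohomology: a power of every x is a coboundary, and these *)
(* powers form a regular sequence.                                            *)
(* Let f be a self-equivalence.  Comparing the coefficients of x1^15, x2^12    *)
(* and y1 y2 x1^4 x2^2 in d f(z) = f(d z), where f(x1) = a1 x1, f(x2) = a2 x2, *)
(* gives a1^15 = a2^12 = a1^9 a2^5, so a1 = a2 = 1.  Putting x1 = 0, x2 = 1 in *)
(* d f(z_v) = f(d z_v) gives an identity of cubic polynomials which forces     *)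
(* f(x_v) = x_(s v) for an automorphism s of the graph.  Two self-maps which   *)
(* agree on the x's differ by cocycles on the other generators; those of       *)
(* degree 33, 35, 37 vanish and those of degree 119 are coboundaries, so the   *)
(* maps are homotopic.  Conversely, as the model is 0 in degrees 7, 9 and 39,  *)
(* homotopic maps agree on the x's.                                           *)
From HB Require Import structures.
From mathcomp Require Import all_boot all_order all_fingroup all_algebra.
From mathcomp Require Import finmap.
From mathcomp.multinomials Require Import monalg.
From mathcomp Require Import ring lra zify.
From mathcomp Require boolp classical_sets.
Require Import Defs.

Set Implicit Arguments.
Unset Strict Implicit.
Unset Printing Implicit Defensive.

Import GRing.Theory Num.Theory.
Local Open Scope ring_scope.

(** * Free graded commutative algebras *)

(** The graph is stored in the differentials of the z_v: the product x_v x_w occurs in d z_v exactly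
    when v and w are adjacent. Permuting the x_v and z_v along an automorphism therefore commutes
    with d ([relabel_exists]). The remaining generators make the algebra elliptic and exclude every
    other self-equivalence.

    Homotopy classes are controlled by degrees. On a cocycle of degree n+1 a homotopy is constant if
    the model vanishes in degree n ([homotopic_cocycle]), so homotopic maps agree on the x's
    ([homotopic_agree]). Conversely, if two maps agree on the x's, their difference on an odd
    generator is a cocycle, zero for the y's ([cocycle_y]) and exact in degree 119 ([exact119]); a
    path affine in t, corrected by a primitive times dt, then joins the two images, and these paths
    define a homotopy ([agree_homotopic]). Hence a homotopy class is the same as its values on the
    x's.

    Degrees also limit these values: x1 and x2 go to multiples of themselves, and x_v to a
    combination of x1^5, x2^4 and the x_w. The pure part x1^15 + x2^12 of d z alone relates the two
    scalars by a1^15 = a2^12; its term y1 y2 x1^4 x2^2 supplies the further relation that forces a1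
    = a2 = 1 ([image_x1x2]). For the x_v one compares coefficients of the cubic polynomials d z_v
    ([rigidity]): the absence of mixed cubes leaves one nonzero entry in each row of an invertible
    matrix, the quadratic terms show that the resulting permutation preserves adjacency, and the
    entries at adjacent vertices are the squares of each other, hence equal to 1. Connectedness and
    the presence of two vertices give each vertex a neighbour ([connected_neighbour]).

    For ellipticity, a power of each even generator is exact ([power_exact]). A cocycle in the ideal
    generated by these powers is exact ([ideal_cocycle_exact]), and the quotient by the ideal is
    finite-dimensional, hence so is the cohomology ([cohomology_span]).

    The underlying algebra has basis x^a y_S with explicit signs. Its universal property, with and
    without differential, is [gcm_exists] and [dgm_exists]. *)

Section LinearExtension.
Variables (K : choiceType) (U : lmodType rat) (F : K -> U).

Definition linext (g : {malg rat[K]}) : U := \sum_(k <- msupp g) g@_k *: F k.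

Lemma linextEw (g : {malg rat[K]}) (D : {fset K}) : (msupp g `<=` D)%fset ->
  linext g = \sum_(k <- D) g@_k *: F k.
Proof.
move=> le; apply: big_fset_incl => // k _ /mcoeff_outdom ->.
by rewrite scale0r.
Qed.

Lemma linext_linear : linear linext.
Proof.
move=> a g h; pose D := (msupp g `|` msupp h)%fset.
have le : (msupp (a *: g + h) `<=` D)%fset.
  apply/fsubsetP => k; rewrite -mcoeff_neq0 mcoeffD mcoeffZ inE -!mcoeff_neq0.
  by apply: contraNT; rewrite negb_or !negbK => /andP[/eqP-> /eqP->]; rewrite mulr0 addr0.
rewrite (linextEw le) (linextEw (fsubsetUl (msupp g) (msupp h))).
rewrite (linextEw (fsubsetUr (msupp g) (msupp h))) scaler_sumr -big_split /=.
by apply: eq_bigr => k _; rewrite mcoeffD mcoeffZ scalerDl scalerA.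
Qed.

HB.instance Definition _ :=
  GRing.isLinear.Build rat {malg rat[K]} U *:%R linext linext_linear.

Lemma linext_basis k : linext << k >> = F k.
Proof. by rewrite /linext msuppU oner_eq0 big_seq_fset1 mcoeffUU scale1r. Qed.

End LinearExtension.

Lemma monalgUZ (K : choiceType) (c : rat) (k : K) : << c *g k >> = c *: << k >> :> {malg rat[K]}.
Proof. by apply/malgP => l; rewrite mcoeffZ !mcoeffU mulrnAr mulr1. Qed.

(** A free module known only through its universal property and linear induction; together with the
    opaque [free_module] this hides the representation of its elements. *)
Record basedModule (K : choiceType) := BasedModule {
  bm_sort :> lmodType rat;
  bm_bas : K -> bm_sort;
  bm_lin : forall U : lmodType rat, (K -> U) -> {linear bm_sort -> U};
  bm_linE : forall (U : lmodType rat) (F : K -> U) k, bm_lin F (bm_bas k) = F k;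
  bm_ind : forall P : bm_sort -> Prop, P 0 ->
    (forall a u v, P u -> P v -> P (a *: u + v)) -> (forall k, P (bm_bas k)) ->
    forall u, P u }.

Lemma free_module (K : choiceType) : basedModule K.
Proof.
apply: (@BasedModule K {malg rat[K]} (fun k => << k >>)
  (fun U F => (linext F : {linear {malg rat[K]} -> U}))) => [U F k|P P0 PD Pb u].
  exact: linext_basis.
rewrite [u]monalgE.
by elim/big_rec: _ => // k v _ Pv; rewrite monalgUZ; apply: PD.
Qed.

(** * Signs of exterior monomials and the free graded commutative algebra *)

Definition prec (Od : finType) (i j : Od) : bool :=
  (index i (enum Od) < index j (enum Od))%N.

(** The number of transpositions that sort the word y_S y_T. *)
HB.lock Definition inv (Od : finType) (S T : {set Od}) : nat :=
  (\sum_i \sum_j ((i \in S) * (j \in T) * prec j i))%N.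

(* The pair [(a, S)] encodes the monomial [x^a y_S], where [y_S] is the product  *)
(* of the odd generators in [S] in the order of [enum Od]; [eps S T] is the    *)
(* sign (or 0) such that [y_S y_T = eps S T y_(S :|: T)].                      *)
HB.lock Definition eps (Od : finType) (S T : {set Od}) : rat :=
  if [disjoint S & T] then (-1) ^+ inv S T else 0.

Definition monom (Ev Od : finType) : Type := ({ffun Ev -> nat} * {set Od})%type.
HB.instance Definition _ (Ev Od : finType) := Choice.on (monom Ev Od).

Definition mon1 (Ev Od : finType) : monom Ev Od := ([ffun=> 0%N], set0).
Definition monM (Ev Od : finType) (k l : monom Ev Od) : monom Ev Od :=
  ([ffun x => (k.1 x + l.1 x)%N], k.2 :|: l.2).

Section FreeAlgebra.
Variables (Ev Od : finType).

Local Notation monom := (monom Ev Od).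
Local Notation mon1 := (mon1 Ev Od).

Implicit Types (k l : monom) (S T : {set Od}) (i j : Od).

Lemma prec_total i j : i != j -> (prec i j + prec j i = 1)%N.
Proof.
rewrite /prec => ne; have : index i (enum Od) != index j (enum Od).
  by apply: contra ne => /eqP /index_inj ->; rewrite ?mem_enum.
by case: ltngtP.
Qed.

Lemma precxx i : prec i i = false.
Proof. by rewrite /prec ltnn. Qed.

Lemma disjoint_addU S T i : [disjoint S & T] ->
  ((i \in S :|: T) = (i \in S) + (i \in T) :> nat)%N.
Proof.
move=> d; rewrite inE; case: (boolP (i \in S)) => [iS|] //=.
by rewrite (disjointFr d iS).
Qed.

Lemma invUl S S' T : [disjoint S & S'] -> inv (S :|: S') T = (inv S T + inv S' T)%N.
Proof.
move=> d; rewrite inv.unlock -big_split; apply: eq_bigr => i _ /=.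
rewrite -big_split; apply: eq_bigr => j _ /=.
by rewrite disjoint_addU // !mulnDl.
Qed.

Lemma invUr S T T' : [disjoint T & T'] -> inv S (T :|: T') = (inv S T + inv S T')%N.
Proof.
move=> d; rewrite inv.unlock -big_split; apply: eq_bigr => i _ /=.
rewrite -big_split; apply: eq_bigr => j _ /=.
by rewrite disjoint_addU // mulnDr !mulnDl.
Qed.

(** Each pair in S x T is out of order in exactly one of the two concatenations. *)
Lemma inv_swap S T : [disjoint S & T] -> (inv S T + inv T S = #|S| * #|T|)%N.
Proof.
move=> d; rewrite inv.unlock [X in (_ + X)%N]exchange_big -big_split /= -!sum1_card.
rewrite big_distrl /= [RHS]big_mkcond /=; apply: eq_bigr => i _.
rewrite -big_split /= mul1n.
case: (boolP (i \in S)) => [iS|_]; last first.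
  by rewrite big1 // => j _; rewrite muln0.
rewrite [RHS]big_mkcond /=; apply: eq_bigr => j _; rewrite mul1n muln1.
case: (boolP (j \in T)) => [jT|_] //=; rewrite ?mul1n ?mul0n //.
by rewrite prec_total //; apply: contraTneq jT => ->; rewrite (disjointFr d iS).
Qed.

Lemma inv0l T : inv set0 T = 0%N.
Proof. by rewrite inv.unlock big1 // => i _; rewrite big1 // => j _; rewrite inE. Qed.

Lemma inv0r S : inv S set0 = 0%N.
Proof. by rewrite inv.unlock big1 // => i _; rewrite big1 // => j _; rewrite inE muln0. Qed.

Lemma eps0l T : eps set0 T = 1.
Proof. by rewrite eps.unlock inv0l disjoints_subset sub0set. Qed.

Lemma eps0r S : eps S set0 = 1.
Proof. by rewrite eps.unlock inv0r disjoint_sym disjoints_subset sub0set. Qed.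

(** This is associativity of the product on basis elements. It holds because [inv] is additive over
    disjoint unions in both arguments. *)
Lemma eps_cocycle S T U : eps S T * eps (S :|: T) U = eps T U * eps S (T :|: U).
Proof.
rewrite eps.unlock; have -> : [disjoint S :|: T & U] = [disjoint S & U] && [disjoint T & U].
  by rewrite -!setI_eq0 setIUl setU_eq0.
have -> : [disjoint S & T :|: U] = [disjoint S & T] && [disjoint S & U].
  by rewrite -!setI_eq0 setIUr setU_eq0.
case: (boolP [disjoint S & T]) => dST; last by rewrite mul0r mulr0.
case: (boolP [disjoint T & U]) => dTU; last by rewrite andbF mul0r mulr0.
rewrite andbT; case: (boolP [disjoint S & U]) => dSU; last by rewrite !mulr0.
by rewrite -!exprD invUl // invUr //; congr (_ ^+ _); lia.
Qed.

Lemma eps_swap S T : eps S T = (-1) ^+ (#|S| * #|T|) * eps T S.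
Proof.
rewrite eps.unlock disjoint_sym; case: (boolP [disjoint T & S]) => d; last by rewrite mulr0.
rewrite -inv_swap 1?disjoint_sym // exprD -mulrA -exprD addnn -mul2n exprM.
by rewrite sqrrN !expr1n mulr1.
Qed.

Lemma monMA : associative (@monM Ev Od).
Proof.
move=> [a S] [b T] [c U]; rewrite /monM /= setUA; congr pair.
by apply/ffunP => x; rewrite !ffunE addnA.
Qed.

Lemma monMC : commutative (@monM Ev Od).
Proof.
move=> [a S] [b T]; rewrite /monM /= setUC; congr pair.
by apply/ffunP => x; rewrite !ffunE addnC.
Qed.

Lemma monM1 : left_id mon1 (@monM Ev Od).
Proof.
move=> [a S]; rewrite /monM /= set0U; congr pair.
by apply/ffunP => x; rewrite !ffunE.
Qed.

Lemma monMr1 : right_id mon1 (@monM Ev Od).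
Proof. by move=> k; rewrite monMC monM1. Qed.

Variable fgca : basedModule monom.
Implicit Types u v w : fgca.
Local Notation bas := (bm_bas fgca).

Definition fmul u v : fgca :=
  bm_lin fgca (U := fgca) (fun k => bm_lin fgca (U := fgca) (fun l => eps k.2 l.2 *: bas (monM k l)) v) u.

Lemma fmulDl : left_distributive fmul +%R.
Proof. by move=> u v w; rewrite /fmul linearD. Qed.

Lemma fmulZl a u v : fmul (a *: u) v = a *: fmul u v.
Proof. by rewrite /fmul linearZ. Qed.

Lemma fmulPr a u v w : fmul u (a *: v + w) = a *: fmul u v + fmul u w.
Proof.
elim/(@bm_ind _ fgca): u => [|b u u' hu hu'|k].
- by rewrite /fmul !linear0 addr0.
- rewrite fmulDl fmulZl fmulDl fmulDl fmulZl fmulZl hu hu' (scalerDr b) (scalerDr a).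
  by rewrite (scalerA b) (scalerA a) [a * b]mulrC addrACA.
- by rewrite /fmul !bm_linE linearP.
Qed.

Lemma fmulDr : right_distributive fmul +%R.
Proof. by move=> u v w; rewrite -[v in LHS]scale1r fmulPr scale1r. Qed.

Lemma fmul0l v : fmul 0 v = 0.
Proof. by rewrite /fmul linear0. Qed.

Lemma fmul0r u : fmul u 0 = 0.
Proof. by have := fmulPr (-1) u 0 0; rewrite scaler0 addr0 scaleN1r addNr. Qed.

Lemma fmulZr a u v : fmul u (a *: v) = a *: fmul u v.
Proof. by rewrite -[a *: v]addr0 fmulPr fmul0r addr0. Qed.

Lemma fmul_basE k l : fmul (bas k) (bas l) = eps k.2 l.2 *: bas (monM k l).
Proof. by rewrite /fmul bm_linE bm_linE. Qed.

Lemma fmulA : associative fmul.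
Proof.
move=> u v w; elim/(@bm_ind _ fgca): u => [|a u u' hu hu'|k]; first by rewrite !fmul0l.
  by rewrite !(fmulDl, fmulZl) hu hu'.
elim/(@bm_ind _ fgca): v => [|a v v' hv hv'|l]; first by rewrite !(fmul0r, fmul0l).
  by rewrite !(fmulDl, fmulDr, fmulZl, fmulZr) hv hv'.
elim/(@bm_ind _ fgca): w => [|a w w' hw hw'|m]; first by rewrite !fmul0r.
  by rewrite !(fmulDr, fmulZr) hw hw'.
rewrite !(fmul_basE, fmulZr, fmulZl) !scalerA monMA /=.
by rewrite -eps_cocycle.
Qed.

Lemma fmul1 : left_id (bas mon1) fmul.
Proof.
elim/(@bm_ind _ fgca) => [|a u v hu hv|k]; first by rewrite fmul0r.
  by rewrite fmulPr hu hv.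
by rewrite fmul_basE monM1 eps0l scale1r.
Qed.

Lemma fmulr1 : right_id (bas mon1) fmul.
Proof.
elim/(@bm_ind _ fgca) => [|a u v hu hv|k]; first by rewrite fmul0l.
  by rewrite fmulDl fmulZl hu hv.
by rewrite fmul_basE monMr1 eps0r scale1r.
Qed.

Lemma fone_neq0 : bas mon1 != 0.
Proof.
apply/eqP => /(congr1 (bm_lin fgca (U := rat^o) (fun=> 1))); rewrite bm_linE linear0.
by apply/eqP; rewrite oner_eq0.
Qed.

Lemma fscaleAr (a : rat) u v : a *: fmul u v = fmul u (a *: v).
Proof. by rewrite fmulZr. Qed.

End FreeAlgebra.

Record freeAlg (Ev Od : finType) := FreeAlg {
  fa_alg :> algType rat;
  bas : monom Ev Od -> fa_alg;
  lin : forall U : lmodType rat, (monom Ev Od -> U) -> {linear fa_alg -> U};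
  linE : forall (U : lmodType rat) (F : monom Ev Od -> U) k, lin F (bas k) = F k;
  bas_ind : forall P : fa_alg -> Prop, P 0 ->
    (forall a u v, P u -> P v -> P (a *: u + v)) -> (forall k, P (bas k)) ->
    forall u, P u;
  bas1 : bas (mon1 Ev Od) = 1;
  basM : forall k l, bas k * bas l = eps k.2 l.2 *: bas (monM k l) }.

Section Construction.
Variables (Ev Od : finType) (V : basedModule (monom Ev Od)).

Definition twisted : Type := V.
HB.instance Definition _ := GRing.Lmodule.on twisted.

HB.instance Definition _ := GRing.Zmodule_isNzRing.Build twisted
  (@fmulA _ _ V) (@fmul1 _ _ V) (@fmulr1 _ _ V) (@fmulDl _ _ V) (@fmulDr _ _ V)
  (fone_neq0 V).
HB.instance Definition _ := GRing.Lmodule_isLalgebra.Build rat twisted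
  (fun a u v => esym (@fmulZl _ _ V a u v)).
HB.instance Definition _ := GRing.Lalgebra_isAlgebra.Build rat twisted
  (@fscaleAr _ _ V).

Definition twistedAlg : freeAlg Ev Od :=
  @FreeAlg Ev Od twisted (@bm_bas _ V) (@bm_lin _ V) (@bm_linE _ V) (@bm_ind _ V)
    erefl (@fmul_basE _ _ V).

End Construction.

Lemma free_alg (Ev Od : finType) : freeAlg Ev Od.
Proof. exact: twistedAlg (free_module _). Qed.

Lemma lrmorph_pack (A B : algType rat) (f : {linear A -> B}) :
  monoid_morphism f -> exists g : {lrmorphism A -> B}, g =1 f.
Proof.
move=> h; pose m := GRing.isMonoidMorphism.Build A B f h.
pose g : {lrmorphism A -> B} := HB.pack (f : A -> B) (GRing.Linear.class f) m.
by exists g.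
Qed.

(** * Generators and the universal property as an algebra *)

Section Generators.
Variables (Ev Od : finType).
Variable A : freeAlg Ev Od.
Local Notation bas := (bas A).
Implicit Types (k l : monom Ev Od) (S T : {set Od}) (i j : Od) (x : Ev) (u v w : A).

Definition mono_ev x : monom Ev Od := ([ffun y => (y == x : nat)], set0).
Definition mono_od j : monom Ev Od := ([ffun=> 0%N], [set j]).
Definition ev x : A := bas (mono_ev x).
Definition od j : A := bas (mono_od j).

Lemma monom_ind (P : monom Ev Od -> Prop) : P (mon1 Ev Od) ->
  (forall x k, P k -> P (monM (mono_ev x) k)) ->
  (forall j k, j \notin k.2 -> P k -> P (monM (mono_od j) k)) -> forall k, P k.
Proof.
move=> P1 Pe Po [a S].
have [n] := ubnP ((\sum_x a x) + #|S|)%N; elim: n a S => // n IH a S; rewrite ltnS => le.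
case: (pickP (fun x => 0 < a x)%N) => [x ax|a0].
  pose b := [ffun y => (a y - (y == x))%N].
  have -> : (a, S) = monM (mono_ev x) (b, S).
    rewrite /monM /= set0U; congr pair; apply/ffunP => y; rewrite !ffunE.
    by case: eqP => [->|_]; rewrite ?subnKC ?subn0.
  apply/Pe/IH; apply: leq_trans le.
  rewrite ltn_add2r [X in (_ < X)%N](bigD1 x) //= [X in (X < _)%N](bigD1 x) //=.
  rewrite ffunE eqxx -addSn; apply: leq_add; first by rewrite subn1 prednK.
  by apply: leq_sum => y _; rewrite ffunE leq_subr.
have a0' : a = [ffun=> 0%N].
  by apply/ffunP => x; rewrite ffunE; apply/eqP; rewrite -leqn0 leqNgt a0.
case: (set_0Vmem S) => [->|[j jS]]; first by rewrite a0'.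
have -> : (a, S) = monM (mono_od j) (a, S :\ j).
  rewrite /monM /= setD1K //; congr pair.
  by apply/ffunP => y; rewrite !ffunE.
apply: Po; first by rewrite !inE eqxx.
by apply/IH/(leq_trans _ le); rewrite [X in (_ < _ + X)%N](cardsD1 j S) jS addnCA add1n.
Qed.

Lemma bas_mono_ev x k : bas (monM (mono_ev x) k) = ev x * bas k.
Proof. by rewrite basM eps0l scale1r. Qed.

Lemma eps_sq S T : [disjoint S & T] -> eps S T * eps S T = 1.
Proof. by rewrite eps.unlock => ->; rewrite -exprD addnn -mul2n exprM sqrrN !expr1n. Qed.

Lemma bas_mono_od j k : j \notin k.2 ->
  bas (monM (mono_od j) k) = eps [set j] k.2 *: (od j * bas k).
Proof.
by move=> nj; rewrite basM scalerA eps_sq ?disjoints1 // scale1r.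
Qed.

Lemma ev_bas x k : ev x * bas k = bas ([ffun y => ((y == x) + k.1 y)%N], k.2).
Proof.
rewrite basM eps0l scale1r /monM /= set0U; congr (bas (_, _)).
by apply/ffunP => y; rewrite !ffunE.
Qed.

Lemma od_bas j k : od j * bas k = eps [set j] k.2 *: bas (k.1, j |: k.2).
Proof.
rewrite basM; congr (_ *: bas (_, _)).
by apply/ffunP => y; rewrite !ffunE.
Qed.

Lemma gen_ind (P : A -> Prop) :
  P 1 -> (forall a u v, P u -> P v -> P (a *: u + v)) ->
  (forall x u, P u -> P (ev x * u)) -> (forall j u, P u -> P (od j * u)) ->
  forall u, P u.
Proof.
move=> P1 PD Pe Po.
have P0 : P 0 by rewrite -[0](addNr 1) -scaleN1r; apply: PD.
have PZ a u : P u -> P (a *: u) by move=> h; rewrite -[_ *: _]addr0; apply: PD.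
elim/(@bas_ind _ _ A) => [//|//|k]; elim/monom_ind: k => [|x k IH|j k nj IH].
- by rewrite bas1.
- by rewrite bas_mono_ev; apply: Pe.
- by rewrite bas_mono_od //; apply/PZ/Po.
Qed.

Section Lift.
Variables (B : algType rat) (fe : Ev -> B) (fo : Od -> B).
Hypothesis fe_central : forall x b, fe x * b = b * fe x.
Hypothesis fo_anti : forall i j, fo i * fo j = - (fo j * fo i).

Definition lift_bas k : B :=
  (\prod_(x <- enum Ev) fe x ^+ k.1 x) * \prod_(j <- enum Od | j \in k.2) fo j.

Definition lift : A -> B := lin A (U := B) lift_bas.
HB.instance Definition _ := GRing.Linear.on lift.

Lemma lift_basE k : lift (bas k) = lift_bas k.
Proof. exact: linE. Qed.

Lemma feX_central x n b : fe x ^+ n * b = b * fe x ^+ n.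
Proof. by have /(commrX n) : GRing.comm b (fe x) by []. Qed.

Lemma prod_fe_central (r : seq Ev) (a : Ev -> nat) b :
  (\prod_(x <- r) fe x ^+ a x) * b = b * \prod_(x <- r) fe x ^+ a x.
Proof.
elim: r => [|x r IH]; first by rewrite big_nil mulr1 mul1r.
by rewrite big_cons -mulrA IH !mulrA feX_central.
Qed.

(** Anticommutation of an element with itself makes twice its square zero, and 2 is invertible in
    the rationals. *)
Lemma fo_sq j : fo j * fo j = 0.
Proof.
have /eqP := fo_anti j j; rewrite -addr_eq0 -mulr2n -scaler_nat scaler_eq0.
by rewrite pnatr_eq0 => /orP[//|/eqP].
Qed.

Lemma prod_fe_succ (r : seq Ev) (a : Ev -> nat) x :
  \prod_(y <- r) fe y ^+ ((y == x) + a y) =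
  fe x ^+ count_mem x r * \prod_(y <- r) fe y ^+ a y.
Proof.
elim: r => [|y r IH]; first by rewrite !big_nil mulr1.
rewrite !big_cons IH /= exprD -!mulrA; case: eqP => [->|_].
  by rewrite add1n exprS -mulrA; congr (_ * _); rewrite !mulrA feX_central.
by rewrite add0n expr0 mul1r !mulrA feX_central.
Qed.

(** Carrying [fo j] from the front to its place in the sorted product costs one sign for each factor
    that precedes j; if j already occurs, it meets its own copy and the square vanishes. *)
Lemma prod_fo_cons (r : seq Od) S j : j \in r -> pairwise (@prec Od) r ->
  fo j * \prod_(i <- r | i \in S) fo i =
  (if j \in S then 0 else (-1) ^+ (\sum_(i <- r) (i \in S) * prec i j)%N) *:
    \prod_(i <- r | i \in j |: S) fo i.
Proof.
elim: r j => [//|i r IH] j; rewrite inE pairwise_cons => jr /andP[/allP ir pr].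
rewrite !big_cons; case: (eqVneq j i) jr => [{j}->|ne] /= jr.
  have nir : i \notin r by apply/negP => /ir; rewrite precxx.
  rewrite setU11 precxx muln0 add0n [(\sum_(j <- r) _)%N]big1_seq ?expr0; last first.
    move=> j /andP[_ /ir h]; have : i != j by apply: contraTneq h => ->; rewrite precxx.
    by move=> /prec_total; rewrite h; case: (prec j i); rewrite ?muln0.
  have -> : \prod_(j <- r | j \in i |: S) fo j = \prod_(j <- r | j \in S) fo j.
    rewrite big_seq_cond [RHS]big_seq_cond; apply: eq_bigl => j; rewrite !inE.
    by case: eqP => [->|]; rewrite // (negPf nir).
  by case: ifP => _; rewrite ?mulrA ?fo_sq ?mul0r ?scale0r ?scale1r.
rewrite !inE [i == j]eq_sym (negPf ne) /= (ir _ jr); case: (boolP (i \in S)) => iS; last first.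
  by rewrite mul0n add0n IH.
rewrite mulrA fo_anti mulNr -mulrA IH // -scalerAr; case: ifP => _.
  by rewrite !scale0r oppr0.
by rewrite mul1n exprD expr1 mulN1r scaleNr.
Qed.

Lemma pairwise_prec_enum : pairwise (@prec Od) (enum Od).
Proof.
case: (pickP (fun _ : Od => true)) => [j _|none]; last first.
  by case: (enum Od) => // j; have := none j.
apply/(pairwiseP j) => a b; rewrite !inE => ha hb ab.
by rewrite /prec !index_uniq // enum_uniq.
Qed.

Lemma inv1l j S : inv [set j] S = (\sum_(i <- enum Od) (i \in S) * prec i j)%N.
Proof.
rewrite inv.unlock (bigD1 j) //= [X in (_ + X)%N]big1 => [|i ne]; last first.
  by rewrite big1 // => l _; rewrite inE (negPf ne).
by rewrite addn0 big_enum; apply: eq_bigr => i _; rewrite inE eqxx mul1n.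
Qed.

Lemma lift_mul_ext a b : (forall k, lift (a * bas k) = b * lift (bas k)) ->
  forall u, lift (a * u) = b * lift u.
Proof.
move=> h; elim/(@bas_ind _ _ A) => [|c u v hu hv|//].
  by rewrite mulr0 !linear0 mulr0.
by rewrite mulrDr -scalerAr linearP /= hu hv linearP mulrDr scalerAr.
Qed.

Lemma lift_ev_mul x u : lift (ev x * u) = fe x * lift u.
Proof.
apply: lift_mul_ext => k.
rewrite ev_bas !lift_basE /lift_bas /= mulrA; congr (_ * _).
rewrite -[fe x]expr1.
have := prod_fe_succ (enum Ev) k.1 x.
rewrite count_uniq_mem ?enum_uniq // mem_enum => <-.
by apply: eq_bigr => y _; rewrite ffunE.
Qed.

Lemma lift_od_mul j u : lift (od j * u) = fo j * lift u.
Proof.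
apply: lift_mul_ext => k.
rewrite od_bas linearZ /= !lift_basE /lift_bas /= mulrA -prod_fe_central -mulrA.
rewrite prod_fo_cons ?mem_enum ?pairwise_prec_enum // eps.unlock disjoints1 -inv1l.
by rewrite scalerAr; case: (j \in k.2).
Qed.

Lemma lift1 : lift 1 = 1.
Proof.
rewrite -(bas1 A) lift_basE /lift_bas /= big1 => [|x _]; last by rewrite ffunE expr0.
by rewrite big1 ?mulr1 // => j; rewrite inE.
Qed.

Lemma lift_mul u v : lift (u * v) = lift u * lift v.
Proof.
elim/gen_ind: u => [|a u u' hu hu'|x u hu|j u hu].
- by rewrite lift1 !mul1r.
- by rewrite mulrDl linearD /= -scalerAl linearZ /= hu hu' linearP /= mulrDl scalerAl.
- by rewrite -mulrA !lift_ev_mul hu mulrA.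
- by rewrite -mulrA !lift_od_mul hu mulrA.
Qed.

Lemma lift_monoid : monoid_morphism lift.
Proof. by split; [apply: lift1|apply: lift_mul]. Qed.

Lemma lift_exists : exists g : {lrmorphism A -> B},
  (forall x, g (ev x) = fe x) /\ (forall j, g (od j) = fo j).
Proof.
have [g gE] := lrmorph_pack (f := lift) lift_monoid.
exists g; split=> [x|j]; rewrite gE.
  by have := lift_ev_mul x 1; rewrite lift1 !mulr1.
by have := lift_od_mul j 1; rewrite lift1 !mulr1.
Qed.

End Lift.

Lemma lrmorph_ext (B : algType rat) (f g : {lrmorphism A -> B}) :
  (forall x, f (ev x) = g (ev x)) -> (forall j, f (od j) = g (od j)) -> f =1 g.
Proof.
move=> he ho; elim/gen_ind => [|a u v hu hv|x u hu|j u hu].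
- by rewrite !rmorph1.
- by rewrite linearP /= hu hv [RHS]linearP.
- by rewrite !rmorphM /= he hu.
- by rewrite !rmorphM /= ho hu.
Qed.

End Generators.

(** * Coefficients in the monomial basis *)

Section Coefficients.
Variables (Ev Od : finType) (A : freeAlg Ev Od).
Local Notation bas := (bas A).
Implicit Types (k l : monom Ev Od) (u v w : A).

Definition cf k : {linear A -> rat^o} := lin A (U := rat^o) (fun l => (l == k)%:R).

Lemma cf_bas k l : cf k (bas l) = (l == k)%:R.
Proof. exact: linE. Qed.

(** Allowing every duplicate-free list that contains [r] lets the supports of two summands be
    merged. *)
Lemma bas_expansion u : exists r : seq (monom Ev Od),
  forall s, uniq s -> {subset r <= s} -> u = \sum_(k <- s) cf k u *: bas k.
Proof.
elim/(@bas_ind _ _ A): u => [|a u v [r hr] [r' hr']|k].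
- by exists [::] => s _ _; rewrite big1 // => k _; rewrite linear0 scale0r.
- exists (r ++ r') => s us sub.
  under eq_bigr => k _ do rewrite linearP scalerDl -scalerA.
  rewrite big_split /= -scaler_sumr -(hr s) -?(hr' s) // => k kr; apply: sub;
    by rewrite mem_cat kr ?orbT.
- exists [:: k] => s us sub; have ks : k \in s by apply: sub; rewrite inE.
  rewrite (bigD1_seq k) //= cf_bas eqxx scale1r big1 ?addr0 // => l ne.
  by rewrite cf_bas eq_sym (negPf ne) scale0r.
Qed.

Lemma supp_ind (P : A -> Prop) u : P 0 ->
  (forall a u v, P u -> P v -> P (a *: u + v)) ->
  (forall k, cf k u != 0 -> P (bas k)) -> P u.
Proof.
move=> P0 PD Pb; have [r hr] := bas_expansion u.
rewrite [u](hr (undup r)) ?undup_uniq //; last by move=> k; rewrite mem_undup.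
elim/big_rec: _ => // k v _ Pv; case: (eqVneq (cf k u) 0) => [->|/Pb Pk].
  by rewrite scale0r add0r.
exact: PD.
Qed.

Lemma cf_ext u v : (forall k, cf k u = cf k v) -> u = v.
Proof.
move=> e; apply/eqP; rewrite -subr_eq0; apply/eqP.
apply: (@supp_ind (fun w => w = 0)) => // [a w w' -> ->|k].
  by rewrite scaler0 addr0.
by rewrite linearB /= e subrr eqxx.
Qed.

End Coefficients.

(** * The grading by weighted degree *)

Section Grading.
Variables (Ev Od : finType) (A : freeAlg Ev Od).
Variables (dE : Ev -> nat) (dO : Od -> nat).
Hypothesis dE_even : forall x, ~~ odd (dE x).
Hypothesis dO_odd : forall j, odd (dO j).
Local Notation bas := (bas A).
Local Notation ev := (ev A).
Local Notation od := (od A).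
Implicit Types (k l : monom Ev Od) (u v w : A) (S T : {set Od}) (i j : Od) (x : Ev).

Definition wdeg k : nat :=
  (\sum_x k.1 x * dE x + \sum_j (j \in k.2) * dO j)%N.

Lemma wdegM k l : [disjoint k.2 & l.2] -> wdeg (monM k l) = (wdeg k + wdeg l)%N.
Proof.
move=> d; rewrite /wdeg addnACA -!big_split /=; congr (_ + _)%N.
  by apply: eq_bigr => x _; rewrite ffunE mulnDl.
by apply: eq_bigr => j _; rewrite disjoint_addU // mulnDl.
Qed.

Lemma wdeg1 : wdeg (mon1 Ev Od) = 0%N.
Proof.
rewrite /wdeg !big1 // => [j _|x _]; first by rewrite inE.
by rewrite ffunE.
Qed.

(** Even generators do not affect parity. This turns the sign of [eps_swap], which counts odd
    generators, into the sign of graded commutativity. *)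
Lemma odd_wdeg k : odd (wdeg k) = odd #|k.2|.
Proof.
rewrite /wdeg oddD -sum1_card [in RHS]big_mkcond /=.
have -> : odd (\sum_x k.1 x * dE x)%N = false.
  by elim/big_ind: _ => // [m n|x _]; rewrite ?oddD ?oddM ?(negPf (dE_even x)) ?andbF //; case: odd; case: odd.
rewrite /=; elim/big_ind2: _ => // [a b c d|j _]; first by rewrite !oddD => -> ->.
by rewrite oddM dO_odd andbT; case: (j \in k.2).
Qed.

Definition fcomp (n : nat) : {linear A -> A} :=
  lin A (U := A) (fun k => if wdeg k == n then bas k else 0).

Lemma fcomp_bas n k : fcomp n (bas k) = if wdeg k == n then bas k else 0.
Proof. exact: linE. Qed.

Lemma cf_fcomp k n u : cf A k (fcomp n u) = if wdeg k == n then cf A k u else 0.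
Proof.
elim/(@bas_ind _ _ A): u => [|a u v hu hv|l].
- by rewrite !linear0; case: ifP.
- by rewrite !linearP /= hu hv; case: ifP => // _; rewrite scaler0 addr0.
rewrite fcomp_bas; case: (eqVneq (wdeg l) n) => [<-|ne].
  rewrite cf_bas; case: (eqVneq l k) => [->|]; first by rewrite eqxx.
  by case: ifP.
rewrite linear0 cf_bas; case: eqP => // e; case: eqP => // e'.
by rewrite e' e eqxx in ne.
Qed.

Lemma fhomogP n u : fcomp n u = u <-> forall k, cf A k u != 0 -> wdeg k = n.
Proof.
split=> [<- k|h]; first by rewrite cf_fcomp; case: (eqVneq (wdeg k)) => // _; rewrite eqxx.
apply: cf_ext => k; rewrite cf_fcomp; case: eqP => // ne.
by case: (eqVneq (cf A k u) 0) => [->|/h].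
Qed.

Lemma fhomog_ind n (P : A -> Prop) : P 0 ->
  (forall a u v, P u -> P v -> P (a *: u + v)) ->
  (forall k, wdeg k = n -> P (bas k)) -> forall u, fcomp n u = u -> P u.
Proof. by move=> P0 PD Pb u /fhomogP h; apply: supp_ind => // k /h /Pb. Qed.

Lemma fcomp_comp m n u : fcomp m (fcomp n u) = if m == n then fcomp n u else 0.
Proof.
apply: cf_ext => k; rewrite !cf_fcomp; case: (eqVneq m n) => [->|ne].
  by rewrite cf_fcomp; case: eqP.
by rewrite linear0; case: (eqVneq (wdeg k) m) => [->|//]; rewrite (negPf ne).
Qed.

Lemma fcomp_sum u : exists N, u = \sum_(n < N) fcomp n u.
Proof.
suff [N0 h] : exists N0, forall N, (N0 <= N)%N -> u = \sum_(n < N) fcomp n u.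
  by exists N0; apply: h.
elim/(@bas_ind _ _ A): u => [|a u v [N hN] [M hM]|k].
- by exists 0%N => N _; rewrite big1 // => n _; rewrite linear0.
- exists (maxn N M) => K; rewrite geq_max => /andP[lN lM].
  under eq_bigr => n _ do rewrite linearP.
  by rewrite big_split /= -scaler_sumr -(hN K) // -(hM K).
- exists (wdeg k).+1 => N lt; rewrite (bigD1 (Ordinal lt)) //= fcomp_bas eqxx.
  rewrite big1 ?addr0 // => n ne; rewrite fcomp_bas; case: eqP => // e.
  by case/eqP: ne; apply: val_inj.
Qed.

Lemma fcomp_one : fcomp 0 1 = 1.
Proof. by rewrite -(bas1 A) fcomp_bas wdeg1. Qed.

Lemma fcomp_basM k l :
  fcomp (wdeg k + wdeg l) (bas k * bas l) = bas k * bas l.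
Proof.
rewrite basM eps.unlock; case: ifP => d; last by rewrite scale0r linear0.
by rewrite linearZ /= fcomp_bas wdegM // eqxx.
Qed.

Lemma fcomp_mul m n u v : fcomp m u = u -> fcomp n v = v ->
  fcomp (m + n)%N (u * v) = u * v.
Proof.
move=> hu hv; move: u hu; apply: fhomog_ind => [|a u u' h h'|k <-].
- by rewrite mul0r linear0.
- by rewrite mulrDl -scalerAl linearP /= h h'.
move: v hv; apply: fhomog_ind => [|a v v' h h'|l <-].
- by rewrite mulr0 linear0.
- by rewrite mulrDr -scalerAr linearP /= h h'.
exact: fcomp_basM.
Qed.

Lemma fgc_comm m n u v : fcomp m u = u -> fcomp n v = v ->
  u * v = (-1) ^+ (m * n) *: (v * u).
Proof.
move=> hu hv; move: u hu; apply: fhomog_ind => [|a u u' h h'|k <-].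
- by rewrite mul0r mulr0 scaler0.
- rewrite mulrDl mulrDr -scalerAl -scalerAr h h' scalerDr !scalerA.
  by rewrite [a * _]mulrC.
move: v hv; apply: fhomog_ind => [|a v v' h h'|l <-].
- by rewrite mul0r mulr0 scaler0.
- rewrite mulrDl mulrDr -scalerAl -scalerAr h h' scalerDr !scalerA.
  by rewrite [a * _]mulrC.
rewrite !basM monMC eps_swap !scalerA; congr (_ * _ *: _).
by rewrite -signr_odd -[RHS]signr_odd !oddM !odd_wdeg.
Qed.

Definition freeGca : gcAlgebra :=
  @GCAlgebra A fcomp fcomp_comp fcomp_sum fcomp_one fcomp_mul fgc_comm.

Lemma homog_bas k : @homog freeGca (wdeg k) (bas k).
Proof. by rewrite /homog /= fcomp_bas eqxx. Qed.

Lemma wdeg_ev x : wdeg (mono_ev Od x) = dE x.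
Proof.
rewrite /wdeg /= [X in (_ + X)%N]big1 => [|j _]; last by rewrite inE.
rewrite addn0 (bigD1 x) //= ffunE eqxx mul1n big1 ?addn0 // => y /negPf ne.
by rewrite ffunE ne.
Qed.

Lemma wdeg_od j : wdeg (mono_od Ev j) = dO j.
Proof.
rewrite /wdeg /= big1 => [|x _]; last by rewrite ffunE.
by rewrite add0n (bigD1 j) //= inE eqxx mul1n big1 ?addn0 // => i /negPf ne; rewrite inE ne.
Qed.

Lemma homog_ev x : @homog freeGca (dE x) (ev x).
Proof. by rewrite -wdeg_ev; apply: homog_bas. Qed.

Lemma homog_od j : @homog freeGca (dO j) (od j).
Proof. by rewrite -wdeg_od; apply: homog_bas. Qed.

End Grading.

Section Central.
Variable A : gcAlgebra.

Lemma even_central n (u : A) : ~~ odd n -> homog n u -> forall v, u * v = v * u.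
Proof.
move=> ev hu; elim/homog_ind => [|v w hv hw|m v hv].
- by rewrite mul0r mulr0.
- by rewrite mulrDl mulrDr hv hw.
- by rewrite (gc_comm hu hv) -signr_odd oddM (negPf ev) scale1r.
Qed.

Lemma odd_anti m n (u v : A) : odd m -> odd n -> homog m u -> homog n v ->
  u * v = - (v * u).
Proof.
move=> om on hu hv.
by rewrite (gc_comm hu hv) -signr_odd oddM om on expr1 scaleN1r.
Qed.

End Central.

(** * Differentials and Sullivan algebras *)

Section Differential.
Variables (Ev Od : finType) (A : freeAlg Ev Od).
Variables (dE : Ev -> nat) (dO : Od -> nat).
Hypothesis dE_even : forall x, ~~ odd (dE x).
Hypothesis dO_odd : forall j, odd (dO j).
Local Notation bas := (bas A).
Local Notation ev := (ev A).
Local Notation od := (od A).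
Local Notation G := (freeGca A dE_even dO_odd).
Local Notation wdg := (wdeg dE dO).
Implicit Types (k l : monom Ev Od) (u v w : A) (S T : {set Od}) (i j : Od) (x : Ev).

(** The left partial derivative by the odd generator j: bring y_j to the front, then delete it. *)
Definition del j : {linear A -> A} := lin A (U := A)
  (fun k => if j \in k.2 then eps [set j] (k.2 :\ j) *: bas (k.1, k.2 :\ j) else 0).

Lemma del_bas j k : del j (bas k) =
  if j \in k.2 then eps [set j] (k.2 :\ j) *: bas (k.1, k.2 :\ j) else 0.
Proof. exact: linE. Qed.

Lemma ev_central x u : ev x * u = u * ev x.
Proof. exact: (even_central (A := G) (dE_even x) (homog_ev A dE_even dO_odd x)). Qed.

Lemma del1 j : del j 1 = 0.
Proof. by rewrite -(bas1 A) del_bas /= inE. Qed.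

Lemma del_ev_mul j x u : del j (ev x * u) = ev x * del j u.
Proof.
elim/(@bas_ind _ _ A): u => [|a u v hu hv|k].
- by rewrite mulr0 !linear0 mulr0.
- by rewrite mulrDr -scalerAr [LHS]linearP /= hu hv linearP mulrDr scalerAr.
rewrite ev_bas !del_bas /=; case: ifP => _; last by rewrite mulr0.
by rewrite -scalerAr ev_bas.
Qed.

Lemma del_od_mul i j u : del j (od i * u) = (i == j)%:R *: u - od i * del j u.
Proof.
elim/(@bas_ind _ _ A): u => [|a u v hu hv|[a S]].
- by rewrite mulr0 !linear0 mulr0 subr0.
- rewrite mulrDr -scalerAr [LHS]linearP /= hu hv linearP mulrDr -scalerAr.
  by rewrite !scalerDr scalerN !scalerA [a * _]mulrC opprD addrACA.
rewrite od_bas linearZ /= !del_bas /=.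
case: (eqVneq i j) => [->|ne].
  rewrite setU11 scale1r; case: (boolP (j \in S)) => jS.
    have -> : eps [set j] S = 0 by rewrite eps.unlock disjoints1 jS.
    rewrite scale0r -scalerAr od_bas /= scalerA eps_sq ?disjoints1 ?setD11 // scale1r.
    by rewrite setD1K // subrr.
  by rewrite mulr0 subr0 scalerA setU1K // eps_sq ?disjoints1 // scale1r.
rewrite scale0r sub0r; rewrite !inE [j == i]eq_sym (negPf ne) /=.
case: (boolP (j \in S)) => jS; last by rewrite mulr0 scaler0 oppr0.
rewrite -scalerAr od_bas /= !scalerA -scaleNr.
have eS : (i |: S) :\ j = i |: (S :\ j).
  apply/setP => l; rewrite !inE; case: (eqVneq l i) => [->|] //=.
  by rewrite ne.
rewrite eS; congr (_ *: _).
have nj : j \notin S :\ j by rewrite setD11.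
have dj : [disjoint [set j] & S :\ j] by rewrite disjoints1.
rewrite -{1}(setD1K jS) !eps.unlock !disjoints1 nj !inE [j == i]eq_sym (negPf ne) eqxx /=.
case: (boolP (i \in S)) => iS /=; first by rewrite mul0r mulr0 oppr0.
have dij : [disjoint [set i] & S :\ j] by rewrite disjoints1 !inE negb_and iS orbT.
rewrite (invUr _ dj) (invUr _ dij) -!exprD -[RHS]mulN1r -exprS.
(* The two sides remove i and j in opposite orders; exactly one of these orders is an inversion,
   which accounts for the minus sign. *)
have /(congr1 odd) : (inv [set i] [set j] + inv [set j] [set i] = 1)%N.
  by rewrite inv_swap ?cards1 // disjoints1 inE.
move=> sw; rewrite -[LHS]signr_odd -[RHS]signr_odd; move: sw; rewrite /= !oddD.
by case: (odd (inv [set i] [set j])); case: (odd (inv [set j] [set i]));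
  case: odd; case: odd.
Qed.

Lemma del_od j i : del j (od i) = (i == j)%:R.
Proof. by have := del_od_mul i j 1; rewrite del1 !mulr1 mulr0 subr0 scaler_nat. Qed.

Lemma del_ev j x : del j (ev x) = 0.
Proof. by have := del_ev_mul j x 1; rewrite del1 !mulr1 mulr0. Qed.

Lemma sgn_ev x : @sgn G (ev x) = ev x.
Proof. by rewrite (sgn_homog (homog_ev _ _ _ x)) -signr_odd (negPf (dE_even x)) scale1r. Qed.

Lemma sgn_od j : @sgn G (od j) = - od j.
Proof. by rewrite (sgn_homog (homog_od _ _ _ j)) -signr_odd dO_odd expr1 scaleN1r. Qed.

(** The twisted Leibniz rule needs to be checked only when the left factor is a generator, since
    [sgn] is multiplicative. *)
Lemma skew_derivation (D : {linear A -> A}) : D 1 = 0 ->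
  (forall x u, D (ev x * u) = D (ev x) * u + ev x * D u) ->
  (forall j u, D (od j * u) = D (od j) * u - od j * D u) ->
  forall u v, D (u * v) = D u * v + @sgn G u * D v.
Proof.
move=> D1 De Do u v; elim/gen_ind: u => [|a u u' hu hu'|x u hu|j u hu].
- by rewrite mul1r D1 mul0r add0r rmorph1 mul1r.
- rewrite mulrDl -scalerAl [LHS]linearP /= hu hu' (linearP D) (linearP (@sgn G)) /=.
  by rewrite !mulrDl scalerDr -!scalerAl addrACA.
- by rewrite -mulrA !De hu (rmorphM (@sgn G)) /= sgn_ev mulrDl mulrDr !mulrA addrA.
- rewrite -mulrA !Do hu (rmorphM (@sgn G)) /= sgn_od mulrBl mulrDr opprD !mulrA addrA.
  by rewrite !mulNr.
Qed.

Lemma del_mul j u v : del j (u * v) = del j u * v + @sgn G u * del j v.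
Proof.
apply: skew_derivation => [|x w|i w]; first exact: del1.
  by rewrite del_ev_mul del_ev mul0r add0r.
by rewrite del_od_mul del_od scaler_nat mulr_natl.
Qed.

Variable Theta : Od -> A.
Hypothesis Theta_homog : forall j, @homog G (dO j).+1 (Theta j).

Lemma Theta_central j u : Theta j * u = u * Theta j.
Proof. by apply: (even_central (A := G) _ (Theta_homog j)); rewrite /= negbK. Qed.

(** The derivation that kills the even generators and sends y_j to [Theta j]. Each [Theta j] has
    even degree, hence is central, so each summand keeps the Leibniz rule of [del j]. *)
Definition dif u : A := \sum_j Theta j * del j u.

Lemma dif_linear : linear dif.
Proof.
move=> a u v; rewrite /dif scaler_sumr -big_split; apply: eq_bigr => j _ /=.
by rewrite linearP mulrDr scalerAr.
Qed.
HB.instance Definition _ := GRing.isLinear.Build rat A A *:%R dif dif_linear.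

Lemma dif1 : dif 1 = 0.
Proof. by rewrite /dif big1 // => j _; rewrite del1 mulr0. Qed.

Lemma dif_ev x : dif (ev x) = 0.
Proof. by rewrite /dif big1 // => j _; rewrite del_ev mulr0. Qed.

Lemma dif_od j : dif (od j) = Theta j.
Proof.
rewrite /dif (bigD1 j) //= del_od eqxx mulr1 big1 ?addr0 // => i ne.
by rewrite del_od eq_sym (negPf ne) mulr0.
Qed.

Lemma dif_mul u v : dif (u * v) = dif u * v + @sgn G u * dif v.
Proof.
rewrite /dif mulr_suml mulr_sumr -big_split; apply: eq_bigr => j _ /=.
by rewrite del_mul mulrDr !mulrA (Theta_central j (@sgn G u)).
Qed.

Lemma dif_homog n u : @homog G n u -> @homog G n.+1 (dif u).
Proof.
move: u; apply: fhomog_ind => [|a u v hu hv|k <-].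
- by rewrite linear0; apply: homog0.
- by rewrite linearP; apply: homogD => //; apply: homogZ.
apply: homog_sum => j _; rewrite del_bas; case: ifP => jk; last first.
  by rewrite mulr0; apply: homog0.
rewrite -scalerAr; apply: homogZ.
have -> : (wdg k).+1 = ((dO j).+1 + wdg (k.1, k.2 :\ j))%N.
  rewrite addSn; congr _.+1; rewrite /wdeg /= addnCA; congr (_ + _)%N.
  rewrite (bigD1 j) //= jk mul1n [in RHS](bigD1 j) //= setD11 mul0n add0n.
  by congr (_ + _)%N; apply: eq_bigr => i ne; rewrite !inE ne.
exact: (homogM (Theta_homog j) (homog_bas _ _ _ _)).
Qed.

Hypothesis Theta_closed : forall j, dif (Theta j) = 0.

Lemma dif_dif u : dif (dif u) = 0.
Proof.
elim/gen_ind: u => [|a u v hu hv|x u hu|j u hu].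
- by rewrite dif1 linear0.
- by rewrite !linearP /= hu hv scaler0 addr0.
- by rewrite dif_mul dif_ev mul0r add0r sgn_ev dif_mul dif_ev mul0r add0r sgn_ev hu mulr0.
rewrite dif_mul dif_od sgn_od mulNr linearB /= !dif_mul Theta_closed mul0r add0r hu.
rewrite mulr0 addr0 dif_od (sgn_homog (Theta_homog j)).
by rewrite -signr_odd /= dO_odd expr0 scale1r subrr.
Qed.

Lemma dif_leibniz n u v : @homog G n u ->
  dif (u * v) = dif u * v + (-1) ^+ n *: (u * dif v).
Proof. by move=> h; rewrite dif_mul (sgn_homog h) scalerAl. Qed.

Definition freeCdga : cdga :=
  @CDGA G dif dif_homog dif_leibniz dif_dif.

End Differential.

Lemma diff1 (B : cdga) : diff (1 : B) = 0.
Proof.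
have h := diff_mul 1 (comp_one B); move: h.
rewrite !mulr1 mul1r expr0 scale1r => /eqP; rewrite -subr_eq0 opprD addNKr oppr_eq0.
by move/eqP.
Qed.

Lemma linear_rV (m : nat) (B : lmodType rat) (f : {linear 'rV[rat]_m -> B}) w :
  f w = \sum_j w 0 j *: f (delta_mx 0 j).
Proof.
rewrite [w in LHS]matrix_sum_delta big_ord1 linear_sum.
by apply: eq_bigr => j _; rewrite linearZ.
Qed.

(** * The Sullivan structure and morphisms out of it *)

Section Sullivan.
Variables (Ev Od : finType) (A : freeAlg Ev Od).
Variables (dE : Ev -> nat) (dO : Od -> nat).
Hypothesis dE_even : forall x, ~~ odd (dE x).
Hypothesis dO_odd : forall j, odd (dO j).
Local Notation ev := (ev A).
Local Notation od := (od A).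
Local Notation G := (freeGca A dE_even dO_odd).
Implicit Types (k l : monom Ev Od) (u v w : A) (S T : {set Od}) (i j : Od) (x : Ev).

Section GcaMorphism.
Variables (B : gcAlgebra) (fe : Ev -> B) (fo : Od -> B).
Hypothesis fe_homog : forall x, homog (dE x) (fe x).
Hypothesis fo_homog : forall j, homog (dO j) (fo j).

Lemma lift_homog (g : {lrmorphism A -> B}) :
  (forall x, g (ev x) = fe x) -> (forall j, g (od j) = fo j) ->
  forall n u, @homog G n u -> homog n (g u).
Proof.
move=> ge go n; apply: fhomog_ind => [|a u v hu hv|k <-].
- by rewrite linear0; apply: homog0.
- by rewrite linearP; apply: homogD => //; apply: homogZ.
elim/monom_ind: k => [|x k IH|j k nj IH].
- by rewrite wdeg1 bas1 rmorph1; apply: comp_one.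
- rewrite wdegM ?wdeg_ev /= ?disjoints_subset ?sub0set // bas_mono_ev rmorphM /= ge.
  exact: homogM.
- rewrite wdegM ?wdeg_od /= ?disjoints1 // bas_mono_od // linearZ /= rmorphM /= go.
  by apply: homogZ; apply: homogM.
Qed.

Lemma gcm_exists : exists g : gcMorphism G B,
  (forall x, g (ev x) = fe x) /\ (forall j, g (od j) = fo j).
Proof.
have [||g [ge go]] := @lift_exists _ _ A B fe fo.
- by move=> x; apply: even_central (fe_homog x).
- by move=> i j; apply: odd_anti (fo_homog i) (fo_homog j).
by exists (@GCMorphism G B g (lift_homog ge go)).
Qed.

End GcaMorphism.

Definition gdeg (g : Ev + Od) : nat :=
  match g with inl x => dE x | inr j => dO j end.
Definition gelt (g : Ev + Od) : A :=
  match g with inl x => ev x | inr j => od j end.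

Lemma homog_gelt g : @homog G (gdeg g) (gelt g).
Proof. by case: g => [x|j]; [apply: homog_ev|apply: homog_od]. Qed.

Definition gset (n : nat) := [set g : Ev + Od | gdeg g == n].
Definition gspace n : vectType rat := 'rV[rat]_#|gset n|.

Definition gincl n (w : gspace n) : G := \sum_j w 0 j *: gelt (enum_val j).

Lemma gincl_linear n : linear (@gincl n).
Proof.
move=> a u v; rewrite /gincl scaler_sumr -big_split; apply: eq_bigr => j _ /=.
by rewrite !mxE scalerDl scalerA.
Qed.
HB.instance Definition _ n :=
  GRing.isLinear.Build rat (gspace n) G *:%R (@gincl n) (@gincl_linear n).

Lemma gincl_homog n (w : gspace n) : @homog G n (@gincl n w).
Proof.
rewrite /gincl; apply: (homog_sum (A := G)) => j _; apply: (homogZ (A := G)).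
by have := homog_gelt (enum_val j); have := enum_valP j; rewrite inE => /eqP ->.
Qed.

Lemma gset_gdeg (g : Ev + Od) : g \in gset (gdeg g).
Proof. by rewrite inE. Qed.

Definition gvec g : gspace (gdeg g) :=
  delta_mx 0 (enum_rank_in (gset_gdeg g) g) : 'rV_ _.

Lemma gincl_delta n (j : 'I_#|gset n|) : @gincl n (delta_mx 0 j : 'rV_ _) = gelt (enum_val j).
Proof.
rewrite /gincl (bigD1 j) //= mxE !eqxx scale1r big1 ?addr0 // => i ne.
by rewrite mxE eqxx (negPf ne) scale0r.
Qed.

Lemma gincl_gvec g : gincl (gvec g) = gelt g.
Proof. by rewrite gincl_delta enum_rankK_in ?gset_gdeg. Qed.

Lemma gvec_enum_val (B : lmodType rat) (f : forall n, {linear gspace n -> B}) n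
    (j : 'I_#|gset n|) :
  f _ (gvec (enum_val j)) = f n (delta_mx 0 j : 'rV_ _).
Proof.
(* The type of [gvec g] depends on its degree, equal to n only propositionally; generalizing over
   [g] allows the equality to be eliminated. *)
suff h g (e : gdeg g = n) : enum_val j = g -> f _ (gvec g) = f n (delta_mx 0 j : 'rV_ _).
  by apply: h => //; have := enum_valP j; rewrite inE => /eqP.
case: _ / e j => j ej; congr (f _ (delta_mx 0 _)).
by apply: enum_val_inj; rewrite ej enum_rankK_in ?gset_gdeg.
Qed.

Lemma ginclE (B : lmodType rat) (h f : forall n, {linear gspace n -> B}) :
  (forall g, h _ (gvec g) = f _ (gvec g)) -> forall n (w : gspace n), h n w = f n w.
Proof.
move=> e n w; rewrite (linear_rV (h n) w) (linear_rV (f n) w).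
by apply: eq_bigr => j _; rewrite -(gvec_enum_val h) -(gvec_enum_val f) e.
Qed.

Lemma gincl_free : @free_gca G gspace (fun n => (@gincl n : {linear gspace n -> G})).
Proof.
move=> B f fh; split.
  have [x|j|g [ge go]] := @gcm_exists B (fun x => f _ (gvec (inl x)))
    (fun j => f _ (gvec (inr j))); [exact: fh|exact: fh|].
  exists g; apply: (ginclE (h := fun n => g \o @gincl n)) => -[x|j].
    by apply: etrans (congr1 g (gincl_gvec (inl x))) _; apply: ge.
  by apply: etrans (congr1 g (gincl_gvec (inr j))) _; apply: go.
move=> g1 g2 e1 e2; apply: lrmorph_ext => [x|j].
  by rewrite -[ev x](gincl_gvec (inl x)) e1 e2.
by rewrite -[od j](gincl_gvec (inr j)) e1 e2.
Qed.

Hypothesis dE_ge2 : forall x, (1 < dE x)%N.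
Hypothesis dO_ge2 : forall j, (1 < dO j)%N.

Lemma gset_eq0 n : (forall g, gdeg g != n) -> \dim {:gspace n} = 0%N.
Proof.
move=> h; rewrite dimvf /dim /= mul1n; apply: eq_card0 => g.
by rewrite inE (negPf (h g)).
Qed.

Lemma gspace_ge2 n : (n < 2)%N -> \dim {:gspace n} = 0%N.
Proof.
move=> n2; apply: gset_eq0 => g; apply: contraTneq n2 => <-.
by rewrite -leqNgt; case: g => [x|j]; [apply: dE_ge2|apply: dO_ge2].
Qed.

Variable Theta : Od -> A.
Hypothesis Theta_homog : forall j, @homog G (dO j).+1 (Theta j).
Hypothesis Theta_closed : forall j, dif Theta (Theta j) = 0.
Local Notation M := (freeCdga Theta_homog Theta_closed).

Definition freeSullivan : sullivan :=
  @Sullivan M gspace (fun n => (@gincl n : {linear gspace n -> G})) gincl_homog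
    gincl_free gspace_ge2.

(** The images of the generators need to respect d only on generators. [Theta j] is an arbitrary
    element, so its image is expressed through any algebra morphism with the prescribed values; such
    a morphism is unique. *)
Lemma dgm_exists (B : cdga) (fe : Ev -> B) (fo : Od -> B) :
  (forall x, homog (dE x) (fe x)) -> (forall j, homog (dO j) (fo j)) ->
  (forall x, diff (fe x) = 0) ->
  (forall g : {lrmorphism A -> B}, (forall x, g (ev x) = fe x) ->
     (forall j, g (od j) = fo j) -> forall j, g (Theta j) = diff (fo j)) ->
  exists g : dgMorphism M B,
    (forall x, g (ev x) = fe x) /\ (forall j, g (od j) = fo j).
Proof.
move=> he ho de dtheta; have [g [ge go]] := gcm_exists he ho.
suff gd u : g (@diff M u) = diff (g u) by exists (@DGMorphism M B g gd).
rewrite /=; elim/gen_ind: u => [|a u v hu hv|x u hu|j u hu].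
- by rewrite dif1 rmorph1 diff1 linear0.
- by rewrite !linearP /= hu hv.
- rewrite dif_mul // dif_ev mul0r add0r sgn_ev !rmorphM /= ge hu.
  by rewrite (diff_mul _ (he x)) de mul0r add0r -signr_odd (negPf (dE_even x)) scale1r.
- rewrite dif_mul // dif_od sgn_od mulNr linearB /= !rmorphM /= go hu.
  by rewrite (diff_mul _ (ho j)) -signr_odd dO_odd expr1 scaleN1r (dtheta g).
Qed.

End Sullivan.

(** * The model of a graph *)

Section WordLength.
Variable M : sullivan.
Implicit Types x y : M.

Lemma Lambda_ge0 k : Lambda_ge k (0 : M).
Proof. by exists [::]; split=> //; rewrite big_nil. Qed.

Lemma Lambda_geD k x y : Lambda_ge k x -> Lambda_ge k y -> Lambda_ge k (x + y).
Proof.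
move=> [r [hr ->]] [s [hs ->]]; exists (r ++ s); split; last by rewrite big_cat.
by move=> m; rewrite mem_cat => /orP[/hr|/hs].
Qed.

Lemma Lambda_ge_le j k x : (k <= j)%N -> Lambda_ge j x -> Lambda_ge k x.
Proof.
move=> kj [r [hr ->]]; exists r; split=> // m /hr[le h]; split=> //.
exact: leq_trans le.
Qed.

Lemma Lambda_geM j k x y : Lambda_ge j x -> Lambda_ge k y -> Lambda_ge (j + k) (x * y).
Proof.
move=> [r [hr ->]] [s [hs ->]].
exists [seq (a.1 * b.1, a.2 ++ b.2) | a <- r, b <- s]; split.
  move=> m /allpairsP[[a b] /= [/hr[la ha] /hs[lb hb] ->]] /=.
  rewrite size_cat leq_add //; split=> // t; rewrite mem_cat => /orP[/ha|/hb] //.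
rewrite big_allpairs_dep /= mulr_suml; apply: eq_bigr => a _.
rewrite mulr_sumr; apply: eq_bigr => b _.
by rewrite big_cat /= -scalerAl -scalerAr scalerA.
Qed.

Lemma Lambda_ge_generator x : generator x -> Lambda_ge 1 x.
Proof.
move=> gx; exists [:: (1, [:: x])]; rewrite big_seq1 big_seq1 scale1r; split=> // m.
by rewrite inE => /eqP -> /=; split=> // t; rewrite inE => /eqP ->.
Qed.

Lemma Lambda_ge1 : Lambda_ge 0 (1 : M).
Proof.
exists [:: (1, [::])]; rewrite big_seq1 big_nil scale1r; split=> // m.
by rewrite inE => /eqP -> /=.
Qed.

Lemma Lambda_geX n x : Lambda_ge 1 x -> Lambda_ge n (x ^+ n).
Proof.
move=> h; elim: n => [|n IH]; first exact: Lambda_ge1.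
by rewrite exprS; apply: (Lambda_geM (j := 1) h IH).
Qed.

Lemma Lambda_geZ k a x : Lambda_ge k x -> Lambda_ge k (a *: x).
Proof.
move=> [r [hr ->]]; exists [seq (a * m.1, m.2) | m <- r]; split.
  by move=> m /mapP[m' /hr h ->].
by rewrite big_map scaler_sumr; apply: eq_bigr => m _ /=; rewrite scalerA.
Qed.

Lemma Lambda_geN k x : Lambda_ge k x -> Lambda_ge k (- x).
Proof. by rewrite -scaleN1r; apply: Lambda_geZ. Qed.

Lemma Lambda_ge_sum k (I : finType) (P : pred I) (F : I -> M) :
  (forall i, P i -> Lambda_ge k (F i)) -> Lambda_ge k (\sum_(i | P i) F i).
Proof. by move=> h; elim/big_ind: _ => //; [apply: Lambda_ge0|apply: Lambda_geD]. Qed.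

End WordLength.

Lemma homogX (B : gcAlgebra) m n (u : B) : homog m u -> homog (m * n) (u ^+ n).
Proof.
move=> h; elim: n => [|n IH]; first by rewrite muln0; apply: comp_one.
by rewrite mulnS exprS; apply: homogM.
Qed.

Lemma homogN (B : gcAlgebra) n (u : B) : homog n u -> homog n (- u).
Proof. by rewrite -scaleN1r; apply: homogZ. Qed.

(** * Generators of the model, its differential, minimality *)

Section ModelGenerators.
Variable V : finType.

Definition EvG : finType := (bool + V)%type.
Definition OdG : finType := ((bool + bool) + V)%type.

Definition gx1 : EvG := inl true.
Definition gx2 : EvG := inl false.
Definition gxv v : EvG := inr v.
Definition gy1 : OdG := inl (inl true).
Definition gy2 : OdG := inl (inl false).
Definition gy3 : OdG := inl (inr true).
Definition gz : OdG := inl (inr false).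
Definition gzv v : OdG := inr v.

Definition degE (x : EvG) : nat :=
  match x with inl true => 8 | inl false => 10 | inr _ => 40 end.
Definition degO (j : OdG) : nat :=
  match j with
  | inl (inl true) => 33 | inl (inl false) => 35 | inl (inr true) => 37
  | inl (inr false) => 119 | inr _ => 119
  end.

Lemma degE_even x : ~~ odd (degE x). Proof. by case: x => [[]|]. Qed.
Lemma degO_odd j : odd (degO j). Proof. by case: j => [[[]|[]]|]. Qed.
Lemma degE_ge2 x : (1 < degE x)%N. Proof. by case: x => [[]|]. Qed.
Lemma degO_ge2 j : (1 < degO j)%N. Proof. by case: j => [[[]|[]]|]. Qed.

End ModelGenerators.

(** The monomial x1^a x2^b at arbitrary images [fe] of the even generators. *)
HB.lock Definition mmon (V : finType) (B : algType rat) (fe : EvG V -> B) (a b : nat) : B :=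
  fe (gx1 V) ^+ a * fe (gx2 V) ^+ b.

Section Model.
Variables (V : finType) (e : rel V).
Local Notation EvG := (EvG V).
Local Notation OdG := (OdG V).
Local Notation gx1 := (gx1 V).
Local Notation gx2 := (gx2 V).
Local Notation gy1 := (gy1 V).
Local Notation gy2 := (gy2 V).
Local Notation gy3 := (gy3 V).
Local Notation degE := (@degE V).
Local Notation degO := (@degO V).
Local Notation degE_even := (@degE_even V).
Local Notation degO_odd := (@degO_odd V).
Local Notation degE_ge2 := (@degE_ge2 V).
Local Notation degO_ge2 := (@degO_ge2 V).

Section ThetaOf.
Variables (B : algType rat) (fe : EvG -> B) (fo : OdG -> B).

Local Notation mmon := (mmon fe).

(** The non-pure part of d z. In the model its product with x2 is x1^3 d(y1 y2 y3), see
    [exact_omega_x2]. *)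
Definition omegaOf : B := fo gy1 * fo gy2 * mmon 4 2 - fo gy1 * fo gy3 * mmon 5 1
  + fo gy2 * fo gy3 * mmon 6 0.

(** The formulas for d on odd generators, at arbitrary images of the generators: a morphism then
    carries one instance to another ([rmorph_thetaOf]). *)
Definition thetaOf (j : OdG) : B :=
  match j with
  | inl (inl true) => mmon 3 1
  | inl (inl false) => mmon 2 2
  | inl (inr true) => mmon 1 3
  | inl (inr false) => omegaOf + mmon 15 0 + mmon 0 12
  | inr v => fe (gxv v) ^+ 3 + \sum_(w | e v w) fe (gxv v) * fe (gxv w) * mmon 0 4
  end.

End ThetaOf.

Lemma rmorph_mmon (B C : algType rat) (g : {lrmorphism B -> C}) (fe : EvG -> B) a b :
  g (mmon fe a b) = mmon (g \o fe) a b.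
Proof. by rewrite mmon.unlock rmorphM /= !rmorphXn. Qed.

Lemma rmorph_omegaOf (B C : algType rat) (g : {lrmorphism B -> C}) fe fo :
  g (omegaOf fe fo) = omegaOf (g \o fe) (g \o fo).
Proof. by rewrite rmorphD rmorphB !rmorphM /= !rmorph_mmon. Qed.

Lemma rmorph_thetaOf (B C : algType rat) (g : {lrmorphism B -> C}) fe fo j :
  g (thetaOf fe fo j) = thetaOf (g \o fe) (g \o fo) j.
Proof.
case: j => [[[]|[]]|v] /=; rewrite ?rmorph_mmon //.
  by rewrite rmorphD rmorphD /= rmorph_omegaOf !rmorph_mmon.
rewrite rmorphD rmorphXn rmorph_sum /=; congr (_ + _).
by apply: eq_bigr => w _; rewrite !rmorphM /= !rmorph_mmon.
Qed.

(** The generators z and z_v occur in no differential. Hence maps that differ on them, such as the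
    ends of a homotopy, still agree on every [Theta j]. *)
Lemma eq_thetaOf (B : algType rat) (fe fe' : EvG -> B) (fo fo' : OdG -> B) j :
  fe =1 fe' -> fo gy1 = fo' gy1 -> fo gy2 = fo' gy2 -> fo gy3 = fo' gy3 ->
  thetaOf fe fo j = thetaOf fe' fo' j.
Proof.
move=> he h1 h2 h3; case: j => [[[]|[]]|v]; rewrite /= /omegaOf ?mmon.unlock ?he ?h1 ?h2 ?h3 //.
by congr (_ + _); apply: eq_bigr => w _; rewrite !he.
Qed.

Section ThetaHomog.
Variables (B : gcAlgebra) (fe : EvG -> B) (fo : OdG -> B).
Hypothesis fe_homog : forall x, homog (degE x) (fe x).
Hypothesis fo_homog : forall j, homog (degO j) (fo j).

Lemma mmon_homog a b : homog (8 * a + 10 * b) (mmon fe a b).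
Proof. by rewrite mmon.unlock; apply: homogM; apply: homogX; [apply: (fe_homog gx1)|apply: (fe_homog gx2)]. Qed.

Lemma thetaOf_homog j : homog (degO j).+1 (thetaOf fe fo j).
Proof.
have hm := mmon_homog; have h1 := fo_homog gy1; have h2 := fo_homog gy2.
have h3 := fo_homog gy3.
case: j => [[[]|[]]|v] /=; try exact: hm.
  apply: homogD; last exact: (hm 0%N 12%N).
  apply: homogD; last exact: (hm 15%N 0%N).
  apply: homogD; first apply: homogD; last 1 first.
  - exact: (homogM (homogM h2 h3) (hm 6%N 0%N)).
  - exact: (homogM (homogM h1 h2) (hm 4%N 2%N)).
  - by apply: homogN; exact: (homogM (homogM h1 h3) (hm 5%N 1%N)).
apply: homogD; first exact: (homogX 3 (fe_homog (gxv v))).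
apply: homog_sum => w _.
exact: (homogM (homogM (fe_homog (gxv v)) (fe_homog (gxv w))) (hm 0%N 4%N)).
Qed.

End ThetaHomog.

Variable A : freeAlg EvG OdG.
Local Notation G := (freeGca A degE_even degO_odd).
Local Notation ev := (ev A).
Local Notation od := (od A).
Implicit Types u v w : A.

Definition Theta := thetaOf ev od.

Lemma Theta_homog j : @homog G (degO j).+1 (Theta j).
Proof.
by apply: (@thetaOf_homog G) => ?; [apply: homog_ev|apply: homog_od].
Qed.

Local Notation d := (dif Theta).

(** These elements are scalars for d: they move through d without a sign ([dif_ecM], [dif_Mec]). *)
Definition even_cocycle u := [/\ d u = 0, @sgn G u = u & forall v, u * v = v * u].

Lemma ecM u v : even_cocycle u -> even_cocycle v -> even_cocycle (u * v).
Proof.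
move=> [du su cu] [dv sv cv]; split.
- by rewrite (dif_mul Theta_homog) du dv mul0r mulr0 addr0.
- by rewrite (rmorphM (@sgn G)) /= su sv.
- by move=> w; rewrite -mulrA cv mulrA cu mulrA.
Qed.

Lemma ecP a u v : even_cocycle u -> even_cocycle v -> even_cocycle (a *: u + v).
Proof.
move=> [du su cu] [dv sv cv]; split.
- by rewrite linearP /= du dv scaler0 addr0.
- by rewrite (linearP (@sgn G)) /= su sv.
- by move=> w; rewrite mulrDl mulrDr -scalerAl -scalerAr cu cv.
Qed.

Lemma ec1 : even_cocycle 1.
Proof. by split; [apply: dif1|apply: rmorph1|move=> v; rewrite mul1r mulr1]. Qed.

Lemma ec_ev x : even_cocycle (ev x).
Proof. by split; [apply: dif_ev|apply: sgn_ev|apply: (ev_central degE_even degO_odd)]. Qed.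

Lemma ec0 : even_cocycle 0.
Proof. by split=> [||v]; rewrite ?linear0 ?mul0r ?mulr0. Qed.

Lemma ecD u v : even_cocycle u -> even_cocycle v -> even_cocycle (u + v).
Proof. by move=> hu hv; rewrite -[u]scale1r; apply: ecP. Qed.

Lemma ecX n u : even_cocycle u -> even_cocycle (u ^+ n).
Proof.
move=> h; elim: n => [|n IH]; first exact: ec1.
by rewrite exprS; apply: ecM.
Qed.

Lemma ec_mmon a b : even_cocycle (mmon ev a b).
Proof. by rewrite mmon.unlock; apply: ecM; apply: ecX; apply: ec_ev. Qed.

Lemma dif_ecM u v : even_cocycle u -> d (u * v) = u * d v.
Proof.
move=> [du su _]; rewrite (dif_mul Theta_homog) du mul0r add0r.
by rewrite su.
Qed.

Lemma dif_Mec u v : even_cocycle v -> d (u * v) = d u * v.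
Proof.
by move=> h; have [_ _ c] := h; rewrite -c dif_ecM // c.
Qed.

Lemma evX_central x n v : ev x ^+ n * v = v * ev x ^+ n.
Proof.
suff /(commrX n) : GRing.comm v (ev x) by [].
by rewrite /GRing.comm (ev_central degE_even degO_odd).
Qed.

Lemma mmonM a b c f : mmon ev a b * mmon ev c f = mmon ev (a + c) (b + f).
Proof.
rewrite mmon.unlock !exprD -!mulrA; congr (_ * _).
by rewrite !mulrA; congr (_ * _); apply: evX_central.
Qed.

Lemma mmonC a b v : mmon ev a b * v = v * mmon ev a b.
Proof.
by rewrite mmon.unlock -mulrA (evX_central gx2 b v) mulrA evX_central mulrA.
Qed.

Lemma dif_odod i j : d (od i * od j) = Theta i * od j - od i * Theta j.
Proof.
rewrite (dif_mul Theta_homog) !dif_od.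
by rewrite (sgn_od A degE_even degO_odd) mulNr.
Qed.

Lemma mmon_mid a b c f v : mmon ev a b * v * mmon ev c f = v * mmon ev (a + c) (b + f).
Proof. by rewrite mmonC -mulrA mmonM. Qed.

Lemma mmon_right a b c f v : v * mmon ev a b * mmon ev c f = v * mmon ev (a + c) (b + f).
Proof. by rewrite -mulrA mmonM. Qed.

(** Each of y1, y2, y3 occurs in two of the six terms, with the same monomial and opposite signs. *)
Lemma dif_omega : d (omegaOf ev od) = 0.
Proof.
rewrite linearD linearB /= !(dif_Mec _ (ec_mmon _ _)) !dif_odod /=.
rewrite !mulrBl !mmon_mid !mmon_right.
by rewrite opprB [X in X + _]addrA subrK addrA subrK subrr.
Qed.

Lemma Theta_closed j : d (Theta j) = 0.
Proof.
have hm a b : d (mmon ev a b) = 0 by case: (ec_mmon a b).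
have hv t : even_cocycle (ev (gxv t)) := ec_ev _.
case: j => [[[]|[]]|v] //=.
  by rewrite linearD linearD /= !hm dif_omega !addr0.
suff [] : even_cocycle (Theta (gzv v)) by [].
rewrite /Theta /=; apply: ecD; first exact: ecX.
elim/big_ind: _ => [||w _]; [exact: ec0|exact: ecD|].
by apply: ecM; [apply: ecM|apply: ec_mmon].
Qed.

Definition Mdl : sullivan :=
  freeSullivan degE_ge2 degO_ge2 Theta_homog Theta_closed.

Lemma Mdl_generator (g : EvG + OdG) : @generator Mdl (gelt A g).
Proof. by exists (gdeg degE degO g), (gvec degE degO g); rewrite /= gincl_gvec. Qed.

Lemma Mdl_minimal : minimal Mdl.
Proof.
have he x : @Lambda_ge Mdl 1 (ev x) := Lambda_ge_generator (Mdl_generator (inl x)).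
have ho j : @Lambda_ge Mdl 1 (od j) := Lambda_ge_generator (Mdl_generator (inr j)).
have hm a b : @Lambda_ge Mdl (a + b) (mmon ev a b).
  by rewrite mmon.unlock; apply: (@Lambda_geM Mdl a b); apply: (@Lambda_geX Mdl).
have ht j : @Lambda_ge Mdl 2 (Theta j).
  case: j => [[[]|[]]|v].
  - exact: Lambda_ge_le (hm 3%N 1%N).
  - exact: Lambda_ge_le (hm 2%N 2%N).
  - exact: Lambda_ge_le (hm 1%N 3%N).
  - have hoo i j k l : (2 <= k + l)%N -> @Lambda_ge Mdl 2 (od i * od j * mmon ev k l).
      move=> _; apply: (@Lambda_ge_le Mdl (1 + 1 + (k + l))); first by rewrite leq_addr.
      by apply: (@Lambda_geM Mdl _ _ (od i * od j)) (hm k l); apply: (@Lambda_geM Mdl).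
    apply: (@Lambda_geD Mdl 2 (_ + _)); last exact: Lambda_ge_le (hm 0%N 12%N).
    apply: (@Lambda_geD Mdl 2 (omegaOf _ _)); last exact: Lambda_ge_le (hm 15%N 0%N).
    apply: (@Lambda_geD Mdl 2 (_ - _)); last exact: hoo.
    apply: (@Lambda_geD Mdl 2 (_ * _ * mmon ev 4 2)); first exact: hoo.
    by apply: (@Lambda_geN Mdl); apply: hoo.
  apply: (@Lambda_geD Mdl 2 (_ ^+ 3)).
    by apply: (@Lambda_ge_le Mdl 3) => //; apply: (@Lambda_geX Mdl).
  apply: (@Lambda_ge_sum Mdl) => w _; apply: (@Lambda_ge_le Mdl (1 + 1 + (0 + 4))) => //.
  apply: (@Lambda_geM Mdl _ _ (_ * _)) (hm 0%N 4%N).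
  exact: (@Lambda_geM Mdl 1 1).
move=> n w; pose f : {linear gspace degE degO n -> A} := @gincl _ _ A _ _ degE_even degO_odd n.
rewrite -[incl _ _ _]/(f w) /= (linear_rV f) linear_sum.
apply: (@Lambda_ge_sum Mdl) => j _; rewrite linearZ; apply: (@Lambda_geZ Mdl) => /=.
rewrite /f gincl_delta; case: (enum_val j) => [x|i] /=; last by rewrite dif_od.
by rewrite dif_ev; apply: (@Lambda_ge0 Mdl).
Qed.
End Model.

(** * Finite-dimensional cohomology *)

(** As long as some [phi z] lies outside the span, adding z raises its dimension, so at most
    [\dim {:W}] elements are added. *)
Lemma finite_span (A : lmodType rat) (Z : A -> Prop) (W : vectType rat)
    (phi : {linear A -> W}) :
  exists zs : seq A, (forall z, z \in zs -> Z z) /\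
    forall z, Z z -> phi z \in <<map phi zs>>%VS.
Proof.
suff H n zs : (forall z, z \in zs -> Z z) -> (\dim {:W} - \dim <<map phi zs>> <= n)%N ->
    exists ys : seq A, (forall z, z \in ys -> Z z) /\
      forall z, Z z -> phi z \in <<map phi ys>>%VS.
  by apply: (H _ [::]).
elim: n zs => [|n IH] zs hz le;
  have [h|/boolp.existsNP[z /boolp.not_implyP[Zz /negP nz]]] :=
    boolp.EM (forall z, Z z -> phi z \in <<map phi zs>>%VS); try by exists zs.
  have e : <<map phi zs>>%VS = fullv.
    by apply/eqP; rewrite eqEdim subvf -subn_eq0 -leqn0.
  by rewrite e memvf in nz.
apply: (IH (z :: zs)) => [y|]; first by rewrite inE => /orP[/eqP->|/hz].
have lt : (\dim <<map phi zs>> < \dim <<map phi (z :: zs)>>)%N.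
  rewrite /= span_cons (ltn_leqif (dimv_leqif_sup (addvSr _ _))).
  apply: contra nz => /subvP; apply; apply: (subvP (addvSl _ _)).
  exact: memv_line.
rewrite leq_subLR; apply: leq_trans (_ : _ <= \dim <<map phi zs>> + n.+1)%N _.
  by rewrite -leq_subLR.
by rewrite addnS -addSn leq_add2r.
Qed.

(** * Cocycles modulo the N-th powers of the even generators *)

Section TruncatedIdeals.
Variables (Ev Od : finType) (A : freeAlg Ev Od).
Variables (dE : Ev -> nat) (dO : Od -> nat).
Hypothesis dE_even : forall x, ~~ odd (dE x).
Hypothesis dO_odd : forall j, odd (dO j).
Local Notation G := (freeGca A dE_even dO_odd).
Local Notation bas := (bas A).
Local Notation ev := (ev A).
Variable Theta : Od -> A.
Hypothesis Theta_homog : forall j, @homog G (dO j).+1 (Theta j).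
Hypothesis Theta_closed : forall j, dif Theta (Theta j) = 0.
Local Notation d := (dif Theta).
Implicit Types (k l : monom Ev Od) (u v w : A) (x : Ev) (L : seq Ev).
Variable N : nat.

(** A monomial is [high] when it lies in the ideal generated by the [ev x ^+ N] with x in L. This is
    a monomial ideal, so membership can be tested on the support. *)
Definition high L k := has (fun x => N <= k.1 x)%N L.
Definition in_ideal L u := forall k, cf A k u != 0 -> high L k.

Lemma in_ideal_ind L (P : A -> Prop) : P 0 ->
  (forall a u v, P u -> P v -> P (a *: u + v)) ->
  (forall k, high L k -> P (bas k)) -> forall u, in_ideal L u -> P u.
Proof. by move=> P0 PD Pb u h; apply: supp_ind => // k /h /Pb. Qed.

Lemma in_ideal0 L : in_ideal L 0.
Proof. by move=> k; rewrite linear0 eqxx. Qed.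

Lemma in_idealP L a u v : in_ideal L u -> in_ideal L v -> in_ideal L (a *: u + v).
Proof.
move=> hu hv k; rewrite linearP /=; case: (eqVneq (cf A k v) 0) => [->|/hv//].
by rewrite addr0; case: (eqVneq (cf A k u) 0) => [->|/hu//]; rewrite scaler0 eqxx.
Qed.

Lemma in_idealB L u v : in_ideal L u -> in_ideal L v -> in_ideal L (u - v).
Proof. by move=> hu hv; rewrite addrC -scaleN1r; apply: in_idealP. Qed.

Lemma in_ideal_bas L a k : high L k -> in_ideal L (a *: bas k).
Proof.
move=> h l; rewrite linearZ /= cf_bas; case: (eqVneq k l) => [<- //|_].
by rewrite scaler0 eqxx.
Qed.

Lemma in_idealMl L w u : in_ideal L u -> in_ideal L (w * u).
Proof.
move: u; apply: in_ideal_ind => [|a u v hu hv|k hk].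
- by rewrite mulr0; apply: in_ideal0.
- by rewrite mulrDr -scalerAr; apply: in_idealP.
elim/(@bas_ind _ _ A): w => [|a u v hu hv|l].
- by rewrite mul0r; apply: in_ideal0.
- by rewrite mulrDl -scalerAl; apply: in_idealP.
rewrite basM; apply: in_ideal_bas; apply: sub_has hk => x /= hx.
by rewrite ffunE (leq_trans hx) ?leq_addl.
Qed.

Lemma in_ideal_dif L u : in_ideal L u -> in_ideal L (d u).
Proof.
move: u; apply: in_ideal_ind => [|a u v hu hv|k hk].
- by rewrite linear0; apply: in_ideal0.
- by rewrite linearP; apply: in_idealP.
rewrite /dif; elim/big_ind: _ => [|u v hu hv|j _]; first exact: in_ideal0.
  by rewrite -[u]scale1r; apply: in_idealP.
apply: in_idealMl; rewrite del_bas; case: ifP => _; last exact: in_ideal0.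
exact: in_ideal_bas.
Qed.

Lemma evX_bas x n k :
  ev x ^+ n * bas k = bas ([ffun y => ((y == x) * n + k.1 y)%N], k.2).
Proof.
elim: n => [|n IH].
  rewrite expr0 mul1r; case: k => [a S]; congr (bas (_, _)).
  by apply/ffunP => y; rewrite ffunE muln0.
rewrite exprS -mulrA IH ev_bas /=; congr (bas (_, _)); apply/ffunP => y.
by rewrite !ffunE; case: eqP => _; rewrite ?mul1n.
Qed.

Lemma in_ideal_cons x L u : in_ideal (x :: L) u ->
  exists m, in_ideal L (u - ev x ^+ N * m).
Proof.
move: u; apply: in_ideal_ind => [|a u v [m hm] [m' hm']|k].
- by exists 0; rewrite mulr0 subr0; apply: in_ideal0.
- exists (a *: m + m'); rewrite mulrDr -scalerAr opprD addrACA -scalerBr.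
  exact: in_idealP.
rewrite /high /=; case: (leqP N (k.1 x)) => [le _|_ hk].
  exists (bas ([ffun y => (k.1 y - (y == x) * N)%N], k.2)).
  rewrite evX_bas (_ : (_, _) = k) ?subrr; first exact: in_ideal0.
  case: k le => [a S] /= le; congr pair; apply/ffunP => y; rewrite !ffunE.
  by case: eqP => [->|_]; rewrite ?mul0n ?subn0 // mul1n subnKC.
by exists 0; rewrite mulr0 subr0 -[bas k]scale1r; apply: in_ideal_bas.
Qed.

(** Regularity of the sequence of powers: multiplication by x^N is injective on monomials and leaves
    the exponents in L unchanged. *)
Lemma in_ideal_shift x L m : x \notin L -> in_ideal L (ev x ^+ N * m) -> in_ideal L m.
Proof.
move=> xL h k hk; pose sh k : monom Ev Od := ([ffun y => ((y == x) * N + k.1 y)%N], k.2).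
have sh_inj : injective sh.
  move=> [a S] [b T] [/ffunP e ->]; congr pair; apply/ffunP => y.
  by have := e y; rewrite !ffunE => /addnI.
have : high L (sh k).
  apply: h; rewrite (_ : cf _ _ _ = cf A k m) //.
  elim/(@bas_ind _ _ A): m {hk} => [|a u v hu hv|l].
  - by rewrite mulr0 !linear0.
  - by rewrite mulrDr -scalerAr !linearP /= hu hv.
  - by rewrite evX_bas !cf_bas -[(_, _)]/(sh l) (inj_eq sh_inj).
move=> /hasP[y yL]; rewrite ffunE; case: eqP => [yx|_ le]; first by rewrite -yx yL in xL.
by apply/hasP; exists y.
Qed.

Hypothesis power_exact : forall x, exists h, d h = ev x ^+ N.

Lemma difX x n u : d (ev x ^+ n * u) = ev x ^+ n * d u.
Proof.
elim: n u => [|n IH] u; first by rewrite !mul1r.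
rewrite !exprS -!mulrA (dif_mul Theta_homog) dif_ev mul0r add0r.
by rewrite (sgn_ev A dE_even dO_odd) IH.
Qed.

(* The powers [ev x ^+ N] form a regular sequence, so killing them one at a   *)
(* time is injective on cohomology, each of them being exact.                 *)
Lemma ideal_cocycle_exact L u : uniq L -> d u = 0 -> in_ideal L u ->
  exists b, u = d b.
Proof.
elim: L u => [|x L IH] u.
  move=> _ _ h; exists 0; rewrite linear0; apply: cf_ext => k; rewrite linear0.
  by case: (eqVneq (cf A k u) 0) => // /h.
move=> /= /andP[xL uL] du /in_ideal_cons[m hm]; have [h dh] := power_exact x.
have dm : in_ideal L (d m).
  apply: (in_ideal_shift xL); have := in_ideal_dif hm.
  rewrite linearB /= du sub0r difX => /(in_idealB (@in_ideal0 L)).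
  by rewrite sub0r opprK.
(* As d h = x^N, the element u - d(h m) equals (u - x^N m) minus [sgn h] times d m, and both terms
   lie in the smaller ideal. *)
have [||b hb] := IH (u - d (h * m)) uL.
- by rewrite linearB /= du (dif_dif Theta_homog Theta_closed) subrr.
- rewrite (dif_mul Theta_homog) dh opprD addrA.
  by apply: in_idealB => //; apply: in_idealMl.
by exists (b + h * m); rewrite linearD /= -hb subrK.
Qed.

Definition low : finType := ({ffun Ev -> 'I_N} * {set Od})%type.
Definition low_monom (t : low) : monom Ev Od := ([ffun x => t.1 x : nat], t.2).

Definition low_coef u : {ffun low -> rat^o} := [ffun t => cf A (low_monom t) u].

Lemma low_coef_linear : linear low_coef.
Proof. by move=> a u v; apply/ffunP => t; rewrite !ffunE linearP. Qed.
HB.instance Definition _ := GRing.isLinear.Build rat A {ffun low -> rat^o} *:%R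
  low_coef low_coef_linear.

Lemma low_coef0 u : low_coef u = 0 -> in_ideal (enum Ev) u.
Proof.
move=> /ffunP h k; apply: contraNT => /hasPn hk; apply/eqP.
have lt x : (k.1 x < N)%N by rewrite ltnNge hk ?mem_enum.
have := h ([ffun x => Ordinal (lt x)], k.2); rewrite !ffunE => <-.
congr (cf A _ u); case: k {hk} lt => [a S] /= lt; congr pair.
by apply/ffunP => x; rewrite !ffunE.
Qed.

(** The [zs] are cocycles whose coefficients on monomials with all exponents below N span those of
    all cocycles. Subtracting a combination of them moves a cocycle into the ideal, where it is
    exact. *)
Lemma cohomology_span : exists zs : seq A, (forall z, z \in zs -> d z = 0) /\
  forall z, d z = 0 -> exists (c : nat -> rat) b,
    z = \sum_(i < size zs) c i *: zs`_i + d b.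
Proof.
have [zs [hz sp]] := finite_span (fun z => d z = 0) low_coef; exists zs; split=> // z dz.
have := sp z dz; rewrite -[map _ _]/(tval (in_tuple _)) => /coord_span ez.
set X := in_tuple _ in ez.
have szX : size (map low_coef zs) = size zs by rewrite size_map.
pose c (i : nat) : rat := if insub i is Some j then coord X j (low_coef z) else 0.
pose w := \sum_(i < size zs) c i *: zs`_i.
have dw : d w = 0.
  rewrite linear_sum big1 // => i _; rewrite linearZ /= hz ?scaler0 //.
  exact: mem_nth.
have [||b hb] := @ideal_cocycle_exact (enum Ev) (z - w) (enum_uniq _).
- by rewrite linearB /= dz dw subrr.
- apply: low_coef0; rewrite linearB /= ez linear_sum.
  rewrite (eq_bigr (fun i => c (val i) *: (map low_coef zs)`_(val i))) => [|i _]; last by rewrite /c valK.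
  rewrite -(big_mkord xpredT (fun i => c i *: (map low_coef zs)`_i)) szX big_mkord -sumrB big1 // => i _.
  by rewrite linearZ /= (nth_map 0) ?subrr.
by exists c, b; rewrite -hb addrC subrK.
Qed.

End TruncatedIdeals.

(** * A power of every even generator is exact *)

Section Elliptic.
Variables (V : finType) (e : rel V) (A : freeAlg (EvG V) (OdG V)).
Local Notation G := (freeGca A (@degE_even V) (@degO_odd V)).
Local Notation ev := (ev A).
Local Notation od := (od A).
Local Notation d := (dif (Theta e A)).
Local Notation ec := (even_cocycle e).
Local Notation m := (mmon ev).
Local Notation y1 := (od (gy1 V)).
Local Notation y2 := (od (gy2 V)).
Local Notation y3 := (od (gy3 V)).
Local Notation omega := (omegaOf ev od).
Implicit Types u v w : A.

Definition coboundary u := exists h, d h = u.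

Lemma coboundaryM u v : coboundary u -> d v = 0 -> coboundary (u * v).
Proof.
move=> [h <-] dv; exists (h * v).
by rewrite (dif_mul (@Theta_homog V e A)) dv mulr0 addr0.
Qed.

Lemma coboundaryP a u v : coboundary u -> coboundary v -> coboundary (a *: u + v).
Proof. by move=> [h <-] [h' <-]; exists (a *: h + h'); rewrite linearP. Qed.

Lemma coboundaryB u v : coboundary u -> coboundary v -> coboundary (u - v).
Proof. by move=> hu hv; rewrite addrC -scaleN1r; apply: coboundaryP. Qed.

Lemma coboundary0 : coboundary 0.
Proof. by exists 0; rewrite linear0. Qed.

Lemma exact_Theta j : coboundary (Theta e A j).
Proof. by exists (od j); apply: dif_od. Qed.

Lemma dif_mmon a b : d (m a b) = 0.
Proof. by case: (ec_mmon e A a b). Qed.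

(** The primitive is y1 y2 y3 x1^3. *)
Lemma exact_omega_x2 : coboundary (omega * m 0 1).
Proof.
exists (y1 * y2 * (y3 * m 3 0)).
rewrite mulrA (dif_Mec _ (ec_mmon _ _ _ _)) (dif_mul (@Theta_homog V e A)) dif_odod dif_od.
rewrite (rmorphM (@sgn G)) /= !(sgn_od A (@degE_even V) (@degO_odd V)) mulrNN /=.
rewrite /omegaOf -!mulrA mulrBl -!mulrA (mmonC 3 1) (mmonC 2 2) !mulrDl !mulNr !mulrA.
by rewrite !mmon_right /= addrC addrCA addrC.
Qed.

(** In x2 d z = omega x2 + x1^15 x2 + x2^13 the first two terms are exact, the second being x1^12 d
    y1. *)
Lemma exact_x2 : coboundary (m 0 13).
Proof.
have h : coboundary (Theta e A (gz V) * m 0 1) := coboundaryM (exact_Theta _) (dif_mmon 0 1).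
have h1 : coboundary (m 15 1).
  by have := coboundaryM (exact_Theta (gy1 V)) (dif_mmon 12 0); rewrite /= mmonM.
have -> : m 0 13 = Theta e A (gz V) * m 0 1 - omega * m 0 1 - m 15 1.
  by rewrite /= !mulrDl !mmonM -[RHS]addrA -opprD [X in X - _]addrC addrK.
by do 2 apply: coboundaryB => //; apply: exact_omega_x2.
Qed.

Lemma od_mul_bas i j : exists c, od i * od j = c *: bas A (monM (mono_od _ i) (mono_od _ j)).
Proof. by rewrite basM; eexists. Qed.

Lemma od_mul4 i j k l : ~~ [disjoint [set i; j] & [set k; l]] ->
  od i * od j * (od k * od l) = 0.
Proof.
move=> nd; have [c ->] := od_mul_bas i j; have [c' ->] := od_mul_bas k l.
by rewrite -scalerAl -scalerAr basM /= eps.unlock (negPf nd) scale0r !scaler0.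
Qed.

(** Any two of the pairs of odd generators in omega share a member. *)
Lemma omega_sq : omega * omega = 0.
Proof.
have mul0 i j k l a b p q : ~~ [disjoint [set i; j] & [set k; l]] ->
    od i * od j * m a b * (od k * od l * m p q) = 0.
  by move=> nd; rewrite -mulrA (mulrA (m a b)) mmon_mid mulrA od_mul4 // mul0r.
have nd i j k l : [|| i == k, i == l, j == k | j == l] ->
    ~~ [disjoint [set i; j] & [set k; l] : {set OdG V}].
  rewrite -setI_eq0 => h; apply/set0Pn; case/or4P: h => /eqP ->.
  - by exists k; rewrite !inE eqxx.
  - by exists l; rewrite !inE eqxx ?orbT.
  - by exists k; rewrite !inE eqxx ?orbT.
  - by exists l; rewrite !inE eqxx ?orbT.
by rewrite /omegaOf !(mulrDl, mulrDr, mulrN, mulNr) !mul0 ?nd ?eqxx ?orbT // !oppr0 !addr0.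
Qed.

(** From x1^3 d z, where x1^3 x2^12 = x2^11 d y1, the element x1^18 + omega x1^3 is exact. Its
    product with the cocycle x1^18 - omega x1^3 is x1^36, because omega^2 = 0. *)
Lemma exact_x1 : coboundary (m 36 0).
Proof.
have h : coboundary (Theta e A (gz V) * m 3 0) := coboundaryM (exact_Theta _) (dif_mmon 3 0).
have h1 : coboundary (m 3 12).
  by have := coboundaryM (exact_Theta (gy1 V)) (dif_mmon 0 11); rewrite /= mmonM.
have h2 : coboundary (m 18 0 + omega * m 3 0).
  rewrite (_ : _ + _ = Theta e A (gz V) * m 3 0 - m 3 12); first exact: coboundaryB.
  by rewrite /= !mulrDl !mmonM addrK addrC.
have dw : d (m 18 0 - omega * m 3 0) = 0.
  by rewrite linearB /= dif_mmon (dif_Mec _ (ec_mmon _ _ _ _)) dif_omega mul0r subr0.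
suff -> : m 36 0 = (m 18 0 + omega * m 3 0) * (m 18 0 - omega * m 3 0).
  exact: coboundaryM.
have := omega_sq; move: omega => w w2.
rewrite mulrBr !mulrDl mmonM (mmonC 18 0) opprD addrA addrK -mulrA (mulrA (m 3 0)).
by rewrite mmon_mid !mulrA w2 mul0r subr0.
Qed.

(** With t = - s x2^4, where s is the sum of the neighbouring x_w, d z_v makes x x^2 and x t
    cohomologous, hence x (x^2)^k and x t^k. For k = 4 the factor x2^16 of t^4 contains the exact
    x2^13, so x^9 is exact. *)
Lemma exact_xv (v : V) : coboundary (ev (gxv v) ^+ 9).
Proof.
pose x := ev (gxv v); have ecx : ec x := ec_ev e A _.
pose s := \sum_(w | e v w) ev (gxv w); pose t := - (s * m 0 4).
have ecs : ec s.
  rewrite /s; elim/big_ind: _ => [||w _]; [exact: ec0|exact: ecD|exact: ec_ev].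
have ect : ec t.
  rewrite /t -scaleN1r -[_ *: _]addr0; apply: ecP; last exact: ec0.
  by apply: ecM => //; apply: ec_mmon.
have h : coboundary (x * x ^+ 2 - x * t).
  have := exact_Theta (gzv v); rewrite /= -/x -exprS mulrN opprK mulrA.
  by rewrite mulr_sumr mulr_suml.
have hk k : coboundary (x * (x ^+ 2) ^+ k - x * t ^+ k).
  elim: k => [|k IH]; first by rewrite subrr; apply: coboundary0.
  have [_ _ cx2] : ec (x ^+ 2) by apply: ecX.
  have [dx2 _ _] : ec (x ^+ 2) by apply: ecX.
  have [dt _ _] : ec (t ^+ k) by apply: ecX.
  have -> : x * (x ^+ 2) ^+ k.+1 - x * t ^+ k.+1 =
      (x * (x ^+ 2) ^+ k - x * t ^+ k) * x ^+ 2 + (x * x ^+ 2 - x * t) * t ^+ k.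
    move: (x ^+ 2) cx2 => y cy; rewrite exprSr [t ^+ k.+1]exprS !mulrBl -!mulrA.
    by rewrite -(cy (t ^+ k)) addrA subrK.
  by rewrite -[X in X + _]scale1r; apply: coboundaryP; apply: coboundaryM.
have ht : coboundary (x * t ^+ 4).
  have -> : x * t ^+ 4 = m 0 13 * (x * s ^+ 4 * m 0 3).
    have [_ _ cs] := ecs; rewrite [RHS]mmonC mmon_right -mulrA; congr (_ * _).
    rewrite /t -mulN1r exprMn_comm; last by rewrite /GRing.comm mulN1r mulrN1.
    rewrite -signr_odd expr0 mul1r exprMn_comm; last exact: cs.
    by congr (_ * _); rewrite mmon.unlock !expr0 !mul1r -exprM.
  apply: coboundaryM exact_x2 _.
  by have [] : ec (x * s ^+ 4 * m 0 3) by apply: ecM; [apply: ecM => //; apply: ecX|apply: ec_mmon].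
have -> : x ^+ 9 = x * (x ^+ 2) ^+ 4 - x * t ^+ 4 - (0 - x * t ^+ 4).
  by rewrite sub0r opprK subrK -exprM -exprS.
by apply: coboundaryB => //; apply: coboundaryB => //; apply: coboundary0.
Qed.

Lemma power_exact x : coboundary (ev x ^+ 36).
Proof.
have pw n k : (n <= k)%N -> coboundary (ev x ^+ n) -> coboundary (ev x ^+ k).
  move=> le h; rewrite -(subnKC le) exprD; apply: coboundaryM => //.
  by case: (ecX (k - n) (ec_ev e A x)).
case: x pw => [[]|v] pw.
- by have := exact_x1; rewrite mmon.unlock expr0 mulr1.
- by apply: (pw 13%N) => //; have := exact_x2; rewrite mmon.unlock expr0 mul1r.
- by apply: (pw 9%N) => //; apply: exact_xv.
Qed.

Lemma Mdl_elliptic : elliptic (Mdl e A).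
Proof.
split.
  exists 120%N => n n120; apply: gset_eq0 => -[[[]|v]|[[[]|[]]|v]] /=;
    by apply: contraTneq n120 => <-.
exact: (cohomology_span (@Theta_homog V e A) (@Theta_closed V e A) power_exact).
Qed.

End Elliptic.

(** * Homotopies *)

Section PathAlgebra.
Variable B : cdga.
Local Notation P := (pathCdga B).
Implicit Types (a b : B) (u v : P).

Definition path_cst a : P := (a%:P, 0).

Lemma path_cst_linear : linear path_cst.
Proof.
move=> c a b; rewrite /path_cst; congr pair => /=; last by rewrite /qscale scaler0 addr0.
by apply/polyP => i; rewrite coefD coef_qscale !coefC; case: eqP => _; rewrite ?scaler0 ?addr0.
Qed.
HB.instance Definition _ := GRing.isLinear.Build rat B P *:%R path_cst path_cst_linear.

Lemma path_cst_monoid : monoid_morphism path_cst.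
Proof.
split=> [//|a b]; rewrite /path_cst [RHS]/GRing.mul /= /pmul /=.
by rewrite polyCM mulr0 mul0r addr0.
Qed.

Lemma path_cst_lrmorph : exists g : {lrmorphism B -> P}, g =1 path_cst.
Proof. exact: (lrmorph_pack (f := path_cst)) path_cst_monoid. Qed.

Lemma path_cst_homog n a : homog n a -> homog n (path_cst a).
Proof.
move=> h; apply/pcompP; split=> [i|]; first by rewrite coefC; case: eqP => // _; apply: homog0.
by case: n {h} => [//|n]; apply: phomog0.
Qed.

Lemma aug_linear i : linear (@aug B i).
Proof.
by move=> c u v; rewrite /aug /= hornerD hornerZ mulr_algl.
Qed.
HB.instance Definition _ i := GRing.isLinear.Build rat P B *:%R (aug i) (aug_linear i).

Lemma aug_monoid i : monoid_morphism (@aug B i).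
Proof.
split=> [|u v]; rewrite /aug /= ?hornerC // hornerM_comm //.
by rewrite /comm_poly mulr_algl mulr_algr.
Qed.

Lemma aug_lrmorph i : exists g : {lrmorphism P -> B}, g =1 @aug B i.
Proof. exact: (lrmorph_pack (f := @aug B i)) (aug_monoid i). Qed.

Lemma aug_cst i a : aug i (path_cst a) = a.
Proof. by rewrite /aug hornerC. Qed.

(** The path a + (b - a) t + c dt. If a and b have odd degree and d c = b - a, the two dt terms of
    its differential cancel ([diff_line]). *)
Definition path_line a b c : P := (a%:P + (b - a)%:P * 'X, c%:P).

Lemma aug_line0 a b c : aug 0 (path_line a b c) = a.
Proof. by rewrite /aug /= scale0r hornerD hornerC hornerMX mulr0 addr0. Qed.

Lemma aug_line1 a b c : aug 1 (path_line a b c) = b.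
Proof. by rewrite /aug /= scale1r hornerD hornerC hornerMX hornerC mulr1 addrC subrK. Qed.

Lemma path_line_cst a : path_line a a 0 = path_cst a.
Proof. by rewrite /path_line subrr polyC0 mul0r addr0. Qed.

Lemma path_line_homog n a b c : homog n.+1 a -> homog n.+1 b -> homog n c ->
  homog n.+1 (path_line a b c).
Proof.
move=> ha hb hc; apply/pcompP; split=> /= i; last first.
  by rewrite coefC; case: eqP => // _; apply: homog0.
rewrite coefD coefMX !coefC; apply: homogD; first by case: eqP => // _; apply: homog0.
case: eqP => _; first exact: homog0.
case: eqP => _; last exact: homog0.
by rewrite -[- a]scaleN1r; apply: homogD => //; apply: homogZ.
Qed.

Lemma diff_cst a : diff (path_cst a) = path_cst (diff a).
Proof.
rewrite /= /pdiff /path_cst /=; congr pair; last by rewrite derivC !raddf0 addr0.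
by rewrite map_polyC.
Qed.

Lemma diff_line n a b c : odd n -> homog n a -> homog n b -> diff c = b - a ->
  diff (path_line a b c) = path_cst (diff a).
Proof.
move=> on ha hb dc; have ddc : diff (b - a) = 0 by rewrite -dc diff_diff.
have sba : sgn (b - a) = - (b - a).
  have h : homog n (b - a) by rewrite -[- a]scaleN1r; apply: homogD => //; apply: homogZ.
  by rewrite (sgn_homog h) -signr_odd on expr1 scaleN1r.
rewrite /= /pdiff /path_line /path_cst /=; congr pair; apply/polyP => i.
  rewrite coef_map coefD coefMX !coefC /=; case: i => [|[|i]] /=.
  - by rewrite addr0.
  - by rewrite add0r ddc.
  - by rewrite addr0 linear0.
rewrite derivD derivC derivM derivC derivX mul0r !add0r mulr1 coefD !coef_map !coefC /=.
by case: eqP => _; rewrite ?linear0 ?addr0 // sba dc addNr.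
Qed.

End PathAlgebra.

(** Write H u = p + q dt. The coefficients of q have degree n, so q = 0; closedness then says that
    the t-derivative of p vanishes, so p is constant and both augmentations agree. *)
Lemma homotopic_cocycle (M B : cdga) (f g : dgMorphism M B) n (u : M) :
  (forall w : B, homog n w -> w = 0) -> homotopic f g -> homog n.+1 u -> diff u = 0 ->
  f u = g u.
Proof.
move=> B0 [H hH] hu du; have [<- <-] := hH u.
have : homog n.+1 (H u) by apply: gcm_homog.
have : diff (H u) = 0 by rewrite -dgm_diff du linear0.
case: (H u) => p q dpq /pcompP /= [_ hq].
have q0 : q = 0 by apply/polyP => i; rewrite coef0; apply/B0/hq.
move: dpq; rewrite q0 /= /pdiff /= raddf0 addr0 => -[_ /polyP sp].
suff p0 i : p`_i.+1 = 0.
  suff -> : p = (p`_0)%:P by rewrite /aug /= !hornerC.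
  by apply/polyP => -[|i]; rewrite coefC.
have := sp i; rewrite coef_map coef0 coef_deriv => /(congr1 (@sgn B)).
rewrite sgnK linear0 -scaler_nat => /eqP; rewrite scaler_eq0 pnatr_eq0 /=.
by move/eqP.
Qed.

(** * Elements of the model in the relevant degrees *)

Section LowDegrees.
Variables (V : finType) (e : rel V) (A : freeAlg (EvG V) (OdG V)).
Local Notation G := (freeGca A (@degE_even V) (@degO_odd V)).
Local Notation bas := (bas A).
Local Notation ev := (ev A).
Local Notation od := (od A).
Local Notation m := (mmon ev).
Local Notation gx1 := (gx1 V).
Local Notation gx2 := (gx2 V).
Local Notation gy1 := (gy1 V).
Local Notation gy2 := (gy2 V).
Local Notation gy3 := (gy3 V).
Local Notation gz := (gz V).
Local Notation wdg := (wdeg (@degE V) (@degO V)).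
Implicit Types (u q : A) (k l : monom (EvG V) (OdG V)).

Lemma wdegE k : wdg k =
  (k.1 gx1 * 8 + k.1 gx2 * 10 + (\sum_v k.1 (gxv v)) * 40 +
   ((gy1 \in k.2) * 33 + (gy2 \in k.2) * 35 + (gy3 \in k.2) * 37 + (gz \in k.2) * 119 +
    (\sum_v (gzv v \in k.2)) * 119))%N.
Proof.
rewrite /wdeg !big_sumType !big_bool /= !big_distrl /= !addnA.
by congr (_ + _)%N.
Qed.

Lemma homog_empty n : (forall k, wdg k != n) -> forall u, @homog G n u -> u = 0.
Proof.
move=> h; apply: fhomog_ind => [//|a u v -> ->|k /eqP]; first by rewrite scaler0 addr0.
by rewrite (negPf (h k)).
Qed.

Lemma wdeg_empty k : [/\ wdg k != 7, wdg k != 9 & wdg k != 39]%N.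
Proof. by rewrite wdegE; split; do 4 case: (_ \in _) => /=; lia. Qed.

Lemma homog7 u : @homog G 7 u -> u = 0.
Proof. by apply: homog_empty => k; case: (wdeg_empty k). Qed.

Lemma homog9 u : @homog G 9 u -> u = 0.
Proof. by apply: homog_empty => k; case: (wdeg_empty k). Qed.

Lemma homog39 u : @homog G 39 u -> u = 0.
Proof. by apply: homog_empty => k; case: (wdeg_empty k). Qed.

Lemma sum_nat_pos (F : V -> nat) : (0 < \sum_v F v)%N -> exists v, (0 < F v)%N.
Proof.
move=> h; case: (pickP (fun v => 0 < F v)%N) => [v hv|h0]; first by exists v.
by rewrite big1 // in h => v _; apply/eqP; rewrite -leqn0 leqNgt h0.
Qed.

Lemma bas_split_od j k : j \in k.2 ->
  exists c l, [/\ bas k = c *: (od j * bas l), wdg k = (degO j + wdg l)%N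
    & j \notin l.2].
Proof.
case: k => a S /= jS; have nj : j \notin ((a, S :\ j) : monom _ _).2 by rewrite setD11.
have ek : (a, S) = monM (mono_od _ j) (a, S :\ j).
  by rewrite /monM /= setD1K //; congr pair; apply/ffunP => x; rewrite !ffunE.
exists (eps [set j] (S :\ j)), (a, S :\ j); split=> //; first by rewrite ek bas_mono_od.
by rewrite ek wdegM ?wdeg_od // disjoints1.
Qed.

Lemma bas_split_ev x n k : (n <= k.1 x)%N ->
  exists l, [/\ bas k = ev x ^+ n * bas l, wdg k = (degE x * n + wdg l)%N
    & forall y, y != x -> l.1 y = k.1 y].
Proof.
elim: n k => [|n IH] k hn; first by exists k; split; rewrite ?expr0 ?mul1r ?muln0.
pose l : monom (EvG V) (OdG V) := ([ffun y => (k.1 y - (y == x))%N], k.2).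
have ek : k = monM (mono_ev _ x) l.
  case: k hn @l => [a S] /= hn; rewrite /monM /= set0U; congr pair; apply/ffunP => y.
  by rewrite !ffunE; case: eqP => [->|_]; rewrite ?subnKC ?subn0 // (leq_trans _ hn).
have [|l' [h1 h2 h3]] := IH l; first by rewrite ffunE eqxx; lia.
exists l'; split.
- by rewrite {1}ek bas_mono_ev h1 exprS mulrA.
- by rewrite ek wdegM /= ?disjoints_subset ?sub0set // wdeg_ev h2; lia.
- by move=> y ne; rewrite h3 // ffunE (negPf ne) subn0.
Qed.

Lemma bas_wdeg0 k : wdg k = 0%N -> bas k = 1.
Proof.
elim/monom_ind: k => [|x k _|j k nj _]; first by rewrite bas1.
  rewrite wdegM ?wdeg_ev /= ?disjoints_subset ?sub0set // => /eqP.
  by rewrite addn_eq0 => /andP[/eqP h]; have := degE_ge2 x; rewrite h.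
rewrite wdegM ?wdeg_od ?disjoints1 // => /eqP.
by rewrite addn_eq0 => /andP[/eqP h]; have := degO_ge2 j; rewrite h.
Qed.

Lemma bas_ev_exact x n k : (n <= k.1 x)%N -> wdg k = (degE x * n)%N -> bas k = ev x ^+ n.
Proof.
move=> /bas_split_ev[l [-> -> _]] h; rewrite bas_wdeg0 ?mulr1 //.
by apply/eqP; rewrite -(eqn_add2l (degE x * n)) h addn0.
Qed.

Lemma bas_od_exact j k : j \in k.2 -> wdg k = degO j -> exists c, bas k = c *: od j.
Proof.
move=> /bas_split_od[c [l [-> -> _]]] h; exists c; rewrite bas_wdeg0 ?mulr1 //.
by apply/eqP; rewrite -(eqn_add2l (degO j)) h addn0.
Qed.

Lemma homog_span1 n u0 : (forall k, wdg k = n -> exists c, bas k = c *: u0) ->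
  forall u, @homog G n u -> exists c, u = c *: u0.
Proof.
move=> h; apply: fhomog_ind => [|a u v [c ->] [c' ->]|k /h //].
  by exists 0; rewrite scale0r.
by exists (a * c + c'); rewrite scalerDl scalerA.
Qed.

Lemma homog8 u : @homog G 8 u -> exists c, u = c *: ev gx1.
Proof.
apply: homog_span1 => k h; exists 1; rewrite scale1r.
apply: (bas_ev_exact (n := 1)) => //; move: h; rewrite wdegE.
by do 4 case: (_ \in _) => /=; lia.
Qed.

Lemma homog10 u : @homog G 10 u -> exists c, u = c *: ev gx2.
Proof.
apply: homog_span1 => k h; exists 1; rewrite scale1r.
apply: (bas_ev_exact (n := 1)) => //; move: h; rewrite wdegE.
by do 4 case: (_ \in _) => /=; lia.
Qed.

Lemma homog_y u j : (j = gy1 \/ j = gy2 \/ j = gy3) -> @homog G (degO j) u ->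
  exists c, u = c *: od j.
Proof.
move=> hj; apply: homog_span1 => k h; apply: bas_od_exact => //; move: h; rewrite wdegE.
case: hj => [->|[->|->]] /=; do 4 case: (_ \in _) => //=; lia.
Qed.

Definition lin40 a b (c : V -> rat) : A := a *: m 5 0 + b *: m 0 4 + \sum_v c v *: ev (gxv v).

Lemma lin40P r a b c a' b' c' : r *: lin40 a b c + lin40 a' b' c' =
  lin40 (r * a + a') (r * b + b') (fun v => r * c v + c' v).
Proof.
rewrite /lin40 !scalerDr !scalerA scaler_sumr.
under [in RHS]eq_bigr => v _ do rewrite scalerDl -scalerA.
rewrite big_split /= !scalerDl.
by rewrite [LHS](AC (3*3) ((1*4)*(2*5)*(3*6))).
Qed.

Lemma homog40 u : @homog G 40 u -> exists a b c, u = lin40 a b c.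
Proof.
move: u; apply: fhomog_ind => [|r u v [a [b [c ->]]] [a' [b' [c' ->]]]|k h].
- exists 0, 0, (fun=> 0); rewrite /lin40 !scale0r big1 ?addr0 // => v _.
  by rewrite scale0r.
- by rewrite lin40P; do 3 eexists.
have : [\/ k.1 gx1 = 5, k.1 gx2 = 4 | 0 < \sum_v k.1 (gxv v)]%N.
  have : ((k.1 gx1 = 5) \/ (k.1 gx2 = 4) \/ (0 < \sum_v k.1 (gxv v)))%N.
    by move: h; rewrite wdegE; do 4 case: (_ \in _) => /=; lia.
  by case=> [->|[->|->]]; [constructor 1|constructor 2|constructor 3].
case=> [e5|e4|/sum_nat_pos[v ev1]].
- exists 1, 0, (fun=> 0); rewrite /lin40 scale1r scale0r big1; last by move=> v _; rewrite scale0r.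
  by rewrite !addr0 (bas_ev_exact (x := gx1) (n := 5)) ?e5 // mmon.unlock expr0 mulr1.
- exists 0, 1, (fun=> 0); rewrite /lin40 scale1r scale0r big1; last by move=> v _; rewrite scale0r.
  by rewrite addr0 add0r (bas_ev_exact (x := gx2) (n := 4)) ?e4 // mmon.unlock expr0 mul1r.
- exists 0, 0, (fun w => (w == v)%:R); rewrite /lin40 !scale0r !add0r (bigD1 v) //= eqxx.
  rewrite scale1r big1 ?addr0 => [|w /negPf ->]; last by rewrite scale0r.
  by rewrite (bas_ev_exact (n := 1) ev1).
Qed.

(** The monomial beside each y_i complements d y_i to x1^5 x2^4, so the y-part has differential x1^5
    x2^4 (q1 + q2 + q3). *)
Definition lin119 c (cw : V -> rat) q1 q2 q3 : A :=
  c *: od gz + \sum_v cw v *: od (gzv v) +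
  (od gy1 * m 2 3 * q1 + od gy2 * m 3 2 * q2 + od gy3 * m 4 1 * q3).

Lemma homog119 u : @homog G 119 u -> exists c cw q1 q2 q3,
  [/\ @homog G 40 q1, @homog G 40 q2, @homog G 40 q3 & u = lin119 c cw q1 q2 q3].
Proof.
have h0 : @homog G 40 0 by apply: homog0.
have lin0 c cw : lin119 c cw 0 0 0 = c *: od gz + \sum_v cw v *: od (gzv v).
  by rewrite /lin119 !mulr0 !addr0.
have sum0 : \sum_v (0 : rat) *: od (gzv v) = 0 :> A.
  by rewrite big1 // => v _; rewrite scale0r.
move: u; apply: fhomog_ind => [|r u v|k h].
- exists 0, (fun=> 0), 0, 0, 0; split=> //.
  by rewrite lin0 scale0r sum0 addr0.
- move=> [c [cw [q1 [q2 [q3 [h1 h2 h3 ->]]]]]] [c' [cw' [q1' [q2' [q3' [h1' h2' h3' ->]]]]]].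
  exists (r * c + c'), (fun v => r * cw v + cw' v), (r *: q1 + q1'), (r *: q2 + q2'), (r *: q3 + q3').
  split; try by apply: homogD => //; apply: homogZ.
  rewrite /lin119 !scalerDr !scalerA scaler_sumr !mulrDr -!scalerAr.
  under [in RHS]eq_bigr => w _ do rewrite scalerDl -scalerA.
  rewrite big_split /= scalerDl.
  by rewrite [LHS](AC ((2*3)*(2*3)) ((1*6)*(2*7)*((3*8)*(4*9)*(5*10)))).
have split2 a b l : (a <= l.1 gx1)%N -> (b <= l.1 gx2)%N -> wdg l = (8 * a + 10 * b + 40)%N ->
    exists q, @homog G 40 q /\ bas l = m a b * q.
  move=> la lb wl; have [l1 [e1 w1 o1]] := bas_split_ev la.
  have lb1 : (b <= l1.1 gx2)%N by rewrite o1.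
  have [l2 [e2 w2 _]] := bas_split_ev lb1; exists (bas l2); split.
    by have := homog_bas A (@degE_even V) (@degO_odd V) l2; congr homog; move: w1 w2 => /=; lia.
  by rewrite e1 e2 mmon.unlock mulrA.
have splity j a b : j \in k.2 -> (forall l, j \notin l.2 -> wdg k = (degO j + wdg l)%N ->
      [/\ (a <= l.1 gx1)%N, (b <= l.1 gx2)%N & wdg l = (8 * a + 10 * b + 40)%N]) ->
    exists q, @homog G 40 q /\ bas k = od j * m a b * q.
  move=> /bas_split_od[c [l [-> wk jl]]] /(_ l jl wk)[la lb wl].
  have [q [hq ->]] := split2 a b l la lb wl.
  exists (c *: q); split; first exact: homogZ.
  by rewrite -scalerAr mulrA.
have [hz|[[v hv]|[hy|[hy|hy]]]] : gz \in k.2 \/ (exists v, gzv v \in k.2) \/ gy1 \in k.2 \/ gy2 \in k.2 \/ gy3 \in k.2.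
- move: h; rewrite wdegE; case: (gz \in k.2); first by left.
  case: (posnP (\sum_v (gzv v \in k.2))) => [->|/sum_nat_pos[v hv] _]; last first.
    by right; left; exists v; case: (_ \in _) hv.
  case: (gy1 \in k.2); first by right; right; left.
  case: (gy2 \in k.2); first by right; right; right; left.
  case: (gy3 \in k.2); first by right; right; right; right.
  by rewrite /=; lia.
- have [//|c ->] := bas_od_exact hz; exists c, (fun=> 0), 0, 0, 0; split=> //.
  by rewrite lin0 sum0 addr0.
- have [//|c ->] := bas_od_exact hv; exists 0, (fun w => (w == v)%:R * c), 0, 0, 0; split=> //.
  rewrite lin0 scale0r add0r (bigD1 v) //= eqxx mul1r big1 ?addr0 // => w /negPf ->.
  by rewrite mul0r scale0r.
(* The cofactor of y1 has degree 86, and 8a + 10b + 40c = 86 forces a >= 2 and b >= 3; no further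
   odd generators fit. The cases y2 and y3 are alike, with 84 and 82. *)
- have [|q [hq ->]] := splity _ 2%N 3%N hy.
    move=> l; rewrite h; have := wdegE l; move: (wdg l) => W.
    case: (gy1 \in l.2); case: (gy2 \in l.2); case: (gy3 \in l.2); case: (gz \in l.2);
      by move=> /= wl // _ hl; split; lia.
  exists 0, (fun=> 0), q, 0, 0; split=> //.
  by rewrite /lin119 scale0r sum0 !mulr0 !add0r !addr0.
- have [|q [hq ->]] := splity _ 3%N 2%N hy.
    move=> l; rewrite h; have := wdegE l; move: (wdg l) => W.
    case: (gy1 \in l.2); case: (gy2 \in l.2); case: (gy3 \in l.2); case: (gz \in l.2);
      by move=> /= wl // _ hl; split; lia.
  exists 0, (fun=> 0), 0, q, 0; split=> //.
  by rewrite /lin119 scale0r sum0 !mulr0 !add0r !addr0.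
- have [|q [hq ->]] := splity _ 4%N 1%N hy.
    move=> l; rewrite h; have := wdegE l; move: (wdg l) => W.
    case: (gy1 \in l.2); case: (gy2 \in l.2); case: (gy3 \in l.2); case: (gz \in l.2);
      by move=> /= wl // _ hl; split; lia.
  exists 0, (fun=> 0), 0, 0, q; split=> //.
  by rewrite /lin119 scale0r sum0 !mulr0 !add0r.
Qed.

End LowDegrees.

(** * Cocycles in the degrees of the odd generators *)

Section Homotopy.
Variables (V : finType) (e : rel V) (A : freeAlg (EvG V) (OdG V)).
Local Notation G := (freeGca A (@degE_even V) (@degO_odd V)).
Local Notation ev := (ev A).
Local Notation od := (od A).
Local Notation m := (mmon ev).
Local Notation gx1 := (gx1 V).
Local Notation gx2 := (gx2 V).
Local Notation gy1 := (gy1 V).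
Local Notation gy2 := (gy2 V).
Local Notation gy3 := (gy3 V).
Local Notation gz := (gz V).
Local Notation d := (dif (Theta e A)).
Local Notation ec := (even_cocycle e).
Implicit Types (u q : A) (t : EvG V -> rat).
Local Arguments Theta : simpl never.

(** Evaluation at a rational point, with odd generators sent to 0, turns identities in the model
    into numerical ones. *)
Lemma eval_exists t : exists g : {lrmorphism A -> rat^o},
  (forall x, g (ev x) = t x) /\ (forall j, g (od j) = 0).
Proof.
apply: (@lift_exists _ _ A rat^o t (fun=> 0)) => [x b|i j].
  by rewrite mulrC.
by rewrite mul0r oppr0.
Qed.

Definition eval t : {lrmorphism A -> rat^o} := projT1 (boolp.cid (eval_exists t)).

Lemma eval_ev t x : eval t (ev x) = t x.
Proof. by rewrite /eval; case: boolp.cid => g []. Qed.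

Lemma eval_od t j : eval t (od j) = 0.
Proof. by rewrite /eval; case: boolp.cid => g []. Qed.

Lemma eval_mmon t a b : eval t (m a b) = t gx1 ^+ a * t gx2 ^+ b.
Proof. by rewrite mmon.unlock rmorphM !rmorphXn /= !eval_ev. Qed.

Lemma eval_omega t : eval t (omegaOf ev od) = 0.
Proof. by rewrite /omegaOf rmorphD rmorphB !rmorphM /= !eval_od !mul0r subr0 addr0. Qed.

Lemma eval_Theta_z t : eval t (Theta e A gz) = t gx1 ^+ 15 + t gx2 ^+ 12.
Proof. by rewrite /Theta /= rmorphD rmorphD /= eval_omega !eval_mmon add0r mulr1 mul1r. Qed.

Lemma eval_Theta_zv t v : eval t (Theta e A (gzv v)) =
  t (gxv v) ^+ 3 + \sum_(w | e v w) t (gxv v) * t (gxv w) * t gx2 ^+ 4.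
Proof.
rewrite /Theta /= rmorphD rmorphXn /= eval_ev rmorph_sum; congr (_ + _); apply: eq_bigr => w _.
by rewrite !rmorphM /= !eval_ev eval_mmon mul1r.
Qed.

Definition point (a b : rat) (c : V -> rat) (x : EvG V) : rat :=
  match x with inl true => a | inl false => b | inr v => c v end.

Lemma eval_lin40 t a b (c : V -> rat) : eval t (lin40 A a b c) =
  a * t gx1 ^+ 5 + b * t gx2 ^+ 4 + \sum_v c v * t (gxv v).
Proof.
rewrite /lin40 !linearD !linearZ /= !eval_mmon linear_sum mulr1 mul1r; congr (_ + _).
by apply: eq_bigr => v _; rewrite linearZ /= eval_ev.
Qed.

Lemma sum_delta (c : V -> rat) w : \sum_v c v * (v == w)%:R = c w.
Proof.
rewrite (bigD1 w) //= eqxx mulr1 big1 ?addr0 // => v /negPf ->.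
by rewrite mulr0.
Qed.

Lemma sum_zero (c : V -> rat) : \sum_v c v * 0 = 0.
Proof. by rewrite big1 // => v _; rewrite mulr0. Qed.

Lemma lin40_eq0 u : @homog G 40 u ->
  (forall t, t gx1 != 0 -> t gx2 != 0 -> eval t u = 0) -> u = 0.
Proof.
move=> /homog40[a [b [c ->]]] h.
(* These points give a + b = 0 and 32 a + b = 0. *)
have h1 := h (point 1 1 (fun=> 0)) isT isT; have h2 := h (point 2 1 (fun=> 0)) isT isT.
rewrite !eval_lin40 /= !sum_zero in h1 h2.
have [a0 b0] : a = 0 /\ b = 0 by split; lra.
rewrite a0 b0 /lin40 !scale0r !add0r big1 // => w _.
have := h (point 1 1 (fun v => (v == w)%:R)) isT isT.
by rewrite eval_lin40 a0 b0 !mul0r !add0r sum_delta => ->; rewrite scale0r.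
Qed.

Lemma ec_lin40 u : @homog G 40 u -> ec u.
Proof.
move=> /homog40[a [b [c ->]]]; rewrite /lin40 -addrA.
apply: ecP; first exact: ec_mmon.
apply: ecP; first exact: ec_mmon.
elim/big_ind: _ => [||v _]; [exact: ec0|exact: ecD|].
by rewrite -[_ *: _]addr0; apply: ecP; [apply: ec_ev|apply: ec0].
Qed.

Lemma od_coboundary_eq0 j c : (j = gy1 \/ j = gy2 \/ j = gy3) ->
  d (c *: od j) = 0 -> c = 0.
Proof.
move=> hj; rewrite linearZ /= dif_od => /(congr1 (eval (point 1 1 (fun=> 0)))).
by case: hj => [->|[->|->]]; rewrite linear0 linearZ /= /Theta /= eval_mmon /= !expr1n mulr1 => <-;
  rewrite [RHS]mulr1.
Qed.

Lemma cocycle_y j u : (j = gy1 \/ j = gy2 \/ j = gy3) -> @homog G (degO j) u ->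
  d u = 0 -> u = 0.
Proof.
move=> hj /(homog_y hj)[c ->] /(od_coboundary_eq0 hj) ->.
by rewrite scale0r.
Qed.

Lemma dif_lin119 c cw q1 q2 q3 : ec q1 -> ec q2 -> ec q3 ->
  d (lin119 c cw q1 q2 q3) = c *: Theta e A gz + \sum_v cw v *: Theta e A (gzv v) +
    m 5 4 * (q1 + q2 + q3).
Proof.
move=> h1 h2 h3.
have dt j a b q : ec q -> d (od j * m a b * q) = Theta e A j * m a b * q.
  by move=> hq; rewrite (dif_Mec _ hq) (dif_Mec _ (ec_mmon _ _ _ _)) dif_od.
rewrite /lin119 [LHS]linearD; congr (_ + _).
  rewrite linearD linearZ /= dif_od linear_sum; congr (_ + _).
  by apply: eq_bigr => w _; rewrite linearZ /= dif_od.
by rewrite !linearD /= !dt // !mulrDr /Theta /= !mmonM.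
Qed.

Lemma homog118 q1 q2 : @homog G 40 q1 -> @homog G 40 q2 ->
  @homog G 118 (od gy1 * od gy2 * m 0 1 * q1 + od gy1 * od gy3 * m 1 0 * q2).
Proof.
move=> h1 h2; have ho j : @homog G (degO j) (od j) by apply: homog_od.
have hm a b : @homog G (8 * a + 10 * b) (m a b).
  by apply: (@mmon_homog V G) => x; apply: homog_ev.
apply: homogD.
  exact: (homogM (homogM (homogM (ho gy1) (ho gy2)) (hm 0%N 1%N)) h1).
exact: (homogM (homogM (homogM (ho gy1) (ho gy3)) (hm 1%N 0%N)) h2).
Qed.

Lemma eval_comb t c cw (Tz : A) (T : V -> A) q :
  eval t (c *: Tz + \sum_v cw v *: T v + m 5 4 * q) =
  c * eval t Tz + \sum_v cw v * eval t (T v) + t gx1 ^+ 5 * t gx2 ^+ 4 * eval t q.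
Proof.
rewrite !linearD linearZ /= linear_sum rmorphM /= eval_mmon; congr (_ + _ + _).
by apply: eq_bigr => v _; rewrite linearZ.
Qed.

(** Evaluating d u where a single even generator is nonzero kills the coefficients of z and the z_v;
    what remains of d u = 0 is q1 + q2 + q3 = 0. *)
Lemma exact119 u : @homog G 119 u -> d u = 0 -> exists n, @homog G 118 n /\ d n = u.
Proof.
move=> /homog119[c [cw [q1 [q2 [q3 [h1 h2 h3 ->]]]]]].
rewrite dif_lin119; try exact: ec_lin40.
move=> E; have Et t : eval t (c *: Theta e A gz + \sum_v cw v *: Theta e A (gzv v) +
    m 5 4 * (q1 + q2 + q3)) = 0 by rewrite E linear0.
have c0 : c = 0.
  have := Et (point 1 0 (fun=> 0)); rewrite eval_comb eval_Theta_z /=.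
  rewrite !(expr0n, expr1n) /= !(mulr0, mul0r) !addr0 mulr1 big1 ?addr0 // => v _.
  by rewrite eval_Theta_zv /= expr0n big1 ?addr0 ?mulr0 // => w _; rewrite !mul0r.
have cw0 w : cw w = 0.
  have := Et (point 0 0 (fun v => (v == w)%:R)); rewrite eval_comb c0 /= !(mul0r, mulr0) addr0 add0r.
  rewrite (eq_bigr (fun v => cw v * (v == w)%:R)) ?sum_delta // => v _.
  rewrite eval_Theta_zv /= big1 ?addr0; first by case: eqP; rewrite ?expr1n ?expr0n.
  by move=> w' _; rewrite expr0n mulr0.
have q0 : q1 + q2 + q3 = 0.
  apply: lin40_eq0 => [|t t1 t2]; first by do 2 apply: homogD => //.
  have := Et t; rewrite eval_comb c0 mul0r add0r big1 ?add0r => [|v _]; last by rewrite cw0 mul0r.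
  have /negPf nz : t gx1 ^+ 5 * t gx2 ^+ 4 != 0 by rewrite mulf_neq0 // expf_neq0.
  by move/eqP; rewrite mulf_eq0 nz => /eqP.
have q1E : q1 = - q2 - q3 by rewrite -opprD; apply/eqP; rewrite -addr_eq0 addrA q0.
(* The differentials of y1 y2 x2 and y1 y3 x1 are the differences of the y2-term, respectively
   y3-term, and the y1-term of [lin119]. *)
exists (od gy1 * od gy2 * m 0 1 * q2 + od gy1 * od gy3 * m 1 0 * q3); split.
  exact: homog118.
have cyc1 i j a b q : ec q -> d (od i * od j * m a b * q) =
    (Theta e A i * od j - od i * Theta e A j) * m a b * q.
  by move=> hq; rewrite (dif_Mec _ hq) (dif_Mec _ (ec_mmon _ _ _ _)) dif_odod.
rewrite linearD /= !cyc1; try exact: ec_lin40.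
rewrite /lin119 c0 scale0r add0r big1 ?add0r => [|v _]; last by rewrite cw0 scale0r.
rewrite q1E /Theta /= !mulrBl !mmon_mid !mmon_right /= mulrBr mulrN.
by rewrite [RHS](AC 4 ((3*1)*(4*2))).
Qed.

End Homotopy.

(** * Homotopy of self-maps is agreement on the even generators *)

Section SelfMaps.
Variables (V : finType) (e : rel V) (A : freeAlg (EvG V) (OdG V)).
Local Notation G := (freeGca A (@degE_even V) (@degO_odd V)).
Local Notation ev := (ev A).
Local Notation od := (od A).
Local Notation gy1 := (gy1 V).
Local Notation gy2 := (gy2 V).
Local Notation gy3 := (gy3 V).
Local Notation d := (dif (Theta e A)).
Local Notation M := (sul_cdga (Mdl e A)).
Implicit Types (u q : A) (t : EvG V -> rat) (f g h : dgMorphism M M).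
Local Arguments Theta : simpl never.

Definition agree f g := forall x, f (ev x) = g (ev x).

Lemma dgm_Theta f j : f (Theta e A j) = thetaOf e (f \o ev) (f \o od) j.
Proof. exact: (rmorph_thetaOf e (gcm_fun f)). Qed.

Lemma dgm_dif f u : f (d u) = d (f u).
Proof. exact: (dgm_diff f u). Qed.

Lemma dgm_homog f n u : @homog G n u -> @homog G n (f u).
Proof. exact: (@gcm_homog _ _ f n u). Qed.

Lemma homotopic_agree f g : homotopic f g -> agree f g.
Proof.
move=> hfg x; have hx := homog_ev A (@degE_even V) (@degO_odd V) x.
have dx : @diff M (ev x) = 0 by apply: dif_ev.
case: x hx dx => [[]|v] hx dx.
- exact: (@homotopic_cocycle M M f g 7 _ (@homog7 _ A) hfg hx dx).
- exact: (@homotopic_cocycle M M f g 9 _ (@homog9 _ A) hfg hx dx).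
- exact: (@homotopic_cocycle M M f g 39 _ (@homog39 _ A) hfg hx dx).
Qed.

Lemma homogB n u q : @homog G n u -> @homog G n q -> @homog G n (u - q).
Proof. by move=> hu hq; apply: (@homogD G) => //; apply: (@homogN G). Qed.

Lemma agree_y f g j : (j = gy1 \/ j = gy2 \/ j = gy3) -> agree f g -> f (od j) = g (od j).
Proof.
move=> hj fg; apply/eqP; rewrite -subr_eq0; apply/eqP.
have ho : @homog G (degO j) (od j) by apply: homog_od.
apply: (@cocycle_y V e A j) => //; first by apply: homogB; apply: dgm_homog.
rewrite linearB /= -!dgm_dif dif_od !dgm_Theta.
by case: hj => [->|[->|->]] /=; rewrite mmon.unlock /= !fg subrr.
Qed.

Lemma agree_Theta f g j : agree f g -> f (Theta e A j) = g (Theta e A j).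
Proof.
move=> fg; rewrite !dgm_Theta; apply: eq_thetaOf => //=; by apply: agree_y => //; auto.
Qed.

(** The clause n = 0 keeps the homotopy constant on the y's, the only odd generators that occur in
    differentials. *)
Lemma agree_coboundary f g j : agree f g -> exists n,
  [/\ @homog G (degO j).-1 n, d n = g (od j) - f (od j) &
      (j = gy1 \/ j = gy2 \/ j = gy3) -> n = 0].
Proof.
move=> fg.
have cyc : d (g (od j) - f (od j)) = 0.
  by rewrite linearB /= -!dgm_dif dif_od -(agree_Theta _ fg) subrr.
have ho : @homog G (degO j) (g (od j) - f (od j)).
  by apply: homogB; apply: dgm_homog; apply: homog_od.
have yc : (j = gy1 \/ j = gy2 \/ j = gy3) -> exists n,
    [/\ @homog G (degO j).-1 n, d n = g (od j) - f (od j) &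
      (j = gy1 \/ j = gy2 \/ j = gy3) -> n = 0].
  move=> hj; exists 0; split=> //; first exact: (@homog0 G).
  by rewrite linear0 (agree_y hj fg) subrr.
case: j ho cyc yc => [[[]|[]]|v] ho cyc yc; try (by apply: yc; auto).
  by have [n [hn dn]] := exact119 ho cyc; exists n; split=> // -[//|[]].
by have [n [hn dn]] := exact119 ho cyc; exists n; split=> // -[//|[]].
Qed.

Lemma agree_homotopic f g : agree f g -> homotopic f g.
Proof.
move=> fg; have [n hn] := boolp.choice (fun j => agree_coboundary j fg).
pose fe x := path_cst (B := M) (f (ev x)).
pose fo j := path_line (B := M) (f (od j)) (g (od j)) (n j).
have hev x := homog_ev A (@degE_even V) (@degO_odd V) x.
have hod j := homog_od A (@degE_even V) (@degO_odd V) j.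
have [cst cstE] := path_cst_lrmorph M.
have fo_y j : (j = gy1 \/ j = gy2 \/ j = gy3) -> fo j = cst (f (od j)).
  move=> hj; have [_ _ n0] := hn j.
  by rewrite cstE /fo (agree_y hj fg) n0 // path_line_cst.
have [||||H [He Ho]] := @dgm_exists _ _ A _ _ (@degE_even V) (@degO_odd V) _
  (@Theta_homog V e A) (@Theta_closed V e A) (pathCdga M) fe fo.
- by move=> x; apply/path_cst_homog/dgm_homog.
- move=> j; have [h _ _] := hn j; have := dgm_homog f (hod j).
  have := dgm_homog g (hod j); case: (degO j) (@degO_odd V j) h => // k _ h hg hf.
  exact: path_line_homog.
- by move=> x; rewrite diff_cst -dgm_diff [diff _]dif_ev !linear0.
- move=> k ke ko j; have [_ dn _] := hn j.
  rewrite [diff (fo j)](@diff_line M (degO j) (f (od j)) (g (od j)) (n j) (degO_odd j) (dgm_homog f (hod j)) (dgm_homog g (hod j)) dn).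
  rewrite -dgm_diff [diff _]dif_od dgm_Theta (rmorph_thetaOf e k) -cstE (rmorph_thetaOf e cst).
  apply: eq_thetaOf => [x|||] /=; first by rewrite ke cstE.
  + by rewrite ko fo_y; auto.
  + by rewrite ko fo_y; auto.
  + by rewrite ko fo_y; auto.
exists H => u.
have [a0 a0E] := aug_lrmorph M 0; have [a1 a1E] := aug_lrmorph M 1.
rewrite -a0E -a1E; split.
  apply: (@lrmorph_ext _ _ A M (a0 \o gcm_fun H) (gcm_fun f)) => [x|j] /=.
    by rewrite He a0E aug_cst.
  by rewrite Ho a0E aug_line0.
apply: (@lrmorph_ext _ _ A M (a1 \o gcm_fun H) (gcm_fun g)) => [x|j] /=.
  by rewrite He a1E aug_cst fg.
by rewrite Ho a1E aug_line1.
Qed.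

End SelfMaps.

(** * Self-equivalences *)

(** Comparison of the coefficients of s^3, r^3, s^2 r, s^2 and s r. Twelve sample points give
    equations that are linear in the monomials of the parameters. *)
Lemma cubic_coefficients (a b c A B D C C' ep : rat) :
  (forall s r : rat, (a * s + b * r + c) ^+ 3 + (a * s + b * r + c) * (A * s + B * r + D) =
    C * (s ^+ 3 + ep * (s * r)) + C' * (r ^+ 3 + ep * (s * r))) ->
  [/\ a ^+ 3 = C, b ^+ 3 = C', a * b = 0, 3 * a ^+ 2 * c + a * A = 0 &
      6 * a * b * c + a * B + b * A = ep * (C + C')].
Proof.
move=> h.
have h00 := h 0 0; have h10 := h 1 0; have hm0 := h (-1) 0; have h20 := h 2 0.
have h01 := h 0 1; have h0m := h 0 (-1); have h02 := h 0 2.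
have h11 := h 1 1; have hm1 := h (-1) 1; have h1m := h 1 (-1); have h21 := h 2 1.
have h12 := h 1 2.
have ab : a ^+ 2 * b = 0 by lra.
split; try lra.
by move/eqP: ab; rewrite mulf_eq0 expf_eq0 /= -mulf_eq0 => /eqP.
Qed.

Lemma cube_root_one (x : rat) : x ^+ 3 = 1 -> x = 1.
Proof.
move=> x3.
have /eqP : (x - 1) * (x ^+ 2 + x + 1) = 0 by transitivity (x ^+ 3 - 1); [ring|rewrite x3 subrr].
by rewrite mulf_eq0 subr_eq0 => /orP[/eqP//|/eqP h]; nra.
Qed.

(** * Rigidity of the cubic identities attached to the graph *)

Section Rigidity.
Variables (V : finType) (e : rel V).
Hypotheses (e_sym : symmetric e) (e_irr : irreflexive e).
Hypothesis e_nbr : forall v, exists w, e v w.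
(** For a self-equivalence f, [a v w] and [c v] are the coefficients of x_w and x2^4 in f(x_v), [b]
    is the matrix of an inverse, and [C v w] is the coefficient of z_w in f(z_v). [L v] is then
    f(x_v) at x1 = 0, x2 = 1, once its x1^5 term is known to vanish or is killed by x1 = 0. *)
Variables (a b : V -> V -> rat) (c : V -> rat) (C : V -> V -> rat).

Let L v (t : V -> rat) := \sum_w a v w * t w + c v.

Hypothesis cubic : forall v t,
  L v t ^+ 3 + \sum_(u | e v u) L v t * L u t =
  \sum_w C v w * (t w ^+ 3 + \sum_(u | e w u) t w * t u).
Hypothesis ab1 : forall v u, \sum_w a v w * b w u = (v == u)%:R.

Let N v w := \sum_(u | e v u) a u w.

Lemma sum_two (F : V -> rat) w w' s r : w != w' ->
  \sum_x F x * (s * (x == w)%:R + r * (x == w')%:R) = F w * s + F w' * r.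
Proof.
move=> ne; have ne' : w' != w by rewrite eq_sym.
rewrite (bigD1 w) //= (bigD1 w') //= !eqxx (negPf ne) (negPf ne').
rewrite big1 => [|x /andP[/negPf -> /negPf ->]]; last by rewrite !(mulr0, addr0).
by rewrite !mulr0 !mulr1 ?addr0 ?add0r.
Qed.

(** The cubic identity restricted to the plane of the coordinates w and w'. *)
Lemma coefficients v w w' : w != w' ->
  [/\ a v w ^+ 3 = C v w, a v w' ^+ 3 = C v w', a v w * a v w' = 0,
    3 * a v w ^+ 2 * c v + a v w * N v w = 0 &
    6 * a v w * a v w' * c v + a v w * N v w' + a v w' * N v w =
      (e w w')%:R * (C v w + C v w')].
Proof.
move=> ne; apply: (cubic_coefficients (D := \sum_(u | e v u) c u)) => s r.
pose t x := s * (x == w)%:R + r * (x == w')%:R.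
have Lt u : L u t = a u w * s + a u w' * r + c u by rewrite /L sum_two.
have := cubic v t; rewrite Lt -mulr_sumr.
under [X in _ + _ * X]eq_bigr => u _ do rewrite Lt.
rewrite !big_split /= -!mulr_suml -/(N v w) -/(N v w') => ->.
have tw : t w = s by rewrite /t eqxx (negPf ne) mulr1 mulr0 addr0.
have ne' : w' != w by rewrite eq_sym.
have tw' : t w' = r by rewrite /t eqxx (negPf ne') mulr1 mulr0 add0r.
have tx x : x != w -> x != w' -> t x = 0.
  by move=> /negPf n1 /negPf n2; rewrite /t n1 n2 !mulr0 addr0.
have nb x : \sum_(u | e x u) t u = (e x w)%:R * s + (e x w')%:R * r.
  rewrite big_mkcond /= -(sum_two (fun u => (e x u)%:R) s r ne); apply: eq_bigr => u _.
  by case: (e x u); rewrite ?mul1r ?mul0r.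
under eq_bigr => x _ do rewrite -mulr_sumr nb.
rewrite (bigD1 w) //= (bigD1 w') //= big1 => [|x /andP[n1 n2]].
  by rewrite addr0 !e_irr tw tw' [e w' w]e_sym /=; ring.
by rewrite tx // expr0n mul0r addr0 mulr0.
Qed.

Lemma exists_other (v : V) : exists w, w != v.
Proof. by have [w vw] := e_nbr v; exists w; apply: contraTneq vw => ->; rewrite e_irr. Qed.

Lemma row_nonzero v : exists w, a v w != 0.
Proof.
apply/existsP; apply: contraT; rewrite negb_exists => /forallP h.
have := ab1 v v; rewrite eqxx big1 => [/eqP|w _]; first by rewrite eq_sym oner_eq0.
by have /negPn/eqP -> := h w; rewrite mul0r.
Qed.

Definition target v : V := xchoose (row_nonzero v).

Lemma target_neq0 v : a v (target v) != 0.
Proof. exact: xchooseP (row_nonzero v). Qed.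

Lemma row_zero v w : w != target v -> a v w = 0.
Proof.
move=> ne; have [_ _ h _ _] := coefficients v ne.
by move/eqP: h; rewrite mulf_eq0 (negPf (target_neq0 v)) orbF => /eqP.
Qed.

Lemma row_sum v u : a v (target v) * b (target v) u = (v == u)%:R.
Proof.
rewrite -ab1 (bigD1 (target v)) //= big1 ?addr0 // => w /row_zero ->.
by rewrite mul0r.
Qed.

(** Two rows with their only nonzero entry in the same column would be proportional, against
    invertibility of [a]. *)
Lemma target_inj : injective target.
Proof.
move=> v u h; apply/eqP; have := row_sum v u.
have hu := row_sum u u; rewrite eqxx -h in hu.
case: (v == u) => //= /eqP; rewrite mulf_eq0 (negPf (target_neq0 v)) /= => /eqP b0.
by move/eqP: hu; rewrite b0 mulr0 eq_sym oner_eq0.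
Qed.

Lemma N_target v u : N v (target u) = (e v u)%:R * a u (target u).
Proof.
rewrite /N big_mkcond (bigD1 u) //= big1 ?addr0; last first.
  move=> w ne; case: ifP => // _; apply: row_zero.
  by apply: contra ne => /eqP /target_inj ->.
by case: (e v u); rewrite ?mul1r ?mul0r.
Qed.

(** In the coefficient of s^2 at [target v], the neighbour sum is [e v v] times an entry, which is 0
    as there are no loops; what remains is 3 a^2 c = 0. *)
Lemma shift_zero v : c v = 0.
Proof.
have [w ne] := exists_other (target v).
rewrite eq_sym in ne; have [_ _ _ h _] := coefficients v ne.
move/eqP: h; rewrite N_target e_irr mul0r mulr0 addr0 !mulf_eq0 (negPf (target_neq0 v)) /=.
by move/eqP.
Qed.

(** With a_v the nonzero entry of row v, the s r coefficient at the two targets says that a_v a_u,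
    counted if v and u are adjacent, equals a_v^3, counted if the targets are. *)
Lemma edge_target v u : v != u ->
  e v u = e (target v) (target u) /\ (e v u -> a u (target u) = a v (target v) ^+ 2).
Proof.
move=> ne; have nt : target v != target u by apply: contra ne => /eqP /target_inj ->.
have z : a v (target u) = 0 by apply: row_zero; rewrite eq_sym.
have [h1 h2 _ _] := coefficients v nt.
rewrite z !mulr0 !mul0r add0r addr0 -h1 -h2 z expr0n addr0 N_target.
have nv := target_neq0 v; have nu := target_neq0 u.
case: (e v u); case: (e _ _); rewrite ?mul1r ?mul0r ?mulr0 => h.
- by split=> // _; apply: (mulfI nv); rewrite h exprS.
- by move/eqP: h; rewrite mulf_eq0 (negPf nv) (negPf nu).
- by have := expf_neq0 3 nv; rewrite -h eqxx.
- by split.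
Qed.

(** For a neighbour u, a_u = a_v^2 and a_v = a_u^2, so a_v = a_v^4 and a_v is a rational cube root
    of 1. *)
Lemma entry_one v : a v (target v) = 1.
Proof.
have [u vu] := e_nbr v; have ne : v != u by apply: contraTneq vu => ->; rewrite e_irr.
have [_ /(_ vu) h1] := edge_target ne.
rewrite eq_sym in ne; rewrite e_sym in vu; have [_ /(_ vu) h2] := edge_target ne.
have := target_neq0 v; move: h2; rewrite h1; move: (a v _) => x hx nx.
by apply: cube_root_one; apply: (mulfI nx); rewrite -exprS mulr1 [RHS]hx -exprM.
Qed.

Lemma rigidity : exists2 s : {perm V}, s \in graph_aut e &
  (forall v, c v = 0) /\ forall v w, a v w = (w == s v)%:R.
Proof.
exists (perm target_inj).
  apply/graph_autP => v w; rewrite !permE; case: (eqVneq v w) => [->|ne].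
    by rewrite !e_irr.
  by case: (edge_target ne).
split=> [|v w]; first exact: shift_zero.
rewrite permE; case: eqP => [->|/eqP]; [exact: entry_one|exact: row_zero].
Qed.

End Rigidity.

(** * A self-equivalence on the even generators *)

Section Analysis.
Variables (V : finType) (e : rel V) (A : freeAlg (EvG V) (OdG V)).
Local Notation G := (freeGca A (@degE_even V) (@degO_odd V)).
Local Notation ev := (ev A).
Local Notation od := (od A).
Local Notation m := (mmon ev).
Local Notation gx1 := (gx1 V).
Local Notation gx2 := (gx2 V).
Local Notation gy1 := (gy1 V).
Local Notation gy2 := (gy2 V).
Local Notation gy3 := (gy3 V).
Local Notation gz := (gz V).
Local Notation d := (dif (Theta e A)).
Local Notation M := (sul_cdga (Mdl e A)).
Implicit Types (u q : A) (t : EvG V -> rat) (f g h : dgMorphism M M).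
Local Arguments Theta : simpl never.

(** Polynomials in the even generators alone. *)
Definition delfree u := forall j, del A j u = 0.

Lemma delfreeM u q : delfree u -> delfree q -> delfree (u * q).
Proof.
move=> hu hq j.
by rewrite (del_mul (@degE_even V) (@degO_odd V)) hu hq mul0r mulr0 addr0.
Qed.

Lemma delfreeP a u q : delfree u -> delfree q -> delfree (a *: u + q).
Proof. by move=> hu hq j; rewrite linearP /= hu hq scaler0 addr0. Qed.

Lemma delfree0 : delfree 0.
Proof. by move=> j; rewrite linear0. Qed.

Lemma delfreeZ a u : delfree u -> delfree (a *: u).
Proof. by move=> hu; rewrite -[_ *: u]addr0; apply: delfreeP => //; apply: delfree0. Qed.

Lemma delfreeD u q : delfree u -> delfree q -> delfree (u + q).
Proof. by move=> hu hq; rewrite -[u]scale1r; apply: delfreeP. Qed.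

Lemma delfreeX n u : delfree u -> delfree (u ^+ n).
Proof.
move=> h; elim: n => [|n IH] j; first exact: del1.
by rewrite exprS delfreeM.
Qed.

Lemma delfree_ev x : delfree (ev x).
Proof. by move=> j; apply: del_ev. Qed.

Lemma delfree_mmon (fe : EvG V -> A) a b : (forall x, delfree (fe x)) -> delfree (mmon fe a b).
Proof. by move=> h; rewrite mmon.unlock; apply: delfreeM; apply: delfreeX. Qed.

Lemma delfree_sum (P : pred V) (F : V -> A) : (forall v, P v -> delfree (F v)) ->
  delfree (\sum_(v | P v) F v).
Proof. by move=> h; elim/big_ind: _ => //; [apply: delfree0|apply: delfreeD]. Qed.

Lemma delfree_lin40 u : @homog G 40 u -> delfree u.
Proof.
move=> /homog40[a [b [c ->]]]; rewrite /lin40.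
apply: delfreeD; first by apply: delfreeD; apply: delfreeZ; apply: delfree_mmon; apply: delfree_ev.
by apply: delfree_sum => v _; apply: delfreeZ; apply: delfree_ev.
Qed.

Lemma delfree_thetaOf_zv (fe : EvG V -> A) fo v : (forall x, delfree (fe x)) ->
  delfree (thetaOf e fe fo (gzv v)).
Proof.
move=> h /=; apply: delfreeD; first exact: delfreeX.
by apply: delfree_sum => w _; apply: delfreeM; [apply: delfreeM|apply: delfree_mmon].
Qed.

(* Detects the coefficient of the non-pure term [y1 y2 x1^4 x2^2] of [d z].    *)
Definition detect u : rat^o := eval A (point 1 1 (fun=> 0)) (del A gy2 (del A gy1 u)).

Lemma detect_linear : linear detect.
Proof. by move=> a u q; rewrite /detect !linearP. Qed.
HB.instance Definition _ := GRing.isLinear.Build rat A rat^o *:%R detect detect_linear.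

Lemma detect_delfree u : delfree u -> detect u = 0.
Proof. by rewrite /detect => ->; rewrite !linear0. Qed.

Lemma del_delfree j i p : delfree p -> del A j (od i * p) = (i == j)%:R *: p.
Proof. by move=> hp; rewrite del_od_mul hp mulr0 subr0. Qed.

Lemma detect_y1y2 p : delfree p ->
  detect (od gy1 * od gy2 * p) = eval A (point 1 1 (fun=> 0)) p.
Proof.
move=> hp; rewrite /detect -mulrA del_od_mul (del_delfree gy1 gy2 hp) eqxx scale1r.
by rewrite scale0r mulr0 subr0 del_delfree // eqxx scale1r.
Qed.

Lemma detect_y1y3 p : delfree p -> detect (od gy1 * od gy3 * p) = 0.
Proof.
move=> hp; rewrite /detect -mulrA del_od_mul (del_delfree gy1 gy3 hp) eqxx scale1r.
by rewrite scale0r mulr0 subr0 del_delfree // scale0r linear0.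
Qed.

Lemma detect_y2y3 p : delfree p -> detect (od gy2 * od gy3 * p) = 0.
Proof.
move=> hp; rewrite /detect -mulrA del_od_mul (del_delfree gy1 gy3 hp).
by rewrite !scale0r mulr0 subr0 !linear0.
Qed.

Lemma detect_thetaOf_z (fe : EvG V -> A) (fo : OdG V -> A) (c : OdG V -> rat) :
  (forall x, delfree (fe x)) -> fo gy1 = c gy1 *: od gy1 -> fo gy2 = c gy2 *: od gy2 ->
  fo gy3 = c gy3 *: od gy3 ->
  detect (thetaOf e fe fo gz) = c gy1 * c gy2 * eval A (point 1 1 (fun=> 0)) (mmon fe 4 2).
Proof.
move=> h h1 h2 h3 /=; have hm a b := delfree_mmon a b h.
rewrite linearD linearD /= (detect_delfree (hm 15%N 0%N)) (detect_delfree (hm 0%N 12%N)) !addr0.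
have sc a b u v w : a *: u * (b *: v) * w = (a * b) *: (u * v * w) :> A.
  by rewrite -scalerAl -scalerAr scalerA -scalerAl.
rewrite /omegaOf h1 h2 h3 !sc linearD linearB !linearZ /= detect_y1y2 //.
by rewrite detect_y1y3 // detect_y2y3 // !scaler0 subr0 addr0.
Qed.

Variables f g : dgMorphism M M.
Hypothesis gf : forall x, g (f (ev x)) = ev x.

Lemma image_y j : (j = gy1 \/ j = gy2 \/ j = gy3) -> exists c, f (od j) = c *: od j.
Proof.
by move=> hj; apply: (homog_y hj); apply: dgm_homog; apply: homog_od.
Qed.

Lemma image_x1 : exists2 a, a != 0 & f (ev gx1) = a *: ev gx1.
Proof.
have hx := homog_ev A (@degE_even V) (@degO_odd V) gx1.
have [a ea] := homog8 (dgm_homog f hx); have [b eb] := homog8 (dgm_homog g hx).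
exists a => //; apply/eqP => a0; have := gf gx1; rewrite ea a0 scale0r linear0.
by move/(congr1 (eval A (fun=> 1))); rewrite eval_ev linear0 => /eqP; rewrite eq_sym oner_eq0.
Qed.

Lemma image_x2 : exists2 a, a != 0 & f (ev gx2) = a *: ev gx2.
Proof.
have hx := homog_ev A (@degE_even V) (@degO_odd V) gx2.
have [a ea] := homog10 (dgm_homog f hx); have [b eb] := homog10 (dgm_homog g hx).
exists a => //; apply/eqP => a0; have := gf gx2; rewrite ea a0 scale0r linear0.
by move/(congr1 (eval A (fun=> 1))); rewrite eval_ev linear0 => /eqP; rewrite eq_sym oner_eq0.
Qed.

Lemma delfree_image x : delfree (f (ev x)).
Proof.
case: x => [[]|v].
- by have [a _ ->] := image_x1; apply/delfreeZ/delfree_ev.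
- by have [a _ ->] := image_x2; apply/delfreeZ/delfree_ev.
apply: delfree_lin40; apply: dgm_homog.
exact: (homog_ev A (@degE_even V) (@degO_odd V) (inr v)).
Qed.

Lemma thetaOf_detect_eq0 v : detect (Theta e A (gzv v)) = 0.
Proof. by apply/detect_delfree/delfree_thetaOf_zv => x; apply: delfree_ev. Qed.

Lemma Theta_detect : detect (Theta e A gz) = 1.
Proof.
rewrite /Theta (detect_thetaOf_z (c := fun=> 1)) ?scale1r //; last exact: delfree_ev.
by rewrite eval_mmon /= !expr1n !mulr1.
Qed.

(** On the locus x1 x2 = 0 the x1^5 x2^4 term of d f(z) or d f(z_v) disappears. The coefficient c of
    z is read off separately by [detect], through the non-pure term. *)
Lemma image_z j : degO j = 119%N -> exists c (cw : V -> rat),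
  detect (f (Theta e A j)) = c /\
  forall t, t gx1 * t gx2 = 0 -> eval A t (f (Theta e A j)) =
    c * (t gx1 ^+ 15 + t gx2 ^+ 12) + \sum_w cw w * (t (gxv w) ^+ 3 +
      \sum_(u | e w u) t (gxv w) * t (gxv u) * t gx2 ^+ 4).
Proof.
move=> dj; have : @homog G 119 (f (od j)).
  by rewrite -dj; apply: dgm_homog; apply: homog_od.
move=> /homog119[c [cw [q1 [q2 [q3 [h1 h2 h3 E]]]]]].
have -> : f (Theta e A j) = d (lin119 c cw q1 q2 q3) by rewrite -E -dgm_dif dif_od.
exists c, cw; rewrite dif_lin119; try exact: ec_lin40.
split=> [|t t0].
  rewrite linearD linearD linearZ linear_sum /= Theta_detect big1 => [|v _]; last first.
    by rewrite linearZ /= thetaOf_detect_eq0 scaler0.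
  rewrite detect_delfree ?addr0 ?[LHS]mulr1 //.
  apply: delfreeM; first by apply: delfree_mmon; apply: delfree_ev.
  by apply: delfreeD; [apply: delfreeD|]; apply: delfree_lin40.
rewrite eval_comb eval_Theta_z.
have -> : t gx1 ^+ 5 * t gx2 ^+ 4 = 0.
  by move/eqP: t0; rewrite mulf_eq0 => /orP[]/eqP->; rewrite expr0n ?mul0r ?mulr0.
rewrite mul0r addr0; congr (_ + _); apply: eq_bigr => w _.
by rewrite eval_Theta_zv.
Qed.

Lemma image_x1x2 : f (ev gx1) = ev gx1 /\ f (ev gx2) = ev gx2.
Proof.
have [a1 a1n E1] := image_x1; have [a2 a2n E2] := image_x2.
have y1 : gy1 = gy1 \/ gy1 = gy2 \/ gy1 = gy3 by left.
have y2 : gy2 = gy1 \/ gy2 = gy2 \/ gy2 = gy3 by right; left.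
have y3 : gy3 = gy1 \/ gy3 = gy2 \/ gy3 = gy3 by right; right.
have [c1 F1] := image_y y1; have [c2 F2] := image_y y2; have [c3 F3] := image_y y3.
pose t x := eval A (point 1 1 (fun=> 0)) (f (ev x)).
have t1 : t gx1 = a1 by rewrite /t E1 linearZ /= eval_ev; apply: mulr1.
have t2 : t gx2 = a2 by rewrite /t E2 linearZ /= eval_ev; apply: mulr1.
have hm p a b : eval A p (mmon (f \o ev) a b) = (a1 * p gx1) ^+ a * (a2 * p gx2) ^+ b.
  by rewrite mmon.unlock rmorphM !rmorphXn /= E1 E2 !linearZ /= !eval_ev.
have fy j c a b : f (od j) = c *: od j -> Theta e A j = m a b -> c = a1 ^+ a * a2 ^+ b.
  move=> Fj Tj; have := dgm_dif f (od j); rewrite Fj linearZ /= dif_od Tj.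
  move/(congr1 (eval A (point 1 1 (fun=> 0)))).
  rewrite (rmorph_mmon (gcm_fun f)) hm linearZ /= eval_mmon /= !mulr1 !expr1n mulr1 => ->.
  by rewrite [RHS]mulr1.
have c1E := fy gy1 c1 3%N 1%N F1 erefl; have c2E := fy gy2 c2 2%N 2%N F2 erefl.
have [c [cw [hd he]]] := image_z (j := gz) erefl.
have eTz p : eval A p (f (Theta e A gz)) = (a1 * p gx1) ^+ 15 + (a2 * p gx2) ^+ 12.
  have w0 : eval A p (omegaOf (f \o ev) (f \o od)) = 0.
    rewrite /omegaOf rmorphD rmorphB !rmorphM /= F1 F2 F3 !linearZ /= !eval_od !scaler0 !mul0r.
    by rewrite scale0r !addr0.
  by rewrite dgm_Theta /= rmorphD rmorphD /= w0 !hm add0r mulr1 mul1r.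
have zv p : p gx1 * p gx2 = 0 -> (forall v, p (gxv v) = 0) ->
    (a1 * p gx1) ^+ 15 + (a2 * p gx2) ^+ 12 = c * (p gx1 ^+ 15 + p gx2 ^+ 12).
  move=> p0 pv; rewrite -eTz he // big1 ?addr0 // => w _.
  by rewrite pv expr0n add0r big1 ?mulr0 // => u _; rewrite !mul0r.
have cA : c = a1 ^+ 15.
  have := zv (point 1 0 (fun=> 0)) (mulr0 _) (fun=> erefl).
  by rewrite /= mulr0 !expr0n expr1n !addr0 !mulr1.
have cB : c = a2 ^+ 12.
  have := zv (point 0 1 (fun=> 0)) (mul0r _) (fun=> erefl).
  by rewrite /= mulr0 !expr0n expr1n !add0r !mulr1.
(* The y1 y2 term is scaled by (a1^3 a2)(a1^2 a2^2)(a1^4 a2^2), the first two factors being the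
   scalars of y1 and y2. *)
have cC : c = a1 ^+ 9 * a2 ^+ 5.
  rewrite -hd dgm_Theta (detect_thetaOf_z (c := fun j => if j == gy1 then c1 else if j == gy2 then c2 else c3)) //.
    by rewrite /= hm /= !mulr1 c1E c2E; ring.
  exact: delfree_image.
have e1 : a1 ^+ 6 = a2 ^+ 5.
  apply: (mulfI (expf_neq0 9 a1n)); rewrite -exprD -cC cA.
  by [].
have e2 : a1 ^+ 9 = a2 ^+ 7.
  apply: (mulIf (expf_neq0 5 a2n)); rewrite -exprD -cC cB.
  by [].
(* From a1^6 = a2^5 and a1^9 = a2^7: a2^15 = a1^18 = a2^14. *)
have a21 : a2 = 1.
  apply: (mulfI (expf_neq0 14 a2n)); rewrite mulr1 -exprSr.
  by rewrite -[15%N]/(5 * 3)%N -[14%N]/(7 * 2)%N !exprM -e1 -e2 -!exprM.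
have a11 : a1 = 1.
  have x3 : a1 ^+ 3 = 1.
    have h6 : a1 ^+ 6 = 1 by rewrite e1 a21 expr1n.
    have h9 : a1 ^+ 9 = 1 by rewrite e2 a21 expr1n.
    by rewrite -h9 -[9%N]/(6 + 3)%N exprD h6 mul1r.
  exact: cube_root_one.
by rewrite E1 E2 a11 a21 !scale1r.
Qed.

Hypotheses (e_sym : symmetric e) (e_irr : irreflexive e).
Hypothesis e_nbr : forall v, exists w, e v w.

Definition relabel (s : {perm V}) (x : EvG V) : EvG V :=
  match x with inl b => inl b | inr v => inr (s v) end.

Lemma linear_lin40 (phi : {linear A -> rat^o}) a b (c : V -> rat) : phi (lin40 A a b c) =
  a * phi (m 5 0) + b * phi (m 0 4) + \sum_v c v * phi (ev (gxv v)).
Proof.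
rewrite /lin40 linearD linearD !linearZ /= linear_sum; congr (_ + _).
by apply: eq_bigr => v _; rewrite linearZ.
Qed.

Lemma homog40_choice h : exists p : V -> rat * rat * (V -> rat),
  forall v, h (ev (gxv v)) = lin40 A (p v).1.1 (p v).1.2 (p v).2.
Proof.
have hx v : exists q : rat * rat * (V -> rat), h (ev (gxv v)) = lin40 A q.1.1 q.1.2 q.2.
  have [a [b [c E]]] := homog40 (dgm_homog h (homog_ev A (@degE_even V) (@degO_odd V) (gxv v))).
  by exists (a, b, c).
by have [p hp] := boolp.choice hx; exists p.
Qed.

(** Evaluation of g(f(x_v)) = x_v at points with x1 = x2 = 0, where the decomposable terms x1^5 and
    x2^4 contribute nothing. *)
Lemma inverse_matrix (p q : V -> rat * rat * (V -> rat)) :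
  (forall v, f (ev (gxv v)) = lin40 A (p v).1.1 (p v).1.2 (p v).2) ->
  (forall v, g (ev (gxv v)) = lin40 A (q v).1.1 (q v).1.2 (q v).2) ->
  forall v u : V, \sum_w (p v).2 w * (q w).2 u = (v == u)%:R.
Proof.
move=> hp hq v u; pose t := point 0 0 (fun w : V => (w == u)%:R).
have tg1 : eval A t (g (ev gx1)) = 0.
  have [a ->] := homog8 (dgm_homog g (homog_ev A (@degE_even V) (@degO_odd V) gx1)).
  by rewrite linearZ /= eval_ev scaler0.
have tg2 : eval A t (g (ev gx2)) = 0.
  have [a ->] := homog10 (dgm_homog g (homog_ev A (@degE_even V) (@degO_odd V) gx2)).
  by rewrite linearZ /= eval_ev scaler0.
have tgm a b : eval A t (g (m a b)) = 0 ^+ a * 0 ^+ b.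
  by rewrite (rmorph_mmon (gcm_fun g)) mmon.unlock rmorphM !rmorphXn /= tg1 tg2.
have := congr1 (eval A t) (gf (gxv v)); rewrite hp eval_ev /= => <-.
rewrite [RHS](linear_lin40 (eval A t \o gcm_fun g)) /= !tgm !expr0n /= !(mulr0, mul0r, add0r).
apply: eq_bigr => w _; rewrite hq eval_lin40 /= !expr0n !mulr0 !add0r.
by rewrite sum_delta.
Qed.

Lemma equivalence_relabels : exists2 s : {perm V}, s \in graph_aut e &
  forall x, f (ev x) = ev (relabel s x).
Proof.
have [f1 f2] := image_x1x2.
have [p hp] := homog40_choice f; have [q hq] := homog40_choice g.
have eTv t v : eval A t (f (Theta e A (gzv v))) = eval A t (f (ev (gxv v))) ^+ 3 +
    \sum_(u | e v u) eval A t (f (ev (gxv v))) * eval A t (f (ev (gxv u))) * t gx2 ^+ 4.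
  rewrite dgm_Theta /= rmorphD rmorphXn /= rmorph_sum; congr (_ + _); apply: eq_bigr => u _.
  by rewrite !rmorphM /= mmon.unlock rmorphM !rmorphXn /= f2 eval_ev mul1r.
have hz v : exists cw : V -> rat, forall t, t gx1 * t gx2 = 0 ->
    eval A t (f (Theta e A (gzv v))) = \sum_w cw w * (t (gxv w) ^+ 3 +
      \sum_(u | e w u) t (gxv w) * t (gxv u) * t gx2 ^+ 4).
  have [c [cw [hd he]]] := image_z (j := gzv v) erefl; exists cw => t t0.
  rewrite he // -hd detect_delfree ?mul0r ?add0r // dgm_Theta.
  by apply: delfree_thetaOf_zv => x; apply: delfree_image.
have [C hC] := boolp.choice hz.
(* At x1 = 1 and all other coordinates 0, f(d z_v) takes the value alpha^3, alpha being the
   coefficient of x1^5, while the right-hand side vanishes. *)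
have alpha0 v : (p v).1.1 = 0.
  have := hC v (point 1 0 (fun=> 0)) (mulr0 _); rewrite eTv hp eval_lin40 /=.
  rewrite sum_zero !expr0n mulr0 !addr0 expr1n mulr1 !big1 ?addr0.
  - by move/eqP; rewrite expf_eq0 => /eqP.
  - by move=> w _; rewrite big1 /= ?addr0 ?mulr0 // => u _; rewrite !mul0r.
  - by move=> u _; rewrite mulr0.
have [||s hs [b0 aE]] := @rigidity V e e_sym e_irr e_nbr (fun v => (p v).2) (fun w => (q w).2)
    (fun v => (p v).1.2) C.
- move=> v t; have := hC v (point 0 1 t) (mul0r _); rewrite eTv /= => E.
  transitivity (\sum_w C v w * (t w ^+ 3 + \sum_(u | e w u) t w * t u * 1 ^+ 4)); last first.
    by apply: eq_bigr => w _; congr (_ * (_ + _)); apply: eq_bigr => u _; rewrite expr1n mulr1.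
  rewrite -E; have L w : eval A (point 0 1 t) (f (ev (gxv w))) = \sum_x (p w).2 x * t x + (p w).1.2.
    by rewrite hp eval_lin40 /= expr0n expr1n mulr0 mulr1 add0r addrC.
  by rewrite L; congr (_ + _); apply: eq_bigr => u _; rewrite L expr1n mulr1.
- exact: inverse_matrix hp hq.
exists s => // -[[]|v] //=.
rewrite [LHS]hp alpha0 b0 /lin40 !scale0r !add0r (bigD1 (s v)) //= aE eqxx scale1r big1 ?addr0 //.
by move=> w /negPf ne; rewrite aE ne scale0r.
Qed.

End Analysis.

(** * The isomorphism with the automorphism group *)

Section Classes.
Variables (V : finType) (e : rel V) (A : freeAlg (EvG V) (OdG V)).
Local Notation ev := (ev A).
Local Notation od := (od A).
Local Notation M := (sul_cdga (Mdl e A)).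
Implicit Types (f g h : dgMorphism M M) (s t : {perm V}).
Local Arguments Theta : simpl never.

Definition relabel_od s (j : OdG V) : OdG V :=
  match j with inl b => inl b | inr v => inr (s v) end.

(** Invariance of adjacency under s lets the sum over neighbours in d z_v be reindexed to the one at
    s v. *)
Lemma relabel_exists s : s \in graph_aut e ->
  exists f, forall x, f (ev x) = ev (relabel s x).
Proof.
move=> /graph_autP hs.
have [||||f [fe _]] := @dgm_exists _ _ A _ _ (@degE_even V) (@degO_odd V) _
  (@Theta_homog V e A) (@Theta_closed V e A) M (fun x => ev (relabel s x))
  (fun j => od (relabel_od s j)); last by exists f.
- by move=> x; have := homog_ev A (@degE_even V) (@degO_odd V) (relabel s x); case: x => [[]|].
- by move=> j; have := homog_od A (@degE_even V) (@degO_odd V) (relabel_od s j);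
    case: j => [[[]|[]]|].
- by move=> x; apply: dif_ev.
move=> k ke ko j; rewrite [RHS]dif_od (rmorph_thetaOf e k).
have -> : Theta e A (relabel_od s j) =
    thetaOf e (ev \o relabel s) (od \o relabel_od s) j.
  case: j => [[[]|[]]|v]; rewrite /Theta /= ?/omegaOf ?mmon.unlock //=; congr (_ + _).
  rewrite (reindex_inj (@perm_inj _ s)) /=; apply: eq_big => [w|w _]; last by [].
  by rewrite -hs.
by apply: eq_thetaOf => [x|||] /=; rewrite ?ke ?ko.
Qed.

(** A full homotopy class when s is an automorphism, since homotopy is agreement on the x's
    ([hclass_relabel]). *)
Definition relabel_class s : classical_sets.set (dgMorphism M M) :=
  fun f => forall x, f (ev x) = ev (relabel s x).

Lemma hclass_relabel f s : (forall x, f (ev x) = ev (relabel s x)) ->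
  hclass f = relabel_class s.
Proof.
move=> hf; apply/boolp.funext => h; apply/boolp.propext; split.
  by move=> /homotopic_agree fh x; rewrite -fh hf.
by move=> hh; apply: agree_homotopic => x; rewrite hf hh.
Qed.

Lemma hmul_relabel s t : s \in graph_aut e -> t \in graph_aut e ->
  hmul (relabel_class t) (relabel_class s) = relabel_class (s * t)%g.
Proof.
move=> /relabel_exists[f hf] /relabel_exists[g hg].
have comp x : relabel t (relabel s x) = relabel (s * t)%g x.
  by case: x => //= v; rewrite permM.
apply/boolp.funext => h; apply/boolp.propext; split.
  move=> [g' [f' [hg' hf' /homotopic_agree E]]] x.
  by rewrite -E /= hf' hg' comp.
move=> hh; exists g, f; split=> //; apply: agree_homotopic => x /=.
by rewrite hf hg hh comp.
Qed.

Lemma hone_relabel : @hone M = relabel_class 1%g.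
Proof. by apply: hclass_relabel => -[b|v] //=; rewrite perm1. Qed.

Lemma relabel_class_inj : {in graph_aut e &, injective relabel_class}.
Proof.
move=> s t /relabel_exists[f hf] _ st; apply/permP => v.
have : relabel_class t f by rewrite -st.
move=> /(_ (gxv v)); rewrite hf => /(congr1 (cf A (mono_ev _ (gxv (s v))))).
rewrite !cf_bas eqxx; case: eqP => // -[/ffunP/(_ (gxv (t v)))].
by rewrite !ffunE eqxx; case: eqP => // -[].
Qed.

Hypotheses (e_sym : symmetric e) (e_irr : irreflexive e).
Hypothesis e_nbr : forall v, exists w, e v w.

Lemma relabel_class_iso : aut_iso_self_equivalences e M.
Proof.
exists relabel_class; split; [exact: relabel_class_inj| |by move=> s t hs ht; rewrite hmul_relabel].
move=> C; split.
  move=> [[f _ <-] [_ [[g _ <-] _ gf]]].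
  have refl h : hclass h h by apply: agree_homotopic.
  have : @hone M (dgm_id M) by apply: refl.
  (* The identity lies in the product class, so representatives satisfy g' f' homotopic to the
     identity, hence equal to it on the x's. *)
  rewrite -gf => -[g' [f' [_ ff' /homotopic_agree E]]].
  have [s hs hf'] := equivalence_relabels (f := f') (g := g') E e_sym e_irr e_nbr.
  exists s => //; apply: hclass_relabel => x.
  by rewrite (homotopic_agree ff').
move=> [s hs ->]; have hs' : s^-1%g \in graph_aut e by rewrite groupV.
have [f hf] := relabel_exists hs; have [g hg] := relabel_exists hs'.
split; first by exists f => //; apply: hclass_relabel.
exists (relabel_class s^-1%g); split; first by exists g => //; apply: hclass_relabel.
  by rewrite hmul_relabel // mulVg hone_relabel.
by rewrite hmul_relabel // mulgV hone_relabel.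
Qed.

End Classes.

Lemma connected_neighbour (V : finType) (e : rel V) :
  (forall v w : V, connect e v w) -> (1 < #|V|)%N -> forall v, exists w, e v w.
Proof.
move=> conn /card_gt1P[x [y [_ _ xy]]] v.
have [w vw] : exists w, v != w.
  by case: (eqVneq v x) => [->|]; [exists y|exists x].
have /connectP[[|u p] /=] := conn v w; first by move=> _ /eqP; rewrite eq_sym (negPf vw).
by move=> /andP[vu _] _; exists u.
Qed.

Local Close Scope ring_scope.

Theorem theorem1p2 (V : finType) (e : rel V)
    (e_sym : symmetric e) (e_irr : irreflexive e)
    (e_conn : forall v w : V, connect e v w) (V_gt1 : 1 < #|V|) :
  exists M : sullivan,
    [/\ minimal M, elliptic M & aut_iso_self_equivalences e M].
Proof.
exists (Mdl e (free_alg (EvG V) (OdG V))); split.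
- exact: Mdl_minimal.
- exact: Mdl_elliptic.
- exact: relabel_class_iso (connected_neighbour e_conn V_gt1).
Qed.
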